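(* Consider the first-order autoregressive change model, the constant $\mathcal K>0$ and the Ergodic CuSum stopping time $\tau_c^*$ described in the context. For $\gamma>0$ let $c=\log\gamma$. Then: 1) $\mathbb{E}_\infty[\tau_c^*]\ge\gamma$; 2) as $\gamma\to\infty$, $\ \mathrm{WADD}(\tau_c^* )\le\dfrac{\log\gamma}{\mathcal K}(1+o(1))$.
   Context: Model. Fix $K\ge1$, an invertible matrix $\bm A\in\mathbb{R}^{K\times K}$ with operator norm $\|\bm A\|<1$, a positive definite matrix $\bm R_\omega\in\mathbb{R}^{K\times K}$, and a Gaussian probability density $f_1$ on $\mathbb{R}^K$. Observations $\bm y_1,\bm y_2,\dots\in\mathbb{R}^K$ are taken sequentially. For a deterministic change point $t_0\in\{1,2,\dots\}$, under the probability measure $\mathbb{P}_{t_0}$: $\bm y_t=\bm\nu_t$ for $t<t_0$ and $\bm y_t=\bm x_t+\bm\nu_t$ for $t\ge t_0$, where $\bm\nu_t\sim\mathcal N(\bm 0,\bm I)$ are i.i.d.; $\bm x_{t_0}$ has density $f_1$; $\bm x_t=\bm A\bm x_{t-1}+\bm\omega_t$ for $t>t_0$ with $\bm\omega_t\sim\mathcal N(\bm 0,\bm R_\omega)$ i.i.d.; and $(\bm\nu_t)$, $(\bm\omega_t)$, $\bm x_{t_0}$ are mutually independent. The signal $\bm x_t$ is not observed. Under $\mathbb{P}_\infty$ (no change), $\bm y_t=\bm\nu_t$ for all $t$. Densities of the observations under $\mathbb{P}_{t_0}$ and $\mathbb{P}_\infty$ are written $p_{t_0}$ and $p_\infty$;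 expectations are $\mathbb{E}_{t_0}$ and $\mathbb{E}_\infty$. Criteria. $\mathcal F_t=\sigma(\bm y_1,\dots,\bm y_t)$. For a stopping time $\tau$ with respect to $(\mathcal F_t)$, $\mathrm{WADD}(\tau)=\sup_{t_0\ge1}\operatorname{ess\,sup}\ \mathbb{E}_{t_0}[(\tau-t_0)^+\mid \bm y_1,\dots,\bm y_{t_0-1}]$. Constant. $\mathcal K$ is the constant, which exists, is positive and does not depend on $t_0$, with $\lim_{t\to\infty}\frac1t\log\frac{p_{t_0}(\bm y_{t_0},\dots,\bm y_{t_0+t-1})}{p_\infty(\bm y_{t_0},\dots,\bm y_{t_0+t-1})}=\mathcal K$ $\mathbb{P}_{t_0}$-almost surely. Ergodic CuSum. Let $L_0=1$ and, for $t\ge1$, $L_t=\dfrac{p_1(\bm y_1,\dots,\bm y_t)}{p_\infty(\bm y_1,\dots,\bm y_t)}$ (the likelihood ratio for change point $1$ against no change, whatever the true change point). Let $S_t=\max_{0\le i\le t}(\log L_t-\log L_i)$, equivalently $S_0=0$, $S_t=\max(0,S_{t-1}+\log L_t-\log L_{t-1})$. Then $\tau_c^*=\inf\{t\ge1:S_t\ge c\}$. *)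

(* Defs.v *)
From HB Require Import structures.
From mathcomp Require Import all_boot all_order all_algebra finmap.
From mathcomp Require Import all_classical all_reals all_analysis.
From mathcomp Require Import measurable_realfun ess_sup_inf.

Set Implicit Arguments.
Unset Strict Implicit.
Unset Printing Implicit Defensive.

Import Order.TTheory GRing.Theory Num.Theory.
Import numFieldNormedType.Exports.

Local Open Scope classical_set_scope.
Local Open Scope ring_scope.

(** * Lebesgue measure on spaces of real matrices *)

(* An m x n matrix is a point of R^(m * n); a vector of R^K is a K x 1 matrix.
   The sigma-algebra is the product Borel sigma-algebra, generated by the
   entries. *)
Definition measure_matrix_display : measure_display.
Proof. exact: default_measure_display. Qed.

Section measurable_matrix.
Context (R : realType) (m n : nat).

Definition measurable_mx : set (set 'M[R]_(m, n)) :=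
  <<s \bigcup_(ij : 'I_m * 'I_n)
        preimage_set_system setT (fun M : 'M[R]_(m, n) => M ij.1 ij.2)
          (@measurable _ R) >>.

Let measurable_mx0 : measurable_mx set0.
Proof. exact: sigma_algebra0. Qed.

Let measurable_mxC A : measurable_mx A -> measurable_mx (~` A).
Proof. exact: sigma_algebraC. Qed.

Let measurable_mx_bigcup (F : (set 'M[R]_(m, n))^nat) :
  (forall i, measurable_mx (F i)) -> measurable_mx (\bigcup_i (F i)).
Proof. exact: sigma_algebra_bigcup. Qed.

HB.instance Definition _ := @isMeasurable.Build measure_matrix_display
  'M[R]_(m, n) measurable_mx measurable_mx0 measurable_mxC measurable_mx_bigcup.

End measurable_matrix.

Lemma measurable_entry (R : realType) (m n : nat) (i : 'I_m) (j : 'I_n) :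
  measurable_fun [set: 'M[R]_(m, n)] (fun M : 'M[R]_(m, n) => M i j).
Proof.
move=> _ B mB; apply: sub_sigma_algebra; exists (i, j) => //=.
by exists B.
Qed.

Lemma measurable_fun_mxP d (T : measurableType d) (R : realType) (m n : nat)
    (f : T -> 'M[R]_(m, n)) :
  measurable_fun [set: T] f <->
  forall i j, measurable_fun [set: T] (fun w => f w i j).
Proof.
split=> [mf i j|mf].
  exact: (measurableT_comp (measurable_entry i j) mf).
have mxf : @measurable_mx R m n `<=` image_set_system setT f (@measurable _ T).
  apply: smallest_sub.
    by apply: sigma_algebra_image; exact: sigma_algebra_measurable.
  move=> _ [[i j] _ [B mB <-]]; rewrite /image_set_system /= setTI.
  by have := mf i j measurableT B mB.
by move=> _ A /mxf.
Qed.

Section pushforward_measure_facts.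
Context d1 d2 (T1 : measurableType d1) (T2 : measurableType d2) (R : realType).
Variables (mu : {measure set T1 -> \bar R}) (f : T1 -> T2) (g : T2 -> T1).
Hypotheses (mf : measurable_fun setT f) (mg : measurable_fun setT g).
Hypothesis fK : cancel f g.

Lemma pushforward_set0 : pushforward mu f set0 = 0%E.
Proof. by rewrite /pushforward preimage_set0 measure0. Qed.

Lemma pushforward_sigma_additive : semi_sigma_additive (pushforward mu f).
Proof.
move=> F mF tF mUF; rewrite /pushforward preimage_bigcup.
apply: measure_semi_sigma_additive.
- by move=> n; rewrite -[X in measurable X]setTI; exact: mf.
- apply/trivIsetP => /= i j _ _ ij; rewrite -preimage_setI.
  by move/trivIsetP : tF => /(_ _ _ _ _ ij) ->//; rewrite preimage_set0.
- by rewrite -preimage_bigcup -[X in measurable X]setTI; exact: mf.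
Qed.

Lemma pushforward_sigma_finite :
  sigma_finite setT mu -> sigma_finite setT (pushforward mu f).
Proof.
move=> [F TF Foo].
exists (fun k => g @^-1` F k); first by rewrite -preimage_bigcup -TF.
move=> k; have [mFk Fkoo] := Foo k; split.
  by rewrite -[X in measurable X]setTI; exact: mg.
rewrite /pushforward -comp_preimage (_ : g \o f = id)//.
by apply/funext => x /=; rewrite fK.
Qed.

End pushforward_measure_facts.

Lemma product_measure1_sigma_finite d1 d2 (T1 : measurableType d1)
    (T2 : measurableType d2) (R : realType)
    (m1 : {sigma_finite_measure set T1 -> \bar R})
    (m2 : {sigma_finite_measure set T2 -> \bar R}) :
  sigma_finite setT (m1 \x m2)%E.
Proof.
have /sigma_finiteP[F [TF ndF Foo]] := sigma_finiteT m1.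
have /sigma_finiteP[G [TG ndG Goo]] := sigma_finiteT m2.
exists (fun n => F n `*` G n).
 rewrite -setXTT TF TG predeqE => -[x y]; split.
    move=> [/= [n _ Fnx] [k _ Gky]]; exists (maxn n k) => //; split.
    - by move: x Fnx; exact/subsetPset/ndF/leq_maxl.
    - by move: y Gky; exact/subsetPset/ndG/leq_maxr.
  by move=> [n _ []/= ? ?]; split; exists n.
move=> k; have [? ?] := Foo k; have [? ?] := Goo k.
split; first exact: measurableX.
by rewrite product_measure1E// lte_mul_pinfty// ge0_fin_numE.
Qed.

Section lebesgue_tuple.
Context (R : realType).
Local Notation RR := (measurableTypeR R).

Definition cons_pair n (xt : RR * n.-tuple RR) : n.+1.-tuple RR :=
  [tuple of xt.1 :: xt.2].

Definition uncons n (t : n.+1.-tuple RR) : RR * n.-tuple RR :=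
  (thead t, [tuple of behead t]).

Lemma measurable_cons_pair n : measurable_fun setT (@cons_pair n).
Proof. exact: (measurable_cons measurable_fst measurable_snd). Qed.

Lemma measurable_uncons n : measurable_fun setT (@uncons n).
Proof.
apply: measurable_fun_pair => /=; first exact: (measurable_tnth ord0).
exact: measurable_behead.
Qed.

Lemma cons_pairK n : cancel (@cons_pair n) (@uncons n).
Proof. by case=> x t; rewrite /uncons theadE; congr pair; apply: val_inj. Qed.

Section step.
Variables (n : nat) (mu : {sigma_finite_measure set (n.-tuple RR) -> \bar R}).

Definition lebesgue_cons : set (n.+1.-tuple RR) -> \bar R :=
  pushforward (@lebesgue_measure R \x mu)%E (@cons_pair n).

Let lebesgue_cons0 : lebesgue_cons set0 = 0%E.
Proof. exact: pushforward_set0. Qed.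

Let lebesgue_cons_ge0 A : (0 <= lebesgue_cons A)%E.
Proof. exact: (measure_ge0 (@lebesgue_measure R \x mu)%E). Qed.

Let lebesgue_cons_sigma_additive : semi_sigma_additive lebesgue_cons.
Proof.
exact: (@pushforward_sigma_additive _ _ _ _ _ (@lebesgue_measure R \x mu)%E _
  (@measurable_cons_pair n)).
Qed.

HB.instance Definition _ := isMeasure.Build _ _ _ lebesgue_cons
  lebesgue_cons0 lebesgue_cons_ge0 lebesgue_cons_sigma_additive.

Let lebesgue_cons_sigma_finite : sigma_finite setT lebesgue_cons.
Proof.
apply: (pushforward_sigma_finite (@measurable_uncons n) (@cons_pairK n)).
exact: product_measure1_sigma_finite.
Qed.

HB.instance Definition _ := Measure_isSigmaFinite.Build _ _ _ lebesgue_cons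
  lebesgue_cons_sigma_finite.

End step.

Fixpoint lebesgue_tuple n : {sigma_finite_measure set (n.-tuple RR) -> \bar R} :=
  match n with
  | 0 => dirac ([tuple] : 0.-tuple RR)
  | n'.+1 => lebesgue_cons (lebesgue_tuple n')
  end.

End lebesgue_tuple.

Section lebesgue_mx.
Context (R : realType) (m n : nat).

Definition mx_of_tuple (t : (m * n).-tuple (measurableTypeR R)) : 'M[R]_(m, n) :=
  \matrix_(i, j) tnth t (mxvec_index i j).

Definition tuple_of_mx (M : 'M[R]_(m, n)) : (m * n).-tuple (measurableTypeR R) :=
  [tuple mxvec M ord0 k | k < m * n].

Lemma measurable_mx_of_tuple : measurable_fun setT mx_of_tuple.
Proof.
apply/measurable_fun_mxP => i j; rewrite (_ : (fun _ => _) =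
  (fun t : (m * n).-tuple (measurableTypeR R) => tnth t (mxvec_index i j))).
  exact: measurable_tnth.
by apply/funext => t; rewrite mxE.
Qed.

Lemma measurable_tuple_of_mx : measurable_fun setT tuple_of_mx.
Proof.
apply/measurable_fun_tnthP => k; case/mxvec_indexP: k => i j.
rewrite (_ : _ \o _ = (fun M : 'M[R]_(m, n) => M i j)).
  exact: measurable_entry.
by apply/funext => M /=; rewrite tnth_mktuple mxvecE.
Qed.

Lemma mx_of_tupleK : cancel mx_of_tuple tuple_of_mx.
Proof.
move=> t; apply: eq_from_tnth => k; rewrite tnth_mktuple.
by case/mxvec_indexP: k => i j; rewrite mxvecE mxE.
Qed.

Definition lebesgue_mx : set 'M[R]_(m, n) -> \bar R :=
  pushforward (lebesgue_tuple R (m * n)) mx_of_tuple.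

Let lebesgue_mx0 : lebesgue_mx set0 = 0%E.
Proof. exact: pushforward_set0. Qed.

Let lebesgue_mx_ge0 A : (0 <= lebesgue_mx A)%E.
Proof. exact: (measure_ge0 (lebesgue_tuple R (m * n))). Qed.

Let lebesgue_mx_sigma_additive : semi_sigma_additive lebesgue_mx.
Proof.
exact: (@pushforward_sigma_additive _ _ _ _ _ (lebesgue_tuple R (m * n)) _
  measurable_mx_of_tuple).
Qed.

HB.instance Definition _ := isMeasure.Build _ _ _ lebesgue_mx
  lebesgue_mx0 lebesgue_mx_ge0 lebesgue_mx_sigma_additive.

Let lebesgue_mx_sigma_finite : sigma_finite setT lebesgue_mx.
Proof.
apply: (pushforward_sigma_finite measurable_tuple_of_mx mx_of_tupleK).
exact: sigma_finiteT.
Qed.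

HB.instance Definition _ := Measure_isSigmaFinite.Build _ _ _ lebesgue_mx
  lebesgue_mx_sigma_finite.

End lebesgue_mx.

(** * Linear algebra *)

Section linear_algebra.
Context (R : realType) (n : nat).
Implicit Types (v : 'cV[R]_n) (M : 'M[R]_n).

Definition euclidean_norm v : R := Num.sqrt (\sum_i v i ord0 ^+ 2).

Definition operator_norm M : R :=
  sup [set euclidean_norm (M *m v) | v in [set v | euclidean_norm v <= 1]].

Definition posdefmx M : Prop :=
  M^T = M /\ forall v, v != 0 -> 0 < (v^T *m M *m v) ord0 ord0.

(* Density of N(mu, S); only meaningful for positive definite S. *)
Definition gaussian_pdf (mu : 'cV[R]_n) (S : 'M[R]_n) (x : 'cV[R]_n) : R :=
  (Num.sqrt ((2 * pi) ^+ n * \det S))^-1 *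
  expR (- (((x - mu)^T *m invmx S *m (x - mu)) ord0 ord0 / 2)).

Definition is_gaussian_pdf (f : 'cV[R]_n -> R) : Prop :=
  exists (mu : 'cV[R]_n) (S : 'M[R]_n), posdefmx S /\ f = gaussian_pdf mu S.

End linear_algebra.

(** * Probability *)

Section probability_notions.
Context d (Omega : measurableType d) (R : realType) (P : probability Omega R).

Definition has_density m n (X : Omega -> 'M[R]_(m, n)) (f : 'M[R]_(m, n) -> R)
    : Prop :=
  [/\ measurable_fun [set: Omega] X,
      measurable_fun [set: 'M[R]_(m, n)] f,
      (forall x, 0 <= f x) &
      forall B : set 'M[R]_(m, n), measurable B ->
        P (X @^-1` B) = (\int[@lebesgue_mx R m n]_(x in B) (f x)%:E)%E].

Definition mutually_independent (I : choiceType) (D : set I)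
    (G : I -> set (set Omega)) : Prop :=
  forall (J : {fset I}) (E : I -> set Omega),
    [set` J] `<=` D -> (forall i, i \in J -> G i (E i)) ->
    P (\bigcap_(i in [set` J]) E i) = (\prod_(i <- J) P (E i))%E.

Definition sigma_vec m n (X : Omega -> 'M[R]_(m, n)) : set (set Omega) :=
  preimage_set_system [set: Omega] X measurable.

Definition sigma_process m n (D : set nat) (X : nat -> Omega -> 'M[R]_(m, n))
    : set (set Omega) :=
  <<s \bigcup_(t in D) sigma_vec (X t) >>.

(* Z is a version of E[X | F], for a sub-sigma-algebra F and X >= 0. *)
Definition is_condexp (F : set (set Omega)) (X Z : Omega -> \bar R) : Prop :=
  [/\ (forall B : set (\bar R), measurable B -> F (Z @^-1` B)),
      (forall w, (0 <= Z w)%E) &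
      forall E, F E -> (\int[P]_(w in E) Z w = \int[P]_(w in E) X w)%E].

End probability_notions.

(* Versions of the conditional expectation exist, so that the supremum over
   versions in [wadd] is not taken over an empty set. *)
Section condexp_exists.
Local Open Scope ereal_scope.
Context d (Omega : measurableType d) (R : realType) (P : probability Omega R).
Variables (F : set (set Omega)).
Hypothesis sF : sigma_algebra setT F.
Hypothesis FM : F `<=` measurable.

Local Notation T := (g_sigma_algebraType F).

Let measurableFE : (@measurable _ T) = F.
Proof. exact: sigma_algebra_id. Qed.

Definition trace_incl (w : Omega) : T := w.
Local Notation inc := trace_incl.

Let minc : measurable_fun setT inc.
Proof.
by move=> _ B mB; rewrite setTI; apply: FM; rewrite -measurableFE.
Qed.

Definition trace_measure : set T -> \bar R := pushforward P inc.
Local Notation mu := trace_measure.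
Let mu0 : mu set0 = 0. Proof. exact: pushforward_set0. Qed.
Let mu_ge0 A : 0 <= mu A. Proof. exact: (measure_ge0 P). Qed.
Let mu_sigma_additive : semi_sigma_additive mu.
Proof. exact: (@pushforward_sigma_additive _ _ _ _ _ P _ minc). Qed.
HB.instance Definition _ := isMeasure.Build _ _ _ mu
  mu0 mu_ge0 mu_sigma_additive.
Let mu_fin : fin_num_fun mu.
Proof.
by move=> A mA; apply: fin_num_measure; apply: FM; rewrite -measurableFE.
Qed.
HB.instance Definition _ := Measure_isFinite.Build _ _ _ mu mu_fin.

Section bounded.
Variable X : Omega -> \bar R.
Hypotheses (mX : measurable_fun setT X) (X0 : forall w, 0 <= X w)
  (X1 : forall w, X w <= 1).

Definition trace_integral (A : set T) : \bar R := \int[P]_(w in A) X w.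
Local Notation nu := trace_integral.
Let nu0 : nu set0 = 0. Proof. exact: integral_set0. Qed.
Let nu_ge0 A : 0 <= nu A. Proof. by apply: integral_ge0 => w _; exact: X0. Qed.

Let nu_sigma_additive : semi_sigma_additive nu.
Proof.
move=> G mG tG mUG; rewrite /nu ge0_integral_bigcup//; last 2 first.
- by move=> k; apply: FM; rewrite -measurableFE; exact: mG.
- exact: measurable_funTS.
apply/cvg_closeP; split; last by rewrite closeE.
by apply: is_cvg_nneseries => k _ _; exact: nu_ge0.
Qed.
HB.instance Definition _ := isMeasure.Build _ _ _ nu
  nu0 nu_ge0 nu_sigma_additive.
Let nu_fin : fin_num_fun nu.
Proof.
move=> A mA; rewrite ge0_fin_numE//.
have mA' : measurable (A : set Omega) by apply: FM; rewrite -measurableFE.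
apply: (@le_lt_trans _ _ (\int[P]_(w in A) cst 1 w)).
  by apply: ge0_le_integral => //; exact: measurable_funTS.
by rewrite integral_cst// mul1e -ge0_fin_numE// fin_num_measure.
Qed.
HB.instance Definition _ := Measure_isFinite.Build _ _ _ nu nu_fin.
Let nu_mu : nu `<< mu.
Proof.
apply/null_content_dominatesP => A mA muA; apply/eqP; rewrite eq_le nu_ge0 andbT.
have mA' : measurable (A : set Omega) by apply: FM; rewrite -measurableFE.
apply: (@le_trans _ _ (\int[P]_(w in A) cst 1 w)).
  by apply: ge0_le_integral => //; exact: measurable_funTS.
rewrite integral_cst// mul1e.
by move: muA; rewrite /mu /pushforward => ->.
Qed.

Lemma condexp_bounded : exists Z : T -> \bar R,
  [/\ measurable_fun setT Z, (forall w, 0 <= Z w) &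
   forall E, F E -> \int[mu]_(w in E) Z w = \int[P]_(w in E) X w].
Proof.
exists (Radon_Nikodym_SigmaFinite.f nu mu); split.
- exact: (measurable_int _ (Radon_Nikodym_SigmaFinite.f_integrable nu_mu)).
- exact: Radon_Nikodym_SigmaFinite.f_ge0.
- move=> E FE; rewrite -Radon_Nikodym_SigmaFinite.f_integral//.
  by rewrite measurableFE.
Qed.
End bounded.

Lemma is_condexp_exists (X : Omega -> \bar R) : measurable_fun setT X ->
  (forall w, 0 <= X w) -> exists Z, is_condexp P F X Z.
Proof.
move=> mX X0.
pose m (n : nat) w := mine (X w) n%:R%:E.
have mfin n w : m n w \is a fin_num.
  rewrite ge0_fin_numE; last by rewrite le_min X0 lee_fin ler0n.
  by rewrite (@le_lt_trans _ _ n%:R%:E) ?ltry// ge_min lexx orbT.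
have mm n : measurable_fun setT (m n) by exact: measurable_mine.
pose D n w := m n.+1 w - m n w.
have mD n : measurable_fun setT (D n) by apply: emeasurable_funB.
have D0 n w : 0 <= D n w.
  rewrite sube_ge0 ?mfin// le_min ge_min lexx /= ge_min lee_fin ler_nat leqnSn.
  by rewrite orbT.
have D1 n w : D n w <= 1.
  rewrite leeBlDr ?mfin// /m; have [Xn|nX] := leP (X w) n%:R%:E.
    by rewrite (@le_trans _ _ (X w)) ?ge_min ?lexx// leeDr.
  by rewrite ge_min -EFinD nat1r lexx orbT.
have sumD N w : \sum_(0 <= n < N) D n w = m N w.
  elim: N => [|N IH]; first by rewrite big_geq// /m; apply/esym/min_idPr.
  have DE : m N w + D N w = m N.+1 w.
    by rewrite /D addeC subeK.
  by rewrite big_nat_recr//= IH.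
have DX w : \sum_(n <oo) D n w = X w.
  apply: cvg_lim => //; under eq_fun do rewrite sumD.
  rewrite /m; have := X0 w; case: (X w) => [r r0| _|//].
    apply: cvg_near_cst; near=> N; apply/min_idPl; rewrite lee_fin.
    by near: N; exact: nbhs_infty_ger.
  under eq_fun do rewrite (min_idPr (leey _)).
  by apply/cvgeryP; exact: cvgr_idn.
have /choice[Z HZ] n := condexp_bounded (mD n) (D0 n) (D1 n).
exists (fun w => \sum_(n <oo) Z n w); split.
- move=> B mB; rewrite -measurableFE.
  have mZ : measurable_fun [set: T] (fun w => \sum_(n <oo) Z n w).
    apply: ge0_emeasurable_sum => [n x _ _|n _]; by have [] := HZ n.
  by rewrite -[X in measurable X]setTI; exact: mZ.
- by move=> w; apply: nneseries_ge0 => n _ _; have [] := HZ n.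
- move=> E FE.
  have mE : @measurable _ T E by rewrite measurableFE.
  transitivity (\int[mu]_(w in E) (\sum_(n <oo) Z n w)).
    rewrite ge0_integral_pushforward//.
    - apply: measurable_funTS; apply: ge0_emeasurable_sum => [n x _ _|n _];
        by have [] := HZ n.
    - by move=> w _; apply: nneseries_ge0 => n _ _; have [] := HZ n.
  rewrite integral_nneseries//; last 2 first.
    by move=> n; apply: measurable_funTS; have [] := HZ n.
    by move=> n w _; have [] := HZ n.
  transitivity (\sum_(n <oo) \int[P]_(w in E) D n w).
    by apply: eq_eseriesr => n _; have [_ _ ->] := HZ n.
  rewrite -integral_nneseries//; first last.
  + by move=> n; exact: measurable_funTS.
  + exact: FM.
  by apply: eq_integral => w _; exact: DX.
Unshelve. all: by end_near. Qed.
End condexp_exists.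

(** * The change model *)

(* The block (y_s, ..., y_(s + n - 1)), one observation per column. *)
Definition block (R : realType) (K : nat) (Omega : Type)
    (y : nat -> Omega -> 'cV[R]_K) (s n : nat) (w : Omega) : 'M[R]_(K, n) :=
  \matrix_(i < K, j < n) y (s + j)%N w i ord0.

Section model.
Context (R : realType) (K : nat) d (Omega : measurableType d).
Implicit Types (y : nat -> Omega -> 'cV[R]_K) (P : probability Omega R).

Definition no_change_model y P : Prop :=
  (forall t, (1 <= t)%N -> has_density P (y t) (gaussian_pdf 0 1%:M)) /\
  mutually_independent P [set t | (1 <= t)%N] (fun t => sigma_vec (y t)).

(* Times are natural numbers and observation starts at time 1: the values at 0
   of [y], [nu], and those of [x], [omega] before the change, are irrelevant. *)
Definition change_model (A Rw : 'M[R]_K) (f1 : 'cV[R]_K -> R) y (t0 : nat) P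
    : Prop :=
  exists nu x omega : nat -> Omega -> 'cV[R]_K,
    [/\ [/\ (forall t, (1 <= t)%N -> has_density P (nu t) (gaussian_pdf 0 1%:M)),
            mutually_independent P [set t | (1 <= t)%N]
              (fun t => sigma_vec (nu t)),
            (forall t, (t0 < t)%N -> has_density P (omega t) (gaussian_pdf 0 Rw)),
            mutually_independent P [set t | (t0 < t)%N]
              (fun t => sigma_vec (omega t)) &
            has_density P (x t0) f1],
        mutually_independent P [set: 'I_3] (tnth [tuple
          sigma_process [set t | (1 <= t)%N] nu;
          sigma_process [set t | (t0 < t)%N] omega;
          sigma_vec (x t0)]),
        (forall t, (t0 < t)%N ->
          \forall w \ae P, x t w = A *m x t.-1 w + omega t w),
        (forall t, (1 <= t < t0)%N -> \forall w \ae P, y t w = nu t w) &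
        (forall t, (t0 <= t)%N -> \forall w \ae P, y t w = x t w + nu t w)].

Definition filtration y (t : nat) : set (set Omega) :=
  sigma_process [set s | (1 <= s <= t)%N] y.

(* The essential supremum does not depend on the version [Z] of
   E_t0[(tau - t0)^+ | y_1, ..., y_(t0 - 1)]. *)
Definition wadd y (P : nat -> probability Omega R) (tau : Omega -> \bar R)
    : \bar R :=
  ereal_sup [set v | exists (t0 : nat) (Z : Omega -> \bar R),
    [/\ (1 <= t0)%N,
        is_condexp (P t0) (filtration y t0.-1)
          (fun w => maxe 0 (tau w - t0%:R%:E))%E Z &
        v = ess_sup (P t0) Z]].

End model.

(** * Ergodic CuSum *)

Section cusum.
Context (R : realType) (K : nat) (Omega : Type).
(* [p1 t] and [pinf t]: densities of (y_1, ..., y_t) under a change at time 1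
   and under no change. *)
Variables (p1 pinf : forall t : nat, 'M[R]_(K, t) -> R).
Variable (y : nat -> Omega -> 'cV[R]_K).

Definition likelihood_ratio (t : nat) (w : Omega) : R :=
  if t == 0%N then 1 else p1 (block y 1 t w) / pinf (block y 1 t w).

(* The default value 0 of the maximum is the term i = t. *)
Definition cusum_stat (t : nat) (w : Omega) : R :=
  \big[Num.max/0]_(i < t.+1)
    (ln (likelihood_ratio t w) - ln (likelihood_ratio i w)).

Definition cusum_time (c : R) (w : Omega) : \bar R :=
  ereal_inf [set (t%:R%:E : \bar R) | t in
    [set t : nat | (1 <= t)%N /\ c <= cusum_stat t w]].

End cusum.

(* Main.v *)
(* Everything is expressed under the law P_inf of white noise. Integrating out
   the hidden state, P_t0 has density Lam(y_t0, ..., y_(t0+n-1)) with respect to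
   P_inf on F_(t0+n-1), where Lam(ys) is the total mass of the unnormalised
   Bayes filter run along ys; in particular the ratio of the densities of
   (y_1, ..., y_t) is Lam(y_1, ..., y_t) almost surely, under P_inf and under
   every P_t0.

   False alarms. R_t = \sum_(i < t) L_t / L_i satisfies
   R_t = (R_(t-1) + 1) L_t / L_(t-1), so that R_t - t is a P_inf-martingale,
   while R is at least gamma at the time of the alarm.

   Delay. Let xs be the observations before the change, ys the next k ones and
   zs the following ones. If no alarm has been raised, then
   Lam(xs ++ ys ++ zs) < gamma Lam(xs ++ ys) and no increment of ln Lam along xs
   exceeds c = ln gamma. The filter density stays Gaussian, and a Lyapunov
   estimate shows that the law of the hidden state predicted from xs ++ ys has a
   density at least exp(- theta^k p c - O(1)) on a ball, with theta < 1. Hence,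
   comparing it with the filter started afresh at the change, either
   Lam(ys ++ zs) <= exp(c (1 + theta^k p) + O(1)), or half of Lam(ys ++ zs) comes
   from states outside the ball. The probability of both events is computed from
   the observations after the change only, so it does not depend on t0 nor on
   y_1, ..., y_(t0-1). For n = (1 + eps) c / kappa observations it tends to 0 by
   the convergence of the log-likelihood ratio; for larger n it decays
   exponentially, as E_inf[sqrt Lam(y_1, ..., y_n)] <= b^(n-1) with b < 1. Summing
   over n bounds the conditional mean delay. *)
Require Import Defs.
From HB Require Import structures.
From mathcomp Require Import all_boot all_order all_algebra finmap.
From mathcomp Require Import all_classical all_reals all_analysis.
From mathcomp Require Import measurable_realfun ess_sup_inf.
From mathcomp Require Import ring lra.

Set Implicit Arguments.
Unset Strict Implicit.
Unset Printing Implicit Defensive.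

Import Order.TTheory GRing.Theory Num.Theory.
Import numFieldNormedType.Exports.

Local Open Scope classical_set_scope.
Local Open Scope ring_scope.

(** * Translation invariance of Lebesgue measure on matrices *)

(** The obstacle is that [Lam] is not a product: at the change the CuSum filter has run on noise
    since time 1, and the bound must hold for every past. The only control on the past is the
    absence of an alarm, so each earlier increment of the log-likelihood is at most [c]; these
    penalties, damped by [theta], sum to at most [p * c], and a burn-in of [k] observations reduces
    this to [theta ^+ k * (p * c)]. Hence the order of the choices: [k] from the precision wanted,
    then the bound [r2] on the burn-in observations and the squared radius [rho] of the ball, and
    only then [c] large. Almost sure convergence carries no rate, so it gives a small probability
    [e] at [n = (1 + eps) c / kappa]; as the absence of an alarm is monotone in [n], the same [e]
    serves until the exponential bound takes over, at a time of order [c], and [e] is chosen small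
    against the ratio of the two times. No Gaussian integral is evaluated: the model makes the
    Gaussian functions densities of random vectors, so they have mass one, and this yields positive
    and finite normalising constants. *)

Section density_integral.
Local Open Scope ereal_scope.
Context d (T : measurableType d) (R : realType).
Variables (mu : {sigma_finite_measure set T -> \bar R})
  (nu : {finite_measure set T -> \bar R}) (g : T -> \bar R).
Hypotheses (mg : measurable_fun setT g) (g0 : forall x, 0 <= g x).
Hypothesis nuE : forall A, measurable A -> nu A = \int[mu]_(x in A) g x.

(** The density makes [nu] vanish on [mu]-null sets, so a Radon-Nikodym derivative exists; it has
    the same integral as [g] over every measurable set, hence equals it almost everywhere and may be
    replaced by it in the change of variables formula. *)
Lemma density_integral (f : T -> \bar R) :
  measurable_fun setT f -> (forall x, 0 <= f x) ->
  \int[nu]_x f x = \int[mu]_x (f x * g x).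
Proof.
move=> mf f0.
have numu : nu `<< mu.
  apply/null_content_dominatesP => A mA muA; rewrite nuE//.
  by apply: null_set_integral => //; exact: measurable_funTS.
pose h := Radon_Nikodym_SigmaFinite.f nu mu.
have hi : mu.-integrable setT h by exact: Radon_Nikodym_SigmaFinite.f_integrable.
have mh : measurable_fun setT h := measurable_int _ hi.
have hg : ae_eq mu setT h g.
  apply: integral_ae_eq => // E _ mE.
  by rewrite -nuE// -Radon_Nikodym_SigmaFinite.f_integral.
rewrite -(Radon_Nikodym_SigmaFinite.change_of_variables numu)//.
apply: ge0_ae_eq_integral => //.
- exact: emeasurable_funM.
- exact: emeasurable_funM.
- by move=> x _; rewrite mule_ge0//; exact: Radon_Nikodym_SigmaFinite.f_ge0.
- by move=> x _; rewrite mule_ge0.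
- by apply: filterS hg => x /= E _; rewrite -E.
Qed.

End density_integral.

Section translation1.
Context (R : realType).
Local Notation mu := (@lebesgue_measure R).
Local Notation RR := (measurableTypeR R).

Let shift (a : R) : RR -> RR := fun x => x + a.

Let measurable_shift a : measurable_fun setT (shift a).
Proof. exact: measurable_funD. Qed.

(** The translated measure still gives each half-open interval its length, and this characterises
    Lebesgue measure. *)
Lemma lebesgue_measure_translate (a : R) (A : set RR) :
  measurable A -> mu (shift a @^-1` A) = mu A.
Proof.
move=> mA; rewrite -[LHS]/(pushforward mu (shift a) A).
have mphi := measurable_shift a.
apply/esym/lebesgue_measure_unique => // _ [[b c]] _ <-.
rewrite /= /pushforward [X in _ = mu X](_ : _ = `](b - a), (c - a)]%classic).
  rewrite !lebesgue_measure_itv/= !lte_fin ltrD2r; case: ifPn => // _.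
  by rewrite -!EFinB; congr EFin; ring.
by apply/seteqP; split=> x /=; rewrite !in_itv/= ltrBlDr lerBrDr.
Qed.

Lemma ge0_integral_translate1 (a : R) (f : RR -> \bar R) :
  measurable_fun setT f -> (forall x, 0 <= f x)%E ->
  (\int[mu]_x f (x + a)%R = \int[mu]_x f x)%E.
Proof.
move=> mf f0.
rewrite [RHS](@eq_measure_integral _ _ _ _ (pushforward mu (shift a))).
  by rewrite ge0_integral_pushforward.
by move=> A mA _; rewrite /= /pushforward lebesgue_measure_translate.
Qed.

End translation1.

Section translation_tuple.
Context (R : realType).
Local Notation RR := (measurableTypeR R).

Definition add_tuple n (s t : n.-tuple RR) : n.-tuple RR :=
  [tuple (tnth s i + tnth t i : RR) | i < n].

Lemma measurable_add_tuple n (s : n.-tuple RR) :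
  measurable_fun setT (add_tuple s).
Proof.
apply/measurable_fun_tnthP => k; rewrite (_ : _ \o _ =
    (fun t : n.-tuple RR => (tnth s k + tnth t k : RR))).
  by apply: measurable_funD => //; exact: measurable_tnth.
by apply/funext => M /=; rewrite tnth_mktuple.
Qed.

Lemma add_tuple_cons n (s : n.+1.-tuple RR) (a : RR) (t : n.-tuple RR) :
  add_tuple s (cons_pair (a, t)) =
  cons_pair (thead s + a : RR, add_tuple [tuple of behead s] t).
Proof.
apply: eq_from_tnth => i; rewrite tnth_mktuple.
rewrite !(tnth_nth (0 : RR))/=; case: i => [[|i] i_lt]/=.
  by rewrite /thead (tnth_nth (0 : RR)).
have i_lt' : (i < n)%N by [].
by rewrite -[i]/(val (Ordinal i_lt')) nth_mktuple !(tnth_nth (0 : RR))/= nth_behead.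
Qed.

Lemma ge0_integral_lebesgue_tupleS n (f : n.+1.-tuple RR -> \bar R) :
  measurable_fun setT f -> (forall x, 0 <= f x)%E ->
  (\int[lebesgue_tuple R n.+1]_x f x =
   \int[@lebesgue_measure R]_a \int[lebesgue_tuple R n]_t f (cons_pair (a, t)))%E.
Proof.
move=> mf f0.
transitivity (\int[(@lebesgue_measure R \x lebesgue_tuple R n)%E]_z f (cons_pair z))%E.
  rewrite -[LHS]/(\int[pushforward (@lebesgue_measure R \x lebesgue_tuple R n)%E
    (@cons_pair R n)]_x f x)%E ge0_integral_pushforward//.
  exact: measurable_cons_pair.
rewrite fubini_tonelli1//=.
by apply: (measurableT_comp mf); exact: measurable_cons_pair.
Qed.

(** Induction on the dimension: Tonelli splits off the head, the inner integral is invariant by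
    induction and the outer one by the one-dimensional case. *)
Lemma ge0_integral_translate_tuple n (s : n.-tuple RR) (f : n.-tuple RR -> \bar R) :
  measurable_fun setT f -> (forall x, 0 <= f x)%E ->
  (\int[lebesgue_tuple R n]_x f (add_tuple s x) = \int[lebesgue_tuple R n]_x f x)%E.
Proof.
elim: n => [|n IH] in s f *; move=> mf f0.
  by apply: eq_integral => x _; rewrite (tuple0 x) (tuple0 (add_tuple _ _)).
have mfc : measurable_fun setT (fun z : RR * n.-tuple RR => f (cons_pair z)).
  by apply: (measurableT_comp mf); exact: measurable_cons_pair.
rewrite !ge0_integral_lebesgue_tupleS//; last first.
  by apply: (measurableT_comp mf); exact: measurable_add_tuple.
under eq_integral => a _.
  under eq_integral do rewrite add_tuple_cons.
  rewrite (IH _ (fun t => f (cons_pair (thead s + a : RR, t))))//; last first.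
    by apply: (measurableT_comp mfc); exact: measurable_fun_pair.
  over.
rewrite -(@ge0_integral_translate1 _ (thead s) (fun a =>
  \int[lebesgue_tuple R n]_t f (cons_pair (a, t)))%E).
- by apply: eq_integral => a _; rewrite addrC.
- exact: (@measurable_fun_fubini_tonelli_F _ _ _ _ _ _ (fun z => f (cons_pair z))).
- by move=> a; apply: integral_ge0.
Qed.

End translation_tuple.

Section translation_mx.
Context (R : realType) (m n : nat).
Local Notation lam := (@lebesgue_mx R m n).

Lemma measurable_addmx (v : 'M[R]_(m, n)) :
  measurable_fun setT (fun x : 'M[R]_(m, n) => x + v).
Proof.
apply/measurable_fun_mxP => i j; rewrite (_ : (fun _ => _) =
  (fun x : 'M[R]_(m, n) => x i j + v i j)); last by apply/funext => x; rewrite mxE.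
by apply: measurable_funD => //; exact: measurable_entry.
Qed.

Lemma ge0_integral_translate (v : 'M[R]_(m, n)) (f : 'M[R]_(m, n) -> \bar R) :
  measurable_fun setT f -> (forall x, 0 <= f x)%E ->
  (\int[lam]_x f (x + v)%R = \int[lam]_x f x)%E.
Proof.
move=> mf f0.
have E g : measurable_fun setT g -> (forall x, 0 <= g x)%E ->
    (\int[lam]_x g x = \int[lebesgue_tuple R (m * n)]_t g (mx_of_tuple t))%E.
  move=> mg g0; rewrite -[LHS]/(\int[pushforward (lebesgue_tuple R (m * n))
    (@mx_of_tuple R m n)]_x g x)%E ge0_integral_pushforward//.
  exact: measurable_mx_of_tuple.
rewrite !E//; last by apply: (measurableT_comp mf); exact: measurable_addmx.
rewrite -(ge0_integral_translate_tuple (tuple_of_mx v)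
  (f := fun t => f (mx_of_tuple t)))//; last first.
  by apply: (measurableT_comp mf); exact: measurable_mx_of_tuple.
apply: eq_integral => t _; congr f; apply/matrixP => i j.
by rewrite !mxE !tnth_mktuple mxvecE addrC.
Qed.

End translation_mx.

(** * Independence and densities *)

Section independence.
Context d (Omega : measurableType d) (R : realType) (P : probability Omega R).

(** [G] is any class of events, so that independence can be checked on a pi-system and then extended
    to the sigma-algebra it generates. *)
Definition indep_of d' (T : measurableType d') (G : set (set Omega))
    (Z : Omega -> T) : Prop :=
  forall E B, G E -> measurable B ->
    P (E `&` Z @^-1` B) = (P E * P (Z @^-1` B))%E.

Section pi_system.
Variables (G : set (set Omega)).
Hypotheses (GI : setI_closed G) (GT : G setT) (GM : G `<=` measurable).

Lemma eq_probability_pi_system (Q : {measure set Omega -> \bar R}) :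
  (forall E, G E -> P E = Q E) -> forall E, <<s G >> E -> P E = Q E.
Proof.
move=> PQ; apply: (@g_sigma_algebra_measure_unique _ _ _ G GM (fun=> setT)) => //.
- by rewrite bigcup_const.
- by move=> _; rewrite ltey_eq fin_num_measure.
Qed.

(** For fixed [B] both sides are finite measures in [E]: the restriction of [P] to the event that
    [Z] falls in [B], and a multiple of [P]. Agreement on a pi-system containing the whole space is
    enough. *)
Lemma indep_of_pi_system d' (T : measurableType d') (Z : Omega -> T) :
  measurable_fun setT Z -> indep_of G Z -> indep_of <<s G >> Z.
Proof.
move=> mZ ind E B GE mB.
have mC : measurable (Z @^-1` B) by rewrite -[X in measurable X]setTI; exact: mZ.
set C := Z @^-1` B in mC *.
have PC : P C \is a fin_num by exact: fin_num_measure.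
pose k := NngNum (fine_ge0 (measure_ge0 P C)).
have kE : (k%:num%:E = P C)%E by rewrite /k/= fineK.
have mE A : (mscale k P A = P A * P (Z @^-1` B))%E.
  by rewrite muleC -kE.
rewrite -mE.
rewrite -[LHS]/(mrestr P mC E).
apply: (@g_sigma_algebra_measure_unique _ _ _ G GM (fun=> setT)) => //.
- by rewrite bigcup_const.
- by move=> A GA; rewrite [RHS]mE /= /mrestr ind.
- by move=> _; rewrite /= /mrestr setTI ltey_eq PC.
Qed.

End pi_system.

End independence.

Section indep_integral.
Local Open Scope ereal_scope.
Context d (Omega : measurableType d) (R : realType) (P : probability Omega R).
Context d' (T : measurableType d').
Variables (X : Omega -> T) (m n : nat) (Z : Omega -> 'M[R]_(m, n))
  (f : 'M[R]_(m, n) -> R).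
Hypotheses (mX : measurable_fun setT X) (Zf : has_density P Z f).

Lemma has_density_integral (h : 'M[R]_(m, n) -> \bar R) :
  measurable_fun setT h -> (forall x, 0 <= h x) ->
  \int[P]_w h (Z w) = \int[@lebesgue_mx R m n]_x (h x * (f x)%:E).
Proof.
have [mZ mf f0 ZE] := Zf; move=> mh h0.
pose Zm : {mfun Omega >-> 'M[R]_(m, n)} := HB.pack_for {mfun Omega >-> 'M[R]_(m, n)} Z
  (isMeasurableFun.Build _ _ _ _ Z mZ).
pose nu := distribution P Zm.
rewrite -(@density_integral _ _ _ (@lebesgue_mx R m n) nu (EFin \o f))//.
- by rewrite ge0_integral_distribution.
- exact/measurable_EFinP.
Qed.

Hypothesis XZ : forall E B, measurable E -> measurable B ->
  P (X @^-1` E `&` Z @^-1` B) = P (X @^-1` E) * P (Z @^-1` B).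

(** Independence says that the joint law of [X] and [Z] is the product of the marginals; Tonelli
    then integrates [Z] out against its density. *)
Lemma indep_integral (F : T * 'M[R]_(m, n) -> \bar R) :
  measurable_fun setT F -> (forall z, 0 <= F z) ->
  \int[P]_w F (X w, Z w) =
  \int[P]_w \int[@lebesgue_mx R m n]_z (F (X w, z) * (f z)%:E).
Proof.
have [mZ _ _ _] := Zf; move=> mF F0.
pose Xm : {mfun Omega >-> T} := HB.pack_for {mfun Omega >-> T} X
  (isMeasurableFun.Build _ _ _ _ X mX).
pose Zm : {mfun Omega >-> 'M[R]_(m, n)} := HB.pack_for {mfun Omega >-> 'M[R]_(m, n)} Z
  (isMeasurableFun.Build _ _ _ _ Z mZ).
have mXZ : measurable_fun setT (fun w => (X w, Z w)).
  exact: measurable_fun_pair.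
pose XZm := HB.pack_for {mfun Omega >-> (T * 'M[R]_(m, n))%type} (fun w => (X w, Z w))
  (isMeasurableFun.Build _ _ _ _ _ mXZ).
have E A : measurable A -> (distribution P Xm \x distribution P Zm) A =
    distribution P XZm A.
  apply: product_measure_unique => B C mB mC.
  exact: XZ.
transitivity (\int[distribution P XZm]_z F z).
  by rewrite ge0_integral_distribution.
rewrite -(eq_measure_integral _ (fun A mA _ => E A mA)) fubini_tonelli1//=.
rewrite ge0_integral_distribution//=; last 2 first.
- exact: measurable_fun_fubini_tonelli_F.
- by move=> x; apply: integral_ge0.
apply: eq_integral => w _; rewrite /fubini_F ge0_integral_distribution//=.
  rewrite (has_density_integral (h := fun z => F (X w, z)))//.
  exact: measurableT_comp.
exact: measurableT_comp.
Qed.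

End indep_integral.

(** * Quadratic forms *)

Section quadratic_forms.
Context (R : realType) (K : nat).
Implicit Types (x y z b : 'cV[R]_K) (M N : 'M[R]_K).

Definition dot x y : R := (x^T *m y) ord0 ord0.
Definition bform M x y : R := (x^T *m M *m y) ord0 ord0.

Lemma dotE x y : dot x y = \sum_i x i ord0 * y i ord0.
Proof. by rewrite /dot mxE; apply: eq_bigr => i _; rewrite mxE. Qed.

Lemma dotC x y : dot x y = dot y x.
Proof. by rewrite !dotE; apply: eq_bigr => i _; rewrite mulrC. Qed.

Lemma dotDr x y z : dot x (y + z) = dot x y + dot x z.
Proof. by rewrite /dot mulmxDr mxE. Qed.

Lemma dotDl x y z : dot (y + z) x = dot y x + dot z x.
Proof. by rewrite dotC dotDr !(dotC x). Qed.

Lemma dotNr x y : dot x (- y) = - dot x y.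
Proof. by rewrite /dot mulmxN mxE. Qed.

Lemma dotNl x y : dot (- y) x = - dot y x.
Proof. by rewrite dotC dotNr dotC. Qed.

Lemma dotZr (a : R) x y : dot x (a *: y) = a * dot x y.
Proof. by rewrite /dot -scalemxAr mxE. Qed.

Lemma dotZl (a : R) x y : dot (a *: y) x = a * dot y x.
Proof. by rewrite dotC dotZr dotC. Qed.

Lemma dot0r x : dot x 0 = 0.
Proof. by rewrite /dot mulmx0 mxE. Qed.

Lemma dot_ge0 x : 0 <= dot x x.
Proof. by rewrite dotE; apply: sumr_ge0 => i _; rewrite -expr2 sqr_ge0. Qed.

Lemma dot_eq0 x : dot x x = 0 -> x = 0.
Proof.
move=> /eqP; rewrite dotE psumr_eq0 => [/allP xx0|i _]; last first.
  by rewrite -expr2 sqr_ge0.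
apply/matrixP => i j; rewrite mxE (ord1 j).
by have := xx0 i (mem_index_enum _); rewrite /= mulf_eq0 orbb => /eqP.
Qed.

Lemma bformE M x y : bform M x y = dot x (M *m y).
Proof. by rewrite /bform/dot mulmxA. Qed.

Lemma bformEl M x y : bform M x y = dot (M^T *m x) y.
Proof. by rewrite /bform/dot trmx_mul trmxK. Qed.

Lemma dot_mulmxl M x y : dot (M *m x) y = dot x (M^T *m y).
Proof. by rewrite /dot trmx_mul mulmxA. Qed.

Lemma bformDr M x y z : bform M x (y + z) = bform M x y + bform M x z.
Proof. by rewrite !bformE mulmxDr dotDr. Qed.

Lemma bformDl M x y z : bform M (y + z) x = bform M y x + bform M z x.
Proof. by rewrite !bformE dotDl. Qed.

Lemma bformNr M x y : bform M x (- y) = - bform M x y.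
Proof. by rewrite !bformE mulmxN dotNr. Qed.

Lemma bformNl M x y : bform M (- y) x = - bform M y x.
Proof. by rewrite !bformE dotNl. Qed.

Lemma bformZr M a x y : bform M x (a *: y) = a * bform M x y.
Proof. by rewrite !bformE -scalemxAr dotZr. Qed.

Lemma bformZl M a x y : bform M (a *: y) x = a * bform M y x.
Proof. by rewrite !bformE dotZl. Qed.

Lemma bformDm M N x y : bform (M + N) x y = bform M x y + bform N x y.
Proof. by rewrite !bformE mulmxDl dotDr. Qed.

Lemma bformNm M x y : bform (- M) x y = - bform M x y.
Proof. by rewrite !bformE mulNmx dotNr. Qed.

Lemma bformZm M a x y : bform (a *: M) x y = a * bform M x y.
Proof. by rewrite !bformE -scalemxAl dotZr. Qed.

Lemma bform1 x y : bform 1%:M x y = dot x y.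
Proof. by rewrite bformE mul1mx. Qed.

Lemma bformC M x y : M^T = M -> bform M x y = bform M y x.
Proof. by move=> MT; rewrite bformE bformEl MT dotC. Qed.

Lemma bform_conj M N x y : bform (N^T *m M *m N) x y = bform M (N *m x) (N *m y).
Proof. by rewrite /bform trmx_mul !mulmxA. Qed.

Definition bformD := (bformDl, bformDr, bformNl, bformNr, bformZl, bformZr,
  dotDl, dotDr, dotNl, dotNr, dotZl, dotZr).

Lemma bform_le_dot M : exists2 L : R, 0 <= L & forall x, bform M x x <= L * dot x x.
Proof.
exists (\sum_i \sum_j `|M i j|).
  by apply: sumr_ge0 => i _; apply: sumr_ge0.
move=> x; rewrite bformE dotE mulr_suml; apply: ler_sum => i _.
rewrite mxE mulr_suml mulr_sumr; apply: ler_sum => j _.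
have xi k : `|x k ord0| ^+ 2 <= dot x x.
  rewrite real_normK ?num_real// dotE (bigD1 k)//= -expr2 lerDl.
  by apply: sumr_ge0 => l _; rewrite -expr2 sqr_ge0.
rewrite mulrCA; apply: (le_trans (ler_norm _)); rewrite normrM ler_wpM2l//.
rewrite normrM; have := xi i; have := xi j; rewrite dotE; set a := `|x i ord0|; set b := `|x j ord0|.
by have := sqr_ge0 (a - b); lra.
Qed.

Lemma pos_unitmx N : (forall x, x != 0 -> 0 < bform N x x) -> N \in unitmx.
Proof.
move=> N0; rewrite unitmxE unitfE; apply/negP => /det0P[v v0 vN].
have : v^T != 0 by apply: contra v0 => /eqP vT; rewrite -(trmxK v) vT trmx0.
move=> /N0; rewrite /bform trmxK vN mul0mx mxE ltxx//.
Qed.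

Lemma dot_le_unitmx N : (forall x, dot x x <= bform N x x) -> N \in unitmx.
Proof.
move=> N1; apply: pos_unitmx => x x0; rewrite (lt_le_trans _ (N1 x))//.
rewrite lt_neqAle dot_ge0 andbT; apply: contra_neq x0 => x0.
exact: dot_eq0.
Qed.

Lemma trmx_invmx M : M^T = M -> (invmx M)^T = invmx M.
Proof. by move=> MT; rewrite trmx_inv MT. Qed.

(* Concave duality: [bform (invmx N) b b] is the maximum over [v] of the
   left-hand side. *)
Lemma bform_inv_ge N b v : N^T = N -> N \in unitmx ->
  (forall x, 0 <= bform N x x) ->
  2 * dot b v - bform N v v <= bform (invmx N) b b.
Proof.
move=> NT uN N0; set w := invmx N *m b.
have := N0 (v - w); rewrite !bformD (bformC w v NT).
have Nw : N *m w = b by rewrite mulKVmx.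
rewrite !(bformE N _ w) Nw (dotC v) (bformE (invmx N)) -/w (dotC w).
lra.
Qed.

(** Duality turns an upper bound [L] on [M] into a lower bound on its inverse, by testing
    [bform_inv_ge] at a multiple of [x]; no eigenvalues are involved. The shift to [L + 1] keeps the
    multiplier positive even when [L] is 0. *)
Lemma posdef_inv_ge M : posdefmx M ->
  exists2 l : R, 0 < l & forall x, l * dot x x <= bform (invmx M) x x.
Proof.
move=> [MT M0].
have uM : M \in unitmx by apply: pos_unitmx.
have M0' x : 0 <= bform M x x.
  have [->|/M0/ltW//] := eqVneq x 0.
  by rewrite bformE mulmx0 dot0r.
have [L L0 ML] := bform_le_dot M.
exists (L + 1)^-1; first by rewrite invr_gt0; lra.
move=> x; apply: le_trans (bform_inv_ge x ((L + 1)^-1 *: x) MT uM M0').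
rewrite !bformD.
have := ML x; set q := bform M x x; set d := dot x x => h.
have l0 : 0 < (L + 1)^-1 by rewrite invr_gt0; lra.
set l := _^-1 in l0 *.
have lL : l * (L + 1) = 1 by rewrite /l mulVf// gt_eqF//; lra.
have d0 : 0 <= d := dot_ge0 x.
have : l * (l * q) <= l * (l * (L * d)) by rewrite !ler_wpM2l// ltW.
have -> : l * (l * (L * d)) = l * (l * (L + 1)) * d - l * l * d by ring.
rewrite lL; have : 0 <= l * l * d by rewrite !mulr_ge0// ltW.
lra.
Qed.

End quadratic_forms.

Section measurable_vec.
Context (R : realType) d (T : measurableType d).

Lemma measurable_dot K (f g : T -> 'cV[R]_K) :
  measurable_fun setT f -> measurable_fun setT g ->
  measurable_fun setT (fun w => dot (f w) (g w)).
Proof.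
move=> /measurable_fun_mxP mf /measurable_fun_mxP mg.
under eq_fun do rewrite dotE.
by apply: measurable_sum => i; exact: measurable_funM.
Qed.

Lemma measurable_mulmxr m n p (A : 'M[R]_(m, n)) (f : T -> 'M[R]_(n, p)) :
  measurable_fun setT f -> measurable_fun setT (fun w => A *m f w).
Proof.
move=> /measurable_fun_mxP mf; apply/measurable_fun_mxP => i j.
under eq_fun do rewrite mxE.
by apply: measurable_sum => k; exact: measurable_funM.
Qed.

Lemma measurable_mxD m n (f g : T -> 'M[R]_(m, n)) :
  measurable_fun setT f -> measurable_fun setT g ->
  measurable_fun setT (fun w => f w + g w).
Proof.
move=> /measurable_fun_mxP mf /measurable_fun_mxP mg.
apply/measurable_fun_mxP => i j; under eq_fun do rewrite mxE.
exact: measurable_funD.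
Qed.

Lemma measurable_mxN m n (f : T -> 'M[R]_(m, n)) :
  measurable_fun setT f -> measurable_fun setT (fun w => - f w).
Proof.
move=> /measurable_fun_mxP mf.
apply/measurable_fun_mxP => i j; under eq_fun do rewrite mxE.
exact: measurableT_comp.
Qed.

Lemma measurable_bform K M (f g : T -> 'cV[R]_K) :
  measurable_fun setT f -> measurable_fun setT g ->
  measurable_fun setT (fun w => bform M (f w) (g w)).
Proof.
move=> mf mg; under eq_fun do rewrite bformE.
by apply: measurable_dot => //; exact: measurable_mulmxr.
Qed.

End measurable_vec.

(** * The unnormalised Bayes filter *)

Section filter.
Local Open Scope ereal_scope.
Context (R : realType) (K : nat).
Local Notation V := ('cV[R]_K).
Local Notation lam := (@lebesgue_mx R K 1).

Definition expo (x y : V) : R := expR (dot x y - dot x x / 2).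

Variables (A : 'M[R]_K) (g : V -> R).

(* Unnormalised Bayes filter: [f] is the predictive density of the hidden state
   and [expo x y] the likelihood ratio of an observation [y] given the state. *)
Definition filt (y : V) (f : V -> \bar R) (x' : V) : \bar R :=
  \int[lam]_x ((g (x' - A *m x) * expo x y)%:E * f x).

Definition alpha (f : V -> \bar R) (ys : seq V) : V -> \bar R :=
  foldl (fun h y => filt y h) f ys.

Definition Lam (f : V -> \bar R) (ys : seq V) : \bar R :=
  \int[lam]_x alpha f ys x.

Hypotheses (mg : measurable_fun setT g) (g0 : forall x, (0 <= g x)%R).

Lemma expo_ge0 (x y : V) : (0 <= expo x y)%R. Proof. exact: expR_ge0. Qed.

Lemma measurable_expo d (T : measurableType d) (f h : T -> V) :
  measurable_fun setT f -> measurable_fun setT h ->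
  measurable_fun setT (fun w => expo (f w) (h w)).
Proof.
move=> mf mh; apply: measurableT_comp => //; apply: measurable_funB.
  exact: measurable_dot.
by apply: measurable_funM => //; exact: measurable_dot.
Qed.

Lemma kernel_ge0 (x' x y : V) : 0 <= (g (x' - A *m x) * expo x y)%:E.
Proof. by rewrite lee_fin mulr_ge0// expo_ge0. Qed.

Lemma filt_ge0 y f x' : (forall x, 0 <= f x) -> 0 <= filt y f x'.
Proof. by move=> f0; apply: integral_ge0 => x _; rewrite mule_ge0// kernel_ge0. Qed.

Lemma alpha_ge0 ys f x : (forall x, 0 <= f x) -> 0 <= alpha f ys x.
Proof.
by elim: ys f x => //= y ys IH f x f0; apply: IH => x'; exact: filt_ge0.
Qed.

Lemma Lam_ge0 ys f : (forall x, 0 <= f x) -> 0 <= Lam f ys.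
Proof. by move=> f0; apply: integral_ge0 => x _; exact: alpha_ge0. Qed.

Lemma alpha_cat f ys zs : alpha f (ys ++ zs) = alpha (alpha f ys) zs.
Proof. exact: foldl_cat. Qed.

Lemma alpha_rcons f ys y : alpha f (rcons ys y) = filt y (alpha f ys).
Proof. exact: foldl_rcons. Qed.

Lemma LamE f ys : Lam f ys = \int[lam]_x alpha f ys x.
Proof. by []. Qed.

Lemma Lam_cat f ys zs : Lam f (ys ++ zs) = Lam (alpha f ys) zs.
Proof. by rewrite /Lam alpha_cat. Qed.

Lemma measurable_kernel d (T : measurableType d) (f h k : T -> V) :
  measurable_fun setT f -> measurable_fun setT h -> measurable_fun setT k ->
  measurable_fun setT (fun w => (g (f w - A *m h w) * expo (h w) (k w))%:E).
Proof.
move=> mf mh mk; apply/measurable_EFinP; apply: measurable_funM.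
  apply: (measurableT_comp mg); apply: measurable_mxD => //.
  by apply: measurable_mxN; exact: measurable_mulmxr.
exact: measurable_expo.
Qed.

Section parametric.
Context d (T : measurableType d).
Implicit Types F : T -> V -> \bar R.

(** Joint measurability in the sample point and the state is what the later Tonelli exchanges
    require. The space [T] is arbitrary because it is taken in turn to be [Omega] with the
    sigma-algebra of the past, a product, or a space of matrices. *)
Lemma measurable_param_filt (Y : T -> V) F :
  measurable_fun setT Y ->
  measurable_fun setT (fun z : T * V => F z.1 z.2) -> (forall t x, 0 <= F t x) ->
  measurable_fun setT (fun z : T * V => filt (Y z.1) (F z.1) z.2).
Proof.
move=> mY mF F0.
apply: (measurable_fun_fubini_tonelli_F (m2 := lam)
  (fun z : (T * V) * V => (g (z.1.2 - A *m z.2) * expo z.2 (Y z.1.1))%:E *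
    F z.1.1 z.2)); last by move=> z; rewrite mule_ge0// kernel_ge0.
apply: emeasurable_funM.
  apply: measurable_kernel => //.
  - exact: (measurableT_comp measurable_snd measurable_fst).
  - apply: (measurableT_comp mY).
    exact: (measurableT_comp measurable_fst measurable_fst).
have mp : measurable_fun setT (fun z : (T * V) * V => (z.1.1, z.2)).
  apply: measurable_fun_pair => //=.
  exact: (measurableT_comp measurable_fst measurable_fst).
exact: (measurableT_comp mF mp).
Qed.

Lemma measurable_param_alpha (I : eqType) (Y : I -> T -> V) (s : seq I) F :
  (forall i, i \in s -> measurable_fun setT (Y i)) ->
  measurable_fun setT (fun z : T * V => F z.1 z.2) -> (forall t x, 0 <= F t x) ->
  measurable_fun setT
    (fun z : T * V => alpha (F z.1) [seq Y i z.1 | i <- s] z.2).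
Proof.
elim: s F => //= i s IH F mY mF F0.
apply: (IH (fun t => filt (Y i t) (F t))).
- by move=> j js; apply: mY; rewrite inE js orbT.
- by apply: measurable_param_filt => //; apply: mY; rewrite inE eqxx.
- by move=> t x; exact: filt_ge0.
Qed.

Lemma measurable_param_integral F :
  measurable_fun setT (fun z : T * V => F z.1 z.2) -> (forall t x, 0 <= F t x) ->
  measurable_fun setT (fun t => \int[lam]_x F t x).
Proof.
move=> mF F0.
by apply: (measurable_fun_fubini_tonelli_F (m2 := lam) (fun z : T * V => F z.1 z.2)).
Qed.

Lemma measurable_param_Lam (I : eqType) (Y : I -> T -> V) (s : seq I) F :
  (forall i, i \in s -> measurable_fun setT (Y i)) ->
  measurable_fun setT (fun z : T * V => F z.1 z.2) -> (forall t x, 0 <= F t x) ->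
  measurable_fun setT (fun t => Lam (F t) [seq Y i t | i <- s]).
Proof.
move=> mY mF F0; apply: (measurable_param_integral
  (F := fun t => alpha (F t) [seq Y i t | i <- s])).
  exact: measurable_param_alpha.
by move=> t x; exact: alpha_ge0.
Qed.

End parametric.

Lemma measurable_filt y f : measurable_fun setT f -> (forall x, 0 <= f x) ->
  measurable_fun setT (filt y f).
Proof.
move=> mf f0.
have H := @measurable_param_filt _ V (cst y) (fun _ => f)
  (measurable_cst _) (measurableT_comp mf measurable_snd) (fun _ => f0).
have mp : measurable_fun setT (fun x : V => (0%R : V, x)).
  exact: measurable_fun_pair.
exact: (measurableT_comp H mp).
Qed.

Lemma measurable_alpha ys f : measurable_fun setT f -> (forall x, 0 <= f x) ->
  measurable_fun setT (alpha f ys).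
Proof.
elim: ys f => //= y ys IH f mf f0; apply: IH; first exact: measurable_filt.
by move=> x; exact: filt_ge0.
Qed.

Lemma le_filt y f h : measurable_fun setT f -> measurable_fun setT h ->
  (forall x, 0 <= f x) -> (forall x, f x <= h x) ->
  forall x, filt y f x <= filt y h x.
Proof.
move=> mf mh f0 fh x'.
have h0 x : 0 <= h x by exact: le_trans (fh x).
apply: ge0_le_integral => //.
- by move=> x _; rewrite mule_ge0// kernel_ge0.
- by apply: emeasurable_funM => //; exact: measurable_kernel.
- by apply: emeasurable_funM => //; exact: measurable_kernel.
- by move=> x _; apply: lee_wpmul2l => //; exact: kernel_ge0.
Qed.

Lemma le_alpha ys f h : measurable_fun setT f -> measurable_fun setT h ->
  (forall x, 0 <= f x) -> (forall x, f x <= h x) ->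
  forall x, alpha f ys x <= alpha h ys x.
Proof.
elim: ys f h => //= y ys IH f h mf mh f0 fh x.
have h0 x' : 0 <= h x' by exact: le_trans (fh x').
apply: IH.
- exact: measurable_filt.
- exact: measurable_filt.
- by move=> x'; exact: filt_ge0.
- exact: le_filt.
Qed.

Lemma le_Lam ys f h : measurable_fun setT f -> measurable_fun setT h ->
  (forall x, 0 <= f x) -> (forall x, f x <= h x) -> Lam f ys <= Lam h ys.
Proof.
move=> mf mh f0 fh.
have h0 x' : 0 <= h x' by exact: le_trans (fh x').
apply: ge0_le_integral => //.
- by move=> x _; exact: alpha_ge0.
- exact: measurable_alpha.
- exact: measurable_alpha.
- by move=> x _; exact: le_alpha.
Qed.

Lemma filtD y f h : measurable_fun setT f -> measurable_fun setT h ->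
  (forall x, 0 <= f x) -> (forall x, 0 <= h x) ->
  filt y (f \+ h) = filt y f \+ filt y h.
Proof.
move=> mf mh f0 h0; apply/funext => x'; rewrite /filt.
under eq_integral do rewrite ge0_muleDr//.
rewrite ge0_integralD//.
- by move=> x _; rewrite mule_ge0// kernel_ge0.
- by apply: emeasurable_funM => //; exact: measurable_kernel.
- by move=> x _; rewrite mule_ge0// kernel_ge0.
- by apply: emeasurable_funM => //; exact: measurable_kernel.
Qed.

Lemma LamD ys f h : measurable_fun setT f -> measurable_fun setT h ->
  (forall x, 0 <= f x) -> (forall x, 0 <= h x) ->
  Lam (f \+ h) ys = Lam f ys + Lam h ys.
Proof.
elim: ys f h => [|y ys IH] f h mf mh f0 h0.
  by rewrite /Lam/= ge0_integralD.
rewrite /Lam/= filtD//; apply: IH; try exact: measurable_filt.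
- by move=> x'; exact: filt_ge0.
- by move=> x'; exact: filt_ge0.
Qed.

Lemma filtZ y (k : R) f : (0 <= k)%R -> measurable_fun setT f ->
  (forall x, 0 <= f x) ->
  filt y (fun x => k%:E * f x) = (fun x => k%:E * filt y f x).
Proof.
move=> k0 mf f0; apply/funext => x'; rewrite /filt.
under eq_integral do rewrite muleCA.
rewrite ge0_integralZl_EFin//.
- by move=> x _; rewrite mule_ge0// kernel_ge0.
- by apply: emeasurable_funM => //; exact: measurable_kernel.
Qed.

Lemma LamZ ys (k : R) f : (0 <= k)%R -> measurable_fun setT f ->
  (forall x, 0 <= f x) -> Lam (fun x => k%:E * f x) ys = k%:E * Lam f ys.
Proof.
move=> k0; elim: ys f => [|y ys IH] f mf f0.
  by rewrite /Lam/= ge0_integralZl_EFin.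
rewrite /Lam/= filtZ//; apply: IH; first exact: measurable_filt.
by move=> x'; exact: filt_ge0.
Qed.

(** Adjoint form of a filtering step: by Tonelli and translation invariance, the test function is
    averaged over the innovation added to [A *m x], and the observation reweights the old
    density. *)
Lemma integral_filt (y : V) f (h : V -> \bar R) :
  measurable_fun setT f -> (forall x, 0 <= f x) ->
  measurable_fun setT h -> (forall x, 0 <= h x) ->
  \int[lam]_x' (h x' * filt y f x') =
  \int[lam]_x ((\int[lam]_x' (h (A *m x + x')%R * (g x')%:E)) *
    ((expo x y)%:E * f x)).
Proof.
move=> mf f0 mh h0.
transitivity (\int[lam]_x' \int[lam]_x
    (h x' * ((g (x' - A *m x) * expo x y)%:E * f x))).
  apply: eq_integral => x' _; rewrite /filt ge0_integralZl//.
  - by apply: emeasurable_funM => //; exact: measurable_kernel.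
  - by move=> x _; rewrite mule_ge0// kernel_ge0.
rewrite (fubini_tonelli (m1 := lam) (m2 := lam)
  (fun z => h z.1 * ((g (z.1 - A *m z.2) * expo z.2 y)%:E * f z.2)))/=; last 2 first.
- apply: emeasurable_funM; first exact: measurableT_comp.
  apply: emeasurable_funM; last exact: measurableT_comp.
  exact: measurable_kernel.
- by move=> z; rewrite !mule_ge0// kernel_ge0.
apply: eq_integral => x _.
have mgA : measurable_fun setT (fun x' : V => (g (x' - A *m x))%:E).
  apply/measurable_EFinP; apply: (measurableT_comp mg).
  exact: measurable_addmx.
under eq_integral => x' _.
  rewrite EFinM -[(_ * _ * f x)]muleA [h x' * _]muleA.
  over.
rewrite ge0_integralZr; [|exact: measurableT|exact: emeasurable_funM|
  by move=> x' _; rewrite mule_ge0// lee_fin|by rewrite mule_ge0// lee_fin expo_ge0].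
congr (_ * _).
rewrite -(ge0_integral_translate (A *m x)); last 2 first.
- exact: emeasurable_funM.
- by move=> x'; rewrite mule_ge0// lee_fin.
by apply: eq_integral => x' _; rewrite addrK addrC.
Qed.

Hypothesis g1 : \int[lam]_x (g x)%:E = 1.

Lemma Lam_filt y f : measurable_fun setT f -> (forall x, 0 <= f x) ->
  Lam (filt y f) [::] = \int[lam]_x ((expo x y)%:E * f x).
Proof.
move=> mf f0; rewrite /Lam/=.
have := integral_filt y mf f0 (measurable_cst (1 : \bar R)) (fun _ => lee01).
under eq_integral do rewrite mul1e.
move=> ->; apply: eq_integral => x _.
by under eq_integral do rewrite mul1e; rewrite g1 mul1e.
Qed.

Lemma Lam_rcons f ys y : measurable_fun setT f -> (forall x, 0 <= f x) ->
  Lam f (rcons ys y) = \int[lam]_x ((expo x y)%:E * alpha f ys x).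
Proof.
move=> mf f0; rewrite -Lam_filt.
- by rewrite /Lam alpha_rcons.
- exact: measurable_alpha.
- by move=> x; exact: alpha_ge0.
Qed.

(** The likelihood ratio of [y] is largest for a state equal to [y]; this bounds the growth of [Lam]
    in one step, whatever the law of the state. *)
Lemma expo_le (x y : V) : (expo x y <= expR (dot y y / 2))%R.
Proof.
rewrite ler_expR; have := dot_ge0 (x - y).
by rewrite !bformD (dotC y x); lra.
Qed.

Lemma Lam_rcons_le f ys y : measurable_fun setT f -> (forall x, 0 <= f x) ->
  Lam f (rcons ys y) <= (expR (dot y y / 2))%:E * Lam f ys.
Proof.
move=> mf f0; have ma : measurable_fun setT (alpha f ys) by exact: measurable_alpha.
have a0 x : 0 <= alpha f ys x by exact: alpha_ge0.
rewrite (Lam_rcons _ _ mf f0) LamE -[leRHS]ge0_integralZl; [|exact: measurableT|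
  exact: ma|by move=> x _; exact: a0|by rewrite lee_fin expR_ge0].
apply: ge0_le_integral; [exact: measurableT| | | |].
- by move=> x _; rewrite mule_ge0 ?a0// lee_fin expo_ge0.
- apply: emeasurable_funM => //.
  by apply/measurable_EFinP; exact: measurable_expo.
- by apply: emeasurable_funM.
- by move=> x _; rewrite lee_wpmul2r ?a0// lee_fin expo_le.
Qed.

Variable phi : V -> R.
Hypotheses (mphi : measurable_fun setT phi) (phi0 : forall x, (0 <= phi x)%R).
Hypothesis phiB : forall x y, phi (y - x) = (phi y * expo x y)%R.

(** Weighting white noise by [expo x y] recentres it at [x], by [phiB]. Averaging a filtering step
    over [y] thus amounts to drawing the observation as [x + v]. This is the one-step change of
    measure; a constant [h] gives the martingale property of [Lam]. *)
Lemma integral_phi_Lam (h : V -> \bar R) f :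
  measurable_fun setT f -> (forall x, 0 <= f x) ->
  measurable_fun setT h -> (forall x, 0 <= h x) ->
  \int[lam]_y (h y * Lam (filt y f) [::] * (phi y)%:E) =
  \int[lam]_x ((\int[lam]_v (h (x + v)%R * (phi v)%:E)) * f x).
Proof.
move=> mf f0 mh h0.
have mphiE : measurable_fun setT (fun x => (phi x)%:E) by exact/measurable_EFinP.
have mphiB (x : V) : measurable_fun setT (fun y : V => (phi (y - x))%:E).
  by apply/measurable_EFinP; apply: (measurableT_comp mphi); exact: measurable_addmx.
transitivity (\int[lam]_y \int[lam]_x (h y * (phi (y - x))%:E * f x)).
  apply: eq_integral => y _; rewrite Lam_filt// muleAC -ge0_integralZl//.
  - by apply: eq_integral => x _; rewrite phiB EFinM !muleA.
  - by apply: emeasurable_funM => //; apply/measurable_EFinP; exact: measurable_expo.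
  - by move=> x _; rewrite mule_ge0// lee_fin expo_ge0.
  - by rewrite mule_ge0// lee_fin.
rewrite (fubini_tonelli (m1 := lam) (m2 := lam)
  (fun z => h z.1 * (phi (z.1 - z.2))%:E * f z.2))/=; last 2 first.
- apply: emeasurable_funM; last exact: measurableT_comp.
  apply: emeasurable_funM; first exact: measurableT_comp.
  apply/measurable_EFinP; apply: (measurableT_comp mphi).
  by apply: measurable_mxD => //; exact: measurable_mxN.
- by move=> z; rewrite !mule_ge0// lee_fin.
apply: eq_integral => x _.
rewrite ge0_integralZr//; last 2 first.
- exact: emeasurable_funM.
- by move=> y _; rewrite mule_ge0// lee_fin.
congr (_ * _); rewrite -(ge0_integral_translate x); last 2 first.
- exact: emeasurable_funM.
- by move=> x'; rewrite mule_ge0// lee_fin.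
by apply: eq_integral => x' _; rewrite addrK addrC.
Qed.

Hypothesis phi1 : \int[lam]_x (phi x)%:E = 1.

Lemma integral_Lam_filt f : measurable_fun setT f -> (forall x, 0 <= f x) ->
  \int[lam]_y (Lam (filt y f) [::] * (phi y)%:E) = Lam f [::].
Proof.
move=> mf f0.
have := integral_phi_Lam mf f0 (measurable_cst (1 : \bar R)) (fun _ => lee01).
under eq_integral do rewrite mul1e.
move=> ->; apply: eq_integral => x _.
by under eq_integral do rewrite mul1e; rewrite phi1 mul1e.
Qed.

End filter.

(** * Gaussian integrals *)

(** Gaussian in information form: products add the parameters, and the precision [M] may be
    singular, since an observation adds the identity to it before it is inverted. *)
Definition gf (R : realType) (K : nat) (k : R) (b : 'cV[R]_K) (M : 'M[R]_K)
  (x : 'cV[R]_K) : R := expR (k + dot b x - bform M x x / 2).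

HB.lock Definition Zg (R : realType) (K : nat) (M : 'M[R]_K) : \bar R :=
  (\int[@lebesgue_mx R K 1]_x (gf 0 0 M x)%:E)%E.

HB.lock Definition zg (R : realType) (K : nat) (M : 'M[R]_K) : R := fine (Zg M).

Section gaussian.
Context (R : realType) (K : nat).
Local Notation V := ('cV[R]_K).
Local Notation lam := (@lebesgue_mx R K 1).
Implicit Types (x y b : V) (M N : 'M[R]_K).

Lemma ZgI M : Zg M = (\int[lam]_x (gf 0 0 M x)%:E)%E.
Proof. by rewrite Zg.unlock. Qed.

Lemma measurable_gf k b M : measurable_fun setT (gf k b M).
Proof.
apply: measurableT_comp => //; apply: measurable_funB.
  by apply: measurable_funD => //; exact: measurable_dot.
by apply: measurable_funM => //; exact: measurable_bform.
Qed.

Lemma gf_ge0 k b M x : 0 <= gf k b M x. Proof. exact: expR_ge0. Qed.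

Lemma gfZ k k' b M x : expR k' * gf k b M x = gf (k' + k) b M x.
Proof. by rewrite /gf -expRD; congr expR; ring. Qed.

Let measurable_gfE k b M : measurable_fun setT (fun x => (gf k b M x)%:E).
Proof. by apply/measurable_EFinP; exact: measurable_gf. Qed.

(** Completing the square: the translation by [invmx N *m b] removes the linear term. *)
Lemma integral_gf k b N : N^T = N -> N \in unitmx ->
  (\int[lam]_x (gf k b N x)%:E = (expR (k + bform (invmx N) b b / 2))%:E * Zg N)%E.
Proof.
move=> NT uN; set v := invmx N *m b.
rewrite -(ge0_integral_translate v); [|exact: measurable_gfE|by move=> x; rewrite lee_fin gf_ge0].
rewrite Zg.unlock -ge0_integralZl_EFin//; last first.
  by move=> x _; rewrite lee_fin gf_ge0.
apply: eq_integral => x _; rewrite -EFinM gfZ; congr EFin; congr expR.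
have Nv : N *m v = b by rewrite mulKVmx.
rewrite !bformD (bformC v x NT) !(bformE N _ v) Nv (bformE (invmx N)) -/v.
by rewrite (dotC x b) (dotC v b) [dot 0 x]dotC dot0r; field.
Qed.

Lemma le_Zg M N : (forall x, bform N x x <= bform M x x) -> (Zg M <= Zg N)%E.
Proof.
move=> NM; rewrite Zg.unlock; apply: ge0_le_integral => //.
- by move=> x _; rewrite lee_fin gf_ge0.
- by move=> x _; rewrite lee_fin ler_expR; have := NM x; lra.
Qed.

Hypotheses (Z1_gt0 : (0 < Zg (1%:M : 'M[R]_K))%E) (Z1_lty : (Zg (1%:M : 'M[R]_K) < +oo)%E).

(** A vanishing integral would force a positive function to be zero almost everywhere; almost no
    point would be left, and the integral for the identity matrix would vanish as well. *)
Lemma Zg_gt0 N : (0 < Zg N)%E.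
Proof.
rewrite lt_neqAle; apply/andP; split; last first.
  by rewrite Zg.unlock; apply: integral_ge0 => x _; rewrite lee_fin gf_ge0.
rewrite Zg.unlock; apply/negP => /eqP Z0.
have : ae_eq lam setT (fun x => (gf 0 0 N x)%:E) (cst 0%E).
  apply/ae_eq_integral_abs => //.
  under eq_integral do rewrite gee0_abs ?lee_fin ?gf_ge0//.
  exact: esym Z0.
move=> N0; have : ae_eq lam setT (fun x => (gf 0 0 1%:M x)%:E) (cst 0%E).
  apply: filterS N0 => x /(_ I) /= [] /eqP.
  by rewrite gt_eqF ?expR_gt0.
move=> H1; have := ae_eq_integral (cst 0%E) _ measurableT
  (measurable_gfE 0 0 1%:M) (measurable_cst _) H1.
by rewrite integral0 => Z10; move: Z1_gt0; rewrite Zg.unlock Z10 ltxx.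
Qed.

Section coercive.
Variable N : 'M[R]_K.
Hypothesis N1 : forall x, dot x x <= bform N x x.

Lemma Zg_le1 : (Zg N <= Zg (1%:M : 'M[R]_K))%E.
Proof. by apply: le_Zg => x; rewrite bform1. Qed.

Lemma ZgE : Zg N = (zg N)%:E.
Proof.
rewrite zg.unlock fineK// ge0_fin_numE; first exact: le_lt_trans Zg_le1 Z1_lty.
exact/ltW/Zg_gt0.
Qed.

Lemma zg_gt0 : 0 < zg N.
Proof. by rewrite -lte_fin -ZgE Zg_gt0. Qed.

End coercive.

Lemma zg_le N M : (forall x, dot x x <= bform N x x) ->
  (forall x, bform N x x <= bform M x x) -> zg M <= zg N.
Proof.
move=> N1 NM; have M1 x : dot x x <= bform M x x by exact: le_trans (NM x).
rewrite -lee_fin.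
rewrite -(ZgE M1).
rewrite -(ZgE N1).
exact: le_Zg.
Qed.

(* One step of the convolution trick [exp(-|x-v|^2) exp(-|v|^2)] halves the
   coercivity constant needed for integrability. *)
Lemma Zg_half (l : R) : 0 < l -> (Zg (l%:M : 'M[R]_K) < +oo)%E -> (Zg ((l / 2)%:M : 'M[R]_K) < +oo)%E.
Proof.
move=> l0 Zl.
have bl (a : R) x y : bform a%:M x y = a * dot x y.
  by rewrite -scalemx1 bformZm bform1.
(* Centring [v] at half of [x] separates the variables: the exponent becomes [- l / 2] times
   [|x|^2 / 2 + 2 |v|^2]. Integrated in the other order, the same double integral is the square of
   the constant for [l]. *)
have E : (\int[lam]_x \int[lam]_v ((gf 0 0 l%:M (x - v))%:E * (gf 0 0 l%:M v)%:E) =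
          Zg ((l / 2)%:M : 'M[R]_K) * Zg ((2 * l)%:M : 'M[R]_K))%E.
  rewrite (ZgI (l / 2)%:M) -ge0_integralZr//.
  - apply: eq_integral => x _.
    rewrite -(ge0_integral_translate (2^-1 *: x)); last 2 first.
    + apply: emeasurable_funM => //; apply/measurable_EFinP.
      apply: (measurableT_comp (measurable_gf _ _ _)).
      by apply: measurable_mxD => //; exact: measurable_mxN.
    + by move=> v; rewrite mule_ge0// lee_fin gf_ge0.
    rewrite ZgI -[RHS]ge0_integralZl.
    + apply: eq_integral => v _; rewrite -!EFinM /gf -!expRD; congr EFin; congr expR.
      rewrite !bl !bformD (dotC v x) !(dotC 0) !dot0r.
      by field.
    + exact: measurableT.
    + exact: measurable_gfE.
    + by move=> v _; rewrite lee_fin gf_ge0.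
    + by rewrite lee_fin gf_ge0.
  - by move=> x _; rewrite lee_fin gf_ge0.
  - exact/ltW/Zg_gt0.
have : (\int[lam]_x \int[lam]_v ((gf 0 0 l%:M (x - v))%:E * (gf 0 0 l%:M v)%:E) =
          Zg (l%:M : 'M[R]_K) * Zg (l%:M : 'M[R]_K))%E.
  rewrite (fubini_tonelli (m1 := lam) (m2 := lam)
    (fun z => (gf 0 0 l%:M (z.1 - z.2))%:E * (gf 0 0 l%:M z.2)%:E)%E)/=; last 2 first.
  - apply: emeasurable_funM; apply/measurable_EFinP;
      apply: (measurableT_comp (measurable_gf _ _ _)) => //.
    by apply: measurable_mxD => //; exact: measurable_mxN.
  - by move=> z; rewrite mule_ge0// lee_fin gf_ge0.
  rewrite [X in (_ = _ * X)%E]ZgI -[RHS]ge0_integralZl//; [|by move=> x _; rewrite lee_fin gf_ge0|exact/ltW/Zg_gt0].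
  apply: eq_integral => v _.
  rewrite ge0_integralZr//; last 3 first.
  - apply/measurable_EFinP; apply: (measurableT_comp (measurable_gf _ _ _)) => //.
    exact: measurable_addmx.
  - by move=> x _; rewrite lee_fin gf_ge0.
  - by rewrite lee_fin gf_ge0.
  congr (_ * _)%E; rewrite ZgI.
  rewrite -[RHS](ge0_integral_translate (- v)); first by [].
    exact: measurable_gfE.
  by move=> x; rewrite lee_fin gf_ge0.
(* The factor for [2 * l] is positive, so an infinite factor for [l / 2] would make the square of a
   finite number infinite. *)
rewrite E => EZ; rewrite ltNge leye_eq; apply/negP => /eqP Zo.
move: EZ; rewrite Zo gt0_mulye ?Zg_gt0// => /esym ZZ.
have Zf : Zg (l%:M : 'M[R]_K) \is a fin_num by rewrite ge0_fin_numE//; exact/ltW/Zg_gt0.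
by have := fin_numM Zf Zf; rewrite ZZ.
Qed.

(** Halving from 1 reaches a value below any positive [l]. This serves the tail of the initial
    density, whose precision may be below 1. *)
Lemma Zg_lty (l : R) : 0 < l -> (Zg (l%:M : 'M[R]_K) < +oo)%E.
Proof.
move=> l0.
have bl (a : R) x y : bform a%:M x y = a * dot x y.
  by rewrite -scalemx1 bformZm bform1.
have H n : (Zg ((2^-1 ^+ n)%:M : 'M[R]_K) < +oo)%E.
  elim: n => [|n IH]; first by rewrite expr0.
  by rewrite exprSr; apply: Zg_half => //; rewrite exprn_gt0.
have [n nl] : exists n, 2^-1 ^+ n < l.
  have h1 : `|2^-1 : R| < 1 by rewrite ger0_norm ?invr_ge0// invf_lt1// ltr1n.
  have /cvgrPdist_lt/(_ l l0)[n _ /(_ n (leqnn n))] := cvg_expr h1.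
  by rewrite /= sub0r normrN ger0_norm ?exprn_ge0 ?invr_ge0//; exists n.
apply: le_lt_trans (H n); apply: le_Zg => x; rewrite !bl ler_wpM2r ?dot_ge0// ltW//.
Qed.

End gaussian.

(** * Gaussian filter densities *)

Section kalman.
Context (R : realType) (K : nat).
Local Notation V := ('cV[R]_K).
Local Notation lam := (@lebesgue_mx R K 1).
Variables (A Ri : 'M[R]_K) (cR : R).
Hypotheses (RiT : Ri^T = Ri) (Ri0 : forall x : V, 0 <= bform Ri x x).
Hypotheses (cR0 : 0 < cR).
Hypotheses (Z1_gt0 : (0 < Zg (1%:M : 'M[R]_K))%E)
  (Z1_lty : (Zg (1%:M : 'M[R]_K) < +oo)%E).

Let g (x : V) : R := cR * expR (- (bform Ri x x / 2)).
Let B := A^T *m Ri *m A.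

(** Unnormalised and possibly improper Gaussian functions of precision at most [L]. Filtering
    preserves the class with the same [L], which makes the constants below uniform over all
    observation sequences. *)
Definition isG (L : R) (f : V -> \bar R) : Prop :=
  exists (k : R) (b : V) (M : 'M[R]_K), [/\ M^T = M,
    (forall x, 0 <= bform M x x <= L * dot x x) &
    f = (fun x => (gf k b M x)%:E)].

Lemma isG_measurable L f : isG L f -> measurable_fun setT f.
Proof.
move=> [k [b [M [_ _ ->]]]]; apply/measurable_EFinP; exact: measurable_gf.
Qed.

Lemma isG_gt0 L f x : isG L f -> (0 < f x)%E.
Proof. by move=> [k [b [M [_ _ ->]]]]; rewrite lte_fin expR_gt0. Qed.

Lemma isG_ge0 L f x : isG L f -> (0 <= f x)%E.
Proof. by move=> /isG_gt0-/(_ x)/ltW. Qed.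

Lemma isG_fin L f x : isG L f -> f x \is a fin_num.
Proof. by move=> [k [b [M [_ _ ->]]]]. Qed.

Let BT : B^T = B.
Proof. by rewrite /B !trmx_mul trmxK RiT mulmxA. Qed.

Let B0 (x : V) : 0 <= bform B x x.
Proof. by rewrite /B bform_conj. Qed.

Lemma expo_gf k (b y x : V) M :
  expo x y * gf k b M x = gf k (b + y) (M + 1%:M) x.
Proof.
rewrite /expo /gf -expRD; congr expR.
by rewrite bformDm bform1 !bformD (dotC x y); field.
Qed.

Lemma kernel_gf k (b y x x' : V) M :
  g (x' - A *m x) * expo x y * gf k b M x =
  gf (k + ln cR - bform Ri x' x' / 2) (b + y + A^T *m (Ri *m x'))
    (M + 1%:M + B) x.
Proof.
rewrite -mulrA expo_gf /g /gf -{1}(lnK (x := cR))// -!expRD; congr expR.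
rewrite [bform (M + 1%:M + B) x x]bformDm /B bform_conj !bformD.
rewrite (bformC (A *m x) x' RiT).
have -> : dot (A^T *m (Ri *m x')) x = bform Ri x' (A *m x).
  by rewrite dot_mulmxl trmxK dot_mulmxl RiT bformE.
by field.
Qed.

Section step.
Variables (k : R) (b y : V) (M : 'M[R]_K).
Hypotheses (MT : M^T = M) (M0 : forall x, 0 <= bform M x x).

Let N := M + 1%:M + B.
Let Ni := invmx N.

Let NT : N^T = N.
Proof. by rewrite /N !linearD/= MT trmx1 BT. Qed.

Let N1 x : dot x x <= bform N x x.
Proof. by rewrite /N !bformDm bform1; have := M0 x; have := B0 x; lra. Qed.

Let uN : N \in unitmx. Proof. exact: dot_le_unitmx. Qed.
Let NiT : Ni^T = Ni. Proof. exact: trmx_invmx. Qed.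

(** Kalman recursion in information form. The observation raises the precision to [M + 1%:M];
    integrating the old state out by completing the square leaves the Woodbury expression for the
    precision after the transition. *)
Lemma filt_gf : filt A g y (fun x => (gf k b M x)%:E) =
  (fun x => (gf (k + ln cR + ln (zg N) + bform Ni (b + y) (b + y) / 2)
    (Ri *m (A *m (Ni *m (b + y))))
    (Ri - Ri *m A *m Ni *m A^T *m Ri) x)%:E).
Proof.
apply/funext => x'; rewrite /filt.
under eq_integral do rewrite -EFinM kernel_gf.
rewrite integral_gf// (ZgE Z1_gt0 Z1_lty N1) -EFinM; congr EFin.
rewrite -{1}(lnK (x := zg N)); last by rewrite posrE; exact: zg_gt0.
rewrite -expRD /gf -[invmx _]/Ni; congr expR.
set u := b + y; set c := A^T *m (Ri *m x').
have cE : c = A^T *m (Ri *m x') by [].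
clearbody u c.
rewrite !bformD (bformC u c NiT).
have -> : dot (Ri *m (A *m (Ni *m u))) x' = bform Ni c u.
  by rewrite (bformC c u NiT) bformE cE !dot_mulmxl NiT RiT.
rewrite bformDm bformNm.
have -> : bform (Ri *m A *m Ni *m A^T *m Ri) x' x' = bform Ni c c.
  by rewrite !bformE cE !dot_mulmxl !trmxK RiT !mulmxA.
by field.
Qed.

Let bformM' (x : V) :
  let w := Ni *m (A^T *m (Ri *m x)) in
  bform (Ri - Ri *m A *m Ni *m A^T *m Ri) x x = bform Ri x x - bform N w w.
Proof.
move=> w; rewrite bformDm bformNm; congr (_ - _).
have Nw : N *m w = A^T *m (Ri *m x) by rewrite mulKVmx.
rewrite [in RHS]bformE Nw bformE /w dot_mulmxl NiT !dot_mulmxl trmxK RiT.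
by rewrite !mulmxA.
Qed.

(** The new precision is [Ri] minus a nonnegative form, whence the upper bound. Its nonnegativity is
    that of [Ri] at [x - A *m w], the remainder being the forms of [M] and of the identity at
    [w]. *)
Lemma filt_isG_step L : (forall x, bform Ri x x <= L * dot x x) ->
  isG L (filt A g y (fun x => (gf k b M x)%:E)).
Proof.
move=> RiL; rewrite filt_gf; do 3 eexists; split; last reflexivity.
  rewrite linearB/= RiT !trmx_mul trmxK RiT NiT; congr (_ - _).
  by rewrite !mulmxA.
move=> x; rewrite bformM'; set w := Ni *m _; apply/andP; split; last first.
  by have := RiL x; have := dot_ge0 w; have := N1 w; lra.
have Nw : N *m w = A^T *m (Ri *m x) by rewrite mulKVmx.
have wx : bform N w w = bform Ri (A *m w) x.
  by rewrite bformE Nw bformE dot_mulmxl.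
have := Ri0 (x - A *m w); rewrite !bformD (bformC x _ RiT) -wx.
have : bform N w w = bform M w w + dot w w + bform Ri (A *m w) (A *m w).
  by rewrite /N !bformDm bform1 /B bform_conj.
by have := M0 w; have := dot_ge0 w; lra.
Qed.

End step.

Lemma filt_isG L y f : (forall x, bform Ri x x <= L * dot x x) ->
  isG L f -> isG L (filt A g y f).
Proof.
move=> RiL [k [b [M [MT ML ->]]]]; apply: filt_isG_step => // x.
by have /andP[] := ML x.
Qed.

Lemma alpha_isG L ys f : (forall x, bform Ri x x <= L * dot x x) ->
  isG L f -> isG L (alpha A g f ys).
Proof. by move=> RiL; elim: ys f => //= y ys IH f fG; apply: IH; exact: filt_isG. Qed.

(** Arrival and departure are decoupled in the kernel: half the form [Ri] of the difference
    [x' - A *m x] is at most the sum of its values at [x'] and at [A *m x]. *)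
Lemma filt_ge_gauss y f x' : measurable_fun setT f -> (forall x, 0 <= f x)%E ->
  ((cR * expR (- bform Ri x' x'))%:E *
    \int[lam]_x ((expR (- bform B x x))%:E * ((expo x y)%:E * f x))
   <= filt A g y f x')%E.
Proof.
move=> mf f0.
have mB : measurable_fun setT (fun x : V => (expR (- bform B x x))%:E).
  apply/measurable_EFinP; apply: measurableT_comp => //; apply: measurableT_comp => //.
  exact: measurable_bform.
have mE : measurable_fun setT (fun x : V => (expo x y)%:E).
  by apply/measurable_EFinP; exact: measurable_expo.
have mg : measurable_fun setT g.
  apply: measurable_funM => //; apply: measurableT_comp => //.
  apply: measurableT_comp => //; apply: measurable_funM => //.
  exact: measurable_bform.
rewrite -ge0_integralZl//.
- apply: ge0_le_integral => //.
  + move=> x _; rewrite !mule_ge0// lee_fin ?expR_ge0//.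
    by rewrite mulr_ge0 ?expR_ge0// ltW.
  + by apply: emeasurable_funM => //; apply: emeasurable_funM => //;
      exact: emeasurable_funM.
  + apply: emeasurable_funM => //; apply: measurable_kernel => //.
  + move=> x _; have -> : ((g (x' - A *m x) * expo x y)%:E * f x =
        (g (x' - A *m x))%:E * ((expo x y)%:E * f x))%E by rewrite EFinM muleA.
    rewrite muleA; apply: lee_wpmul2r.
      by rewrite mule_ge0// lee_fin expR_ge0.
    rewrite -EFinM lee_fin /g -mulrA ler_pM2l// -expRD ler_expR /B bform_conj.
    have := Ri0 (x' + A *m x); rewrite !bformD (bformC x' _ RiT); lra.
- apply: emeasurable_funM => //; exact: emeasurable_funM.
- by move=> x _; rewrite !mule_ge0// lee_fin expR_ge0.
- by rewrite lee_fin mulr_ge0 ?expR_ge0// ltW.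
Qed.

(* Contraction: a filtering step multiplies the negative log-density at 0 of the
   predictive law by [theta < 1], up to the normalisation and a constant. This
   works because observations make the posterior at least as concentrated as the
   standard Gaussian, whatever the norm of [A]. *)
Lemma lyapunov L : 0 <= L -> exists C theta : R, 0 <= theta < 1 /\
  forall f y x', isG L f -> exists l : R, [/\ 0 < l,
    (\int[lam]_x ((expo x y)%:E * f x) = l%:E)%E &
    - C - bform Ri x' x' + theta * (ln (fine (f 0)) - ln l) <=
      ln (fine (filt A g y f x')) - ln l].
Proof.
move=> L0; have [LB LB0 BL] := bform_le_dot B.
(* The posterior precision [N] is at least the identity, so adding [2 B] multiplies it by at most
   [1 + 2 * LB] and its inverse keeps at least the fraction [kap]; the rest, [1 - kap], is the
   contraction factor. *)
pose kap := (1 + 2 * LB)^-1.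
have kap0 : 0 < kap by rewrite invr_gt0; lra.
have kapE : kap * (1 + 2 * LB) = 1 by rewrite mulVf// gt_eqF//; lra.
have kap1 : kap <= 1 by rewrite invf_le1; lra.
(* Dominates [N2] for every [f] in the class, so [zg top] bounds the normalising constant of [N2]
   from below. *)
pose top : 'M[R]_K := (L + 1 + 2 * LB)%:M.
pose C := - (ln cR + ln (zg top) - kap * ln (zg (1%:M : 'M[R]_K))).
exists C, (1 - kap); split; first lra.
move=> f y x' fG; have mf := isG_measurable fG; have f0 x := isG_ge0 x fG.
have [k [b [M [MT ML fE]]]] := fG.
set N := M + 1%:M; set N2 := N + (2 : R) *: B; set u := b + y.
have NT : N^T = N by rewrite /N linearD/= MT trmx1.
have N2T : N2^T = N2 by rewrite /N2 linearD/= NT linearZ/= BT.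
have M0 x : 0 <= bform M x x by have /andP[] := ML x.
have ML' x : bform M x x <= L * dot x x by have /andP[] := ML x.
have NE x : bform N x x = bform M x x + dot x x by rewrite /N bformDm bform1.
have N2E x : bform N2 x x = bform M x x + dot x x + 2 * bform B x x.
  by rewrite /N2 bformDm bformZm NE.
have N1 x : dot x x <= bform N x x by rewrite NE; have := M0 x; lra.
have N21 x : dot x x <= bform N2 x x by rewrite N2E; have := M0 x; have := B0 x; lra.
have topE x : bform top x x = (L + 1 + 2 * LB) * dot x x.
  by rewrite /top -scalemx1 bformZm bform1.
have zN : zg N <= zg (1%:M : 'M[R]_K).
  by apply: zg_le => // x; rewrite bform1.
have zN2 : zg top <= zg N2.
  by apply: zg_le => // x; rewrite topE N2E; have := ML' x; have := BL x; lra.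
have ztop : 0 < zg top.
  apply: zg_gt0 => // x; rewrite topE; have := dot_ge0 x; nra.
have zN0 : 0 < zg N by exact: zg_gt0.
have uN := dot_le_unitmx N1; have uN2 := dot_le_unitmx N21.
exists (expR (k + bform (invmx N) u u / 2) * zg N); split.
- by rewrite mulr_gt0// expR_gt0.
- rewrite fE; under eq_integral do rewrite -[(_ * _)%E]EFinM expo_gf.
  by rewrite integral_gf// (ZgE Z1_gt0 Z1_lty N1).
have := filt_ge_gauss y x' mf f0.
have E x : ((expR (- bform B x x))%:E * ((expo x y)%:E * (gf k b M x)%:E) =
    (gf k u N2 x)%:E)%E.
  rewrite -[((expo x y)%:E * _)%E]EFinM expo_gf -EFinM -/u -/N; congr EFin.
  by rewrite /gf -expRD; congr expR; rewrite N2E NE; field.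
rewrite fE; under eq_integral do rewrite E.
rewrite integral_gf// (ZgE Z1_gt0 Z1_lty N21) -!EFinM.
have fG' : isG L (fun x => (gf k b M x)%:E) by rewrite -fE.
have q2E (v : V) : kap * bform (invmx N) v v <= bform (invmx N2) v v.
  set w := invmx N *m v.
  have Nw : N *m w = v by rewrite mulKVmx.
  have qE : bform (invmx N) v v = bform N w w by rewrite !bformE Nw dotC.
  have N20 x : 0 <= bform N2 x x by exact: le_trans (dot_ge0 x) (N21 x).
  (* The maximiser [w] for [N], shrunk by [kap], is the test vector in the dual formula for [N2]. *)
  have := bform_inv_ge v (kap *: w) N2T uN2 N20.
  have dq : dot v w = bform N w w by rewrite bformE Nw dotC.
  rewrite !bformD dq qE.
  have : kap * (kap * bform N2 w w) <= kap * bform N w w.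
    rewrite ler_wpM2l ?(ltW kap0)//.
    have : kap * bform N2 w w <= kap * ((1 + 2 * LB) * bform N w w).
      rewrite ler_wpM2l ?(ltW kap0)// N2E -NE.
      have := BL w; have := N1 w.
      have : LB * dot w w <= LB * bform N w w by rewrite ler_wpM2l.
      lra.
    by rewrite mulrA kapE mul1r.
  lra.
rewrite filt_gf// lee_fin [fine _]/= [fine (_%:E)]/=.
set v := (gf _ _ _ x') => fil.
rewrite /gf dot0r [bform M 0 0]bformE mulmx0 dot0r expRK.
have zN20 : 0 < zg N2 by exact: lt_le_trans zN2.
have : ln (cR * expR (- bform Ri x' x') *
    (expR (k + bform (invmx N2) u u / 2) * zg N2)) <= ln v.
  by rewrite ler_ln ?posrE ?expR_gt0// !mulr_gt0 ?expR_gt0.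
rewrite !lnM ?posrE ?mulr_gt0 ?expR_gt0// !expRK.
have : ln (zg top) <= ln (zg N2) by rewrite ler_ln.
have : kap * ln (zg N) <= kap * ln (zg (1%:M : 'M[R]_K)).
  by rewrite ler_wpM2l ?(ltW kap0)// ler_ln ?posrE//; exact: lt_le_trans zN.
rewrite /C; move: (q2E u); clear; lra.
Qed.

End kalman.

(** * Lower bound on the predictive density *)

Definition cutoff (R : realType) K (rho : R) (f : 'cV[R]_K -> \bar R)
    (x : 'cV[R]_K) : \bar R :=
  if dot x x <= rho then f x else 0%E.

Definition tail (R : realType) K (rho : R) (f : 'cV[R]_K -> \bar R)
    (x : 'cV[R]_K) : \bar R :=
  if dot x x <= rho then 0%E else f x.

Section predictive_density.
Context (R : realType) (K : nat).
Local Notation V := ('cV[R]_K).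
Local Notation lam := (@lebesgue_mx R K 1).
Variables (A Ri : 'M[R]_K) (cR : R).
Hypotheses (RiT : Ri^T = Ri) (Ri0 : forall x : V, 0 <= bform Ri x x).
Hypotheses (cR0 : 0 < cR).
Hypotheses (Z1_gt0 : (0 < Zg (1%:M : 'M[R]_K))%E)
  (Z1_lty : (Zg (1%:M : 'M[R]_K) < +oo)%E).

Let g (x : V) : R := cR * expR (- (bform Ri x x / 2)).
Hypothesis g1 : (\int[lam]_x (g x)%:E = 1)%E.

Variables (L c1 : R) (f1 : V -> \bar R).
Hypotheses (L0 : 0 <= L) (RiL : forall x, bform Ri x x <= L * dot x x).
Hypotheses (f1G : isG L f1) (f1_1 : (\int[lam]_x f1 x = 1)%E).
Hypothesis f1_le : forall x, (f1 x <= c1%:E)%E.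

Local Notation alpha := (alpha A g).
Local Notation Lam := (Lam A g).
Local Notation filt := (filt A g).

Lemma measurable_gauss_kernel : measurable_fun setT g.
Proof.
apply: measurable_funM => //; apply: measurableT_comp => //.
apply: measurableT_comp => //; apply: measurable_funM => //.
exact: measurable_bform.
Qed.

Lemma gauss_kernel_ge0 x : 0 <= g x.
Proof. by rewrite /g mulr_ge0 ?expR_ge0// ltW. Qed.

Let mg := measurable_gauss_kernel.
Let g0 := gauss_kernel_ge0.

Lemma alpha_f1G ys : isG L (alpha f1 ys).
Proof. exact: alpha_isG. Qed.

(** After an observation the mass is the positive real [l] of the Lyapunov estimate. *)
Lemma Lam_f1_gt0_lty ys : (0 < Lam f1 ys < +oo)%E.
Proof.
have f10 x := isG_ge0 x f1G; have mf1 := isG_measurable f1G.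
case/lastP: ys => [|ys y]; first by rewrite LamE/= f1_1 lte01 ltry.
rewrite Lam_rcons//.
have [C [th [_ /(_ _ y 0 (alpha_f1G ys))[l [l0 -> _]]]]] :=
  lyapunov A RiT Ri0 cR0 Z1_gt0 Z1_lty L0.
by rewrite lte_fin l0 ltry.
Qed.

Definition LamR ys : R := fine (Lam f1 ys).

Lemma LamRE ys : Lam f1 ys = (LamR ys)%:E.
Proof.
have /andP[l0 ly] := Lam_f1_gt0_lty ys.
by rewrite /LamR fineK// ge0_fin_numE// ltW.
Qed.

Lemma LamR_gt0 ys : 0 < LamR ys.
Proof. by have /andP[+ _] := Lam_f1_gt0_lty ys; rewrite LamRE lte_fin. Qed.

Lemma LamR_nil : LamR [::] = 1.
Proof. by rewrite /LamR LamE/= f1_1. Qed.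

Lemma LamR_rcons_le ys y : LamR (rcons ys y) <= expR (dot y y / 2) * LamR ys.
Proof.
have f10 x := isG_ge0 x f1G; have mf1 := isG_measurable f1G.
by rewrite -lee_fin EFinM -!LamRE; exact: Lam_rcons_le.
Qed.

Lemma LamR_le ys (r2 : R) : (forall y, y \in ys -> dot y y <= r2) ->
  LamR ys <= expR ((size ys)%:R * (r2 / 2)).
Proof.
elim/last_ind: ys => [|ys y IH] yr; first by rewrite LamR_nil mul0r expR0.
rewrite (le_trans (LamR_rcons_le _ _))// size_rcons -[(size ys).+1%:R]natr1 mulrDl mul1r addrC expRD.
apply: ler_pM; rewrite ?expR_ge0//; first exact/ltW/LamR_gt0.
  by rewrite ler_expR; have := yr y; rewrite mem_rcons inE eqxx => /(_ isT); lra.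
by apply: IH => z zy; apply: yr; rewrite mem_rcons inE zy orbT.
Qed.

(** Normalised predictive log-density; its value at the origin is the Lyapunov function of the
    forgetting argument. *)
Let h ys x : R := ln (fine (alpha f1 ys x)) - ln (LamR ys).

Let h_nil_ge : exists2 D : R, 0 <= D &
  forall x, - D - (L + 1) * dot x x <= h [::] x.
Proof.
have [k [b [M [MT ML f1E]]]] := f1G.
exists (`|k| + dot b b); first by rewrite addr_ge0// dot_ge0.
move=> x; rewrite /h LamR_nil ln1 subr0 /= f1E/= /gf expRK.
have /andP[M0 Mx] := ML x; have := dot_ge0 x; have := dot_ge0 b.
have := dot_ge0 (b + x); rewrite !bformD (dotC x b).
have := ler_norm (- k); rewrite normrN.
have : 0 <= L * dot x x by exact: le_trans M0 Mx.
lra.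
Qed.

(** One step turns a lower bound [v] for [h] at 0 into [th * (v - increment)] minus a constant, the
    increment being that of the log-likelihood. Along [ys] the increments are at most [c]; along
    [zs] they are at most [r2 / 2], so there the part proportional to [c] only decays. *)
Lemma predictive_density_ge : exists D p C Q theta : R,
  [/\ 0 <= p, 0 <= C, 0 <= Q, 0 <= theta < 1 &
  forall (c r2 : R) ys zs x, 0 <= c -> 0 <= r2 ->
    (forall i, (i < size ys)%N ->
       LamR (take i.+1 ys) <= expR c * LamR (take i ys)) ->
    (forall y, y \in zs -> dot y y <= r2) ->
    ((LamR (ys ++ zs) * expR (- (theta ^+ size zs * (p * c) + D +
        (size zs)%:R * (C + r2 / 2) + Q * dot x x)))%:E
      <= alpha f1 (ys ++ zs) x)%E].
Proof.
have f10 x := isG_ge0 x f1G; have mf1 := isG_measurable f1G.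
have [C0 [th [/andP[th0 th1] lya]]] := lyapunov A RiT Ri0 cR0 Z1_gt0 Z1_lty L0.
have [D0 D00 hD0] := h_nil_ge.
pose C := `|C0|; have C_ge0 : 0 <= C by rewrite /C normr_ge0.
have step ys y x : - C - L * dot x x + th * (h ys 0 -
    (ln (LamR (rcons ys y)) - ln (LamR ys))) <= h (rcons ys y) x.
  have [l [l0 lE]] := lya _ y x (alpha_f1G ys).
  have -> : l = LamR (rcons ys y) by rewrite /LamR Lam_rcons// lE.
  rewrite /h alpha_rcons; have := RiL x; have := ler_norm C0; rewrite -/C.
  set a := ln (fine (alpha f1 ys 0)); set t := ln _.
  have -> : a - ln (LamR ys) - (t - ln (LamR ys)) = a - t by ring.
  lra.
(* Fixed points of the recursion: [p = th * (p + 1)] absorbs one penalty [c] per step, and [D] one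
   constant [C] per step. *)
pose p := th / (1 - th); pose D := Num.max D0 (C / (1 - th)).
have th1' : 0 < 1 - th by lra.
have p0 : 0 <= p by rewrite divr_ge0// ltW.
have D0D : D0 <= D by rewrite le_max lexx.
have CD : C + th * D <= D.
  have : C / (1 - th) <= D by rewrite le_max lexx orbT.
  rewrite ler_pdivrMr//; lra.
have pE : th * (p + 1) = p.
  by rewrite /p; field; rewrite gt_eqF.
have D_ge0 : 0 <= D by exact: le_trans D0D.
have h1 (c : R) ys x : 0 <= c -> (forall i, (i < size ys)%N ->
    LamR (take i.+1 ys) <= expR c * LamR (take i ys)) ->
    - D - p * c - (L + 1) * dot x x <= h ys x.
  move=> c0; elim/last_ind: ys x => [|ys y IH] x inc.
    have := hD0 x; have : 0 <= p * c by rewrite mulr_ge0.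
    lra.
  have {}IH : - D - p * c - (L + 1) * dot (0 : V) 0 <= h ys 0.
    apply: IH => i iys; have := inc i; rewrite size_rcons => /(_ (ltnW iys)).
    rewrite -!cats1 !takel_cat//; exact: ltnW.
  rewrite dot0r mulr0 subr0 in IH.
  have incl : ln (LamR (rcons ys y)) - ln (LamR ys) <= c.
    have := inc (size ys); rewrite size_rcons ltnSn => /(_ isT).
    rewrite -{1}(size_rcons ys y) take_size -cats1 take_size_cat// cats1.
    rewrite -ler_ln ?posrE ?mulr_gt0 ?expR_gt0 ?LamR_gt0//.
    by rewrite lnM ?posrE ?expR_gt0 ?LamR_gt0// expRK; lra.
  have := step ys y x; have := dot_ge0 x.
  have : th * (- D - p * c - c) <= th * (h ys 0 - (ln (LamR (rcons ys y)) - ln (LamR ys))).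
    by rewrite ler_wpM2l//; lra.
  have : th * (- D - p * c - c) = - (th * D) - th * (p + 1) * c by ring.
  rewrite pE; lra.
(* The bounded increments along [zs] are merely added up, which gives the term linear in [size zs],
   while the inherited penalty is multiplied by [th] each time. *)
have h2 (c r2 : R) ys zs x : 0 <= c -> 0 <= r2 -> (forall i, (i < size ys)%N ->
    LamR (take i.+1 ys) <= expR c * LamR (take i ys)) ->
    (forall y, y \in zs -> dot y y <= r2) ->
    - (th ^+ size zs * (p * c) + D + (size zs)%:R * (C + r2 / 2)) -
      (L + 1) * dot x x <= h (ys ++ zs) x.
  move=> c0 r20 inc; elim/last_ind: zs x => [|zs z IH] x zr.
    by rewrite /= cats0 expr0 mul1r mul0r; have := h1 c ys x c0 inc; lra.
  have zr' y : y \in zs -> dot y y <= r2.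
    by move=> yz; apply: zr; rewrite mem_rcons inE yz orbT.
  have {}IH := IH 0 zr'.
  rewrite dot0r mulr0 subr0 in IH.
  have incl : ln (LamR (rcons (ys ++ zs) z)) - ln (LamR (ys ++ zs)) <= r2 / 2.
    have := LamR_rcons_le (ys ++ zs) z.
    rewrite -ler_ln ?posrE ?mulr_gt0 ?expR_gt0 ?LamR_gt0//.
    rewrite lnM ?posrE ?expR_gt0 ?LamR_gt0// expRK.
    by have := zr z; rewrite mem_rcons inE eqxx => /(_ isT); lra.
  rewrite -rcons_cat; have := step (ys ++ zs) z x; have := dot_ge0 x.
  rewrite size_rcons exprS -[(size zs).+1%:R]natr1.
  set n := (size zs)%:R in IH *; set q := th ^+ size zs * (p * c) in IH *.
  set inc1 := ln _ - ln _ in incl *.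
  have n0 : 0 <= n by rewrite /n.
  have q0 : 0 <= q by apply: mulr_ge0; [exact: exprn_ge0|exact: mulr_ge0].
  have : th * (- (q + D + n * (C + r2 / 2)) - r2 / 2) <= th * (h (ys ++ zs) 0 - inc1).
    by rewrite ler_wpM2l//; lra.
  have : th * (D + n * (C + r2 / 2) + r2 / 2) <= 1 * (D + n * (C + r2 / 2) + r2 / 2).
    rewrite ler_wpM2r ?(ltW th1)//.
    have : 0 <= n * (C + r2 / 2) by rewrite mulr_ge0//; lra.
    lra.
  have -> : th * th ^+ size zs * (p * c) = th * q by rewrite /q -mulrA.
  rewrite mul1r; lra.
exists D, p, C, (L + 1), th; split; [exact: p0|exact: C_ge0|exact: addr_ge0|by rewrite th0 th1|].
move=> c r2 ys zs x c0 r20 inc zr; have := h2 c r2 ys zs x c0 r20 inc zr.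
set a := (- _ - _); set b := expR _.
have ab : b = expR a by congr expR; rewrite /a; ring.
rewrite -(fineK (isG_fin x (alpha_f1G (ys ++ zs)))) lee_fin /h.
have a0 : 0 < fine (alpha f1 (ys ++ zs) x).
  by rewrite -lte_fin fineK ?(isG_gt0 x (alpha_f1G _))// (isG_fin x (alpha_f1G _)).
have b0 : 0 < b by rewrite ab expR_gt0.
move=> ale; rewrite -ler_ln ?posrE ?mulr_gt0 ?LamR_gt0//.
rewrite lnM ?posrE ?LamR_gt0// ab expRK; lra.
Qed.

(** The transition density is at most [cR], so after any step the predictive density is at most [cR]
    times its mass; [c1] serves before the first observation. *)
Lemma predictive_density_le ys x :
  (alpha f1 ys x <= (Num.max cR c1 * LamR ys)%:E)%E.
Proof.
have f10 x' := isG_ge0 x' f1G; have mf1 := isG_measurable f1G.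
case/lastP: ys => [|ys y].
  rewrite LamR_nil mulr1 (le_trans (f1_le x))// lee_fin.
  by rewrite le_max lexx orbT.
rewrite alpha_rcons EFinM -LamRE Lam_rcons//.
have mal := isG_measurable (alpha_f1G ys).
have al0 x' := isG_ge0 x' (alpha_f1G ys).
have mE : measurable_fun setT (fun x : V => (expo x y)%:E).
  by apply/measurable_EFinP; exact: measurable_expo.
rewrite -ge0_integralZl//.
- apply: ge0_le_integral => //.
  + by move=> x' _; rewrite mule_ge0// kernel_ge0.
  + by apply: emeasurable_funM => //; exact: measurable_kernel.
  + by apply: emeasurable_funM => //; exact: emeasurable_funM.
  + move=> x' _; rewrite EFinM -muleA; apply: lee_wpmul2r.
      by rewrite mule_ge0// lee_fin expo_ge0.
    rewrite lee_fin /g; apply: (@le_trans _ _ cR); last by rewrite le_max lexx.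
    rewrite -[leRHS]mulr1 ler_pM2l// -expR0 ler_expR.
    by rewrite oppr_le0 divr_ge0.
- exact: emeasurable_funM.
- by move=> x' _; rewrite mule_ge0// lee_fin expo_ge0.
- by rewrite lee_fin le_max ltW.
Qed.

Section truncation.
Variables (rho : R) (f : V -> \bar R).
Hypotheses (mf : measurable_fun setT f) (f0 : forall x, (0 <= f x)%E).

Let ball := [set x : V | dot x x <= rho].

Let measurable_ball : measurable ball.
Proof.
have md : measurable_fun setT (fun x : V => dot x x) by exact: measurable_dot.
rewrite (_ : ball = (fun x : V => dot x x) @^-1` `]-oo, rho]).
  by rewrite -[X in measurable X]setTI; apply: md.
by apply/seteqP; split=> x; rewrite /= in_itv.
Qed.

Let cutoffE : cutoff rho f = (fun x => (\1_ball x)%:E * f x)%E.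
Proof.
apply/funext => x; rewrite /cutoff indicE.
case: ifPn => hx; first by rewrite mem_set// mul1e.
by rewrite memNset ?mul0e//; exact/negP.
Qed.

Let tailE : tail rho f = (fun x => (\1_(~` ball) x)%:E * f x)%E.
Proof.
apply/funext => x; rewrite /tail indicE in_setC.
case: ifPn => hx; first by rewrite mem_set// mul0e.
by rewrite memNset ?mul1e//; exact/negP.
Qed.

Lemma measurable_cutoff : measurable_fun setT (cutoff rho f).
Proof.
rewrite cutoffE; apply: emeasurable_funM => //; apply/measurable_EFinP.
exact: measurable_indic.
Qed.

Lemma measurable_tail : measurable_fun setT (tail rho f).
Proof.
rewrite tailE; apply: emeasurable_funM => //; apply/measurable_EFinP.
by apply: measurable_indic; exact: measurableC.
Qed.

Lemma cutoff_ge0 x : (0 <= cutoff rho f x)%E.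
Proof. by rewrite /cutoff; case: ifP. Qed.

Lemma tail_ge0 x : (0 <= tail rho f x)%E.
Proof. by rewrite /tail; case: ifP. Qed.

Lemma cutoffD : f = (cutoff rho f \+ tail rho f)%E.
Proof.
by apply/funext => x; rewrite /cutoff /tail; case: ifP; rewrite ?adde0 ?add0e.
Qed.

End truncation.

(** On the ball, the predictive density after [xs ++ ys] dominates a multiple [k] of the one after
    [ys], by the lower bound for the former and the upper bound for the latter. Filtering along [zs]
    is linear and monotone, so [k] times the mass issued from the ball is at most
    [expR c * LamR (xs ++ ys)]; the factor [LamR (xs ++ ys)] is also in [k] and cancels. *)
Lemma likelihood_dichotomy : exists D p C Q theta : R,
  [/\ 0 <= p, 0 <= C, 0 <= Q, 0 <= theta < 1 &
  forall (c r2 rho : R) xs ys zs, 0 <= c -> 0 <= r2 -> 0 <= rho ->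
    (forall i, (i < size xs)%N ->
       LamR (take i.+1 xs) <= expR c * LamR (take i xs)) ->
    (forall y, y \in ys -> dot y y <= r2) ->
    LamR (xs ++ ys ++ zs) <= expR c * LamR (xs ++ ys) ->
    LamR (ys ++ zs) <= expR (c + theta ^+ size ys * (p * c) + D +
        (size ys)%:R * (C + r2) + Q * rho) \/
    (Lam f1 (ys ++ zs) <= 2%:E * Lam (tail rho (alpha f1 ys)) zs)%E].
Proof.
have [D [p [C [Q [th [p0 C0 Q0 th01 dens]]]]]] := predictive_density_ge.
pose m := Num.max cR c1.
have m0 : 0 < m by rewrite lt_max cR0.
(* [ln m] comes from the upper bound on the density and [ln 2] from the ball carrying at least half
   of the mass. In [C + r2], one [r2 / 2] comes from the lower bound on the density and the other
   from [LamR_le]. *)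
exists (D + ln m + ln 2), p, C, Q, th; split=> //.
move=> c r2 rho xs ys zs c0 r20 rho0 inc yr stop.
set f := alpha f1 ys.
have fG : isG L f := alpha_f1G ys.
have mf := isG_measurable fG; have f0 x := isG_ge0 x fG.
have mcut := measurable_cutoff rho mf; have cut0 := cutoff_ge0 rho f0.
have mtail := measurable_tail rho mf; have tail0 := tail_ge0 rho f0.
have [|large] := leP (Lam f1 (ys ++ zs)) (2%:E * Lam (tail rho f) zs)%E.
  by right.
left.
pose a := th ^+ size ys * (p * c) + D + (size ys)%:R * (C + r2 / 2) + Q * rho.
pose k := LamR (xs ++ ys) * expR (- a) / (m * LamR ys).
have LXY : 0 < LamR (xs ++ ys) := LamR_gt0 _.
have mL : 0 < m * LamR ys by rewrite mulr_gt0// LamR_gt0.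
have k0 : 0 <= k.
  apply: divr_ge0; last exact: ltW.
  by apply: mulr_ge0; [exact: ltW|exact: expR_ge0].
have cutle x : (k%:E * cutoff rho f x <= alpha f1 (xs ++ ys) x)%E.
  rewrite /cutoff; case: ifPn => xrho; last first.
    by rewrite mule0 (isG_ge0 x (alpha_f1G _)).
  apply: le_trans (dens c r2 xs ys x c0 r20 inc yr).
  have := predictive_density_le ys x; rewrite -/f -/m.
  rewrite -(fineK (isG_fin x fG)) -EFinM !lee_fin => fle.
  rewrite /k mulrAC ler_pdivrMr//; apply: ler_pM => //.
  - by apply: mulr_ge0; [exact: ltW|exact: expR_ge0].
  - by rewrite fine_ge0.
  - rewrite ler_pM2l ?LamR_gt0// ler_expR /a lerN2.
    have : Q * dot x x <= Q * rho by rewrite ler_wpM2l.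
    lra.
have : (k%:E * Lam (cutoff rho f) zs <= (LamR (xs ++ ys ++ zs))%:E)%E.
  rewrite -LamRE -LamZ// catA Lam_cat; apply: le_Lam => //.
  - exact: emeasurable_funM.
  - exact: isG_measurable (alpha_f1G _).
  - by move=> x; rewrite mule_ge0.
have LD : Lam f1 (ys ++ zs) = (Lam (cutoff rho f) zs + Lam (tail rho f) zs)%E.
  by rewrite Lam_cat -/f {1}(cutoffD rho f) LamD.
have Lc : Lam (cutoff rho f) zs \is a fin_num.
  rewrite ge0_fin_numE ?Lam_ge0//; apply: le_lt_trans (proj2 (andP (Lam_f1_gt0_lty (ys ++ zs)))).
  by rewrite LD leeDl// Lam_ge0.
have Lt : Lam (tail rho f) zs \is a fin_num.
  rewrite ge0_fin_numE ?Lam_ge0//; apply: le_lt_trans (proj2 (andP (Lam_f1_gt0_lty (ys ++ zs)))).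
  by rewrite LD leeDr// Lam_ge0.
move: large LD; rewrite LamRE -(fineK Lc) -(fineK Lt) -EFinM -EFinD lte_fin.
set u := fine (Lam (cutoff _ _) _); set v := fine (Lam (tail _ _) _).
move=> large [LD]; rewrite -EFinM lee_fin => ku.
have u_ge : LamR (ys ++ zs) < 2 * u by lra.
apply/ltW/(lt_le_trans u_ge).
have {ku stop} : k * u <= expR c * LamR (xs ++ ys) by exact: le_trans stop.
rewrite /k mulrAC ler_pdivrMr ?mulr_gt0 ?LamR_gt0// => ku.
have {}ku : expR (- a) * u <= expR c * (m * LamR ys).
  rewrite -(ler_pM2l (LamR_gt0 (xs ++ ys))); lra.
have Lys := LamR_le yr.
have {}ku : u <= expR a * (expR c * (m * expR ((size ys)%:R * (r2 / 2)))).
  rewrite -ler_pdivrMl ?expR_gt0// -expRN (le_trans ku)//.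
  by rewrite ler_pM2l ?expR_gt0// ler_pM2l.
rewrite (le_trans (_ : _ <= expR (ln 2) * (expR a * (expR c * (expR (ln m) * expR ((size ys)%:R * (r2 / 2)))))))//.
  by rewrite !lnK ?posrE// ler_pM2l.
by rewrite -!expRD ler_expR /a; lra.
Qed.

End predictive_density.

(** * Hellinger affinity *)

Section measurable_power.
Context d (T : measurableType d) (R : realType) (f : T -> R).
Hypotheses (mf : measurable_fun setT f) (f0 : forall x, 0 <= f x).

Lemma measurable_invr_ge0 : measurable_fun setT (fun x => (f x)^-1).
Proof.
under eq_fun do rewrite -powR_inv1//.
exact: (measurableT_comp (measurable_powR (-1))).
Qed.

Lemma measurable_sqrtr_ge0 : measurable_fun setT (fun x => Num.sqrt (f x)).
Proof.
under eq_fun do rewrite -powR12_sqrt//.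
exact: (measurableT_comp (measurable_powR 2^-1)).
Qed.

End measurable_power.

Section affinity.
Context (R : realType) (K : nat).
Local Notation V := ('cV[R]_K).
Local Notation lam := (@lebesgue_mx R K 1).
Variables (A Ri : 'M[R]_K) (cR cI : R).
Hypotheses (K0 : (0 < K)%N).
Hypotheses (RiT : Ri^T = Ri) (Ri0 : forall x : V, 0 <= bform Ri x x).
Hypotheses (cR0 : 0 < cR) (cI0 : 0 < cI).

Let g (x : V) : R := cR * expR (- (bform Ri x x / 2)).
Let phi (x : V) : R := cI * expR (- (dot x x / 2)).
Hypothesis g1 : (\int[lam]_x (g x)%:E = 1)%E.
Hypothesis phi1 : (\int[lam]_x (phi x)%:E = 1)%E.

Let mg : measurable_fun setT g. Proof. exact: measurable_gauss_kernel. Qed.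
Let g0 x : 0 <= g x. Proof. exact: gauss_kernel_ge0. Qed.

Lemma measurable_std_gauss : measurable_fun setT phi.
Proof.
apply: measurable_funM => //; apply: measurableT_comp => //.
apply: measurableT_comp => //; apply: measurable_funM => //.
exact: measurable_dot.
Qed.

Lemma std_gauss_gt0 x : 0 < phi x.
Proof. by rewrite /phi mulr_gt0 ?expR_gt0. Qed.

Let mphi := measurable_std_gauss.
Let phi0 x : 0 <= phi x. Proof. exact/ltW/std_gauss_gt0. Qed.

Lemma std_gaussB x y : phi (y - x) = phi y * expo x y.
Proof.
rewrite /phi /expo -mulrA -expRD; congr (_ * expR _).
by rewrite !bformD (dotC y x); field.
Qed.

Lemma Zg1E : (cI%:E * Zg (1%:M : 'M[R]_K) = 1)%E.
Proof.
rewrite ZgI -ge0_integralZl.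
- rewrite -[RHS]phi1; apply: eq_integral => x _; rewrite -EFinM /gf /phi.
  by congr (_ * expR _)%:E; rewrite bform1 dotC dot0r; ring.
- exact: measurableT.
- by apply/measurable_EFinP; exact: measurable_gf.
- by move=> x _; rewrite lee_fin gf_ge0.
- by rewrite lee_fin ltW.
Qed.

Lemma Zg1_gt0 : (0 < Zg (1%:M : 'M[R]_K))%E.
Proof.
rewrite lt_neqAle; apply/andP; split; last first.
  by rewrite ZgI; apply: integral_ge0 => x _; rewrite lee_fin gf_ge0.
apply/negP => /eqP Z0; have := Zg1E; rewrite -Z0 mule0 => /eqP.
by rewrite eqe eq_sym oner_eq0.
Qed.

Lemma Zg1_lty : (Zg (1%:M : 'M[R]_K) < +oo)%E.
Proof.
rewrite ltNge leye_eq; apply/negP => /eqP Zo; have := Zg1E.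
by rewrite Zo gt0_muley ?lte_fin.
Qed.

Let Z1_gt0 := Zg1_gt0.
Let Z1_lty := Zg1_lty.

(** Up to the factor [C0], the mean of the bump [u] defined below at [x] plus standard noise; the 4
    is twice the sum of the unit variances of bump and noise. *)
Let q (x : V) : R := expR (- (dot x x / 4)).

Let mq : measurable_fun setT q.
Proof.
apply: measurableT_comp => //; apply: measurableT_comp => //.
by apply: measurable_funM => //; exact: measurable_dot.
Qed.

Let q0 x : 0 < q x. Proof. exact: expR_gt0. Qed.
Let q1 x : q x <= 1.
Proof. by rewrite /q -[leRHS]expR0 ler_expR; have := dot_ge0 x; lra. Qed.

(** Two Gaussian functions overlap most when their centres agree; both integrals are explicit after
    completing the square. *)
Let int_qg_le (a : V) :
  (\int[lam]_x (q (a + x) * g x)%:E <= \int[lam]_x (q x * g x)%:E)%E.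
Proof.
pose N := Ri + (2^-1 : R) *: 1%:M.
have NT : N^T = N by rewrite /N linearD/= linearZ/= trmx1 RiT.
have NE x : bform N x x = bform Ri x x + 2^-1 * dot x x.
  by rewrite /N bformDm bformZm bform1.
have uN : N \in unitmx.
  apply: pos_unitmx => x x0; rewrite NE.
  have := Ri0 x; have := dot_ge0 x; rewrite le_eqVlt => /orP[/eqP/esym/dot_eq0 x00|].
    by rewrite x00 eqxx in x0.
  lra.
have E a' x : q (a' + x) * g x =
    gf (ln cR - dot a' a' / 4) (- (2^-1 : R) *: a') N x.
  rewrite /q /g /gf -{1}(lnK (x := cR))// mulrCA -!expRD; congr expR.
  by rewrite NE !bformD (dotC x a'); field.
have E0 x : q x * g x = gf (ln cR) 0 N x.
  by have := E 0 x; rewrite add0r dot0r scaler0 mul0r subr0.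
under eq_integral do rewrite E.
under [leRHS]eq_integral do rewrite E0.
rewrite !integral_gf//; apply: lee_wpmul2r; first exact/ltW/Zg_gt0.
rewrite lee_fin ler_expR [bform _ 0 0]bformE mulmx0 dot0r.
set b := _ *: a; set w := invmx N *m b.
have Nw : N *m w = b by rewrite mulKVmx.
have -> : bform (invmx N) b b = bform N w w by rewrite !bformE Nw dotC.
have bw : dot b w = bform N w w by rewrite bformE Nw dotC.
have : dot a w = - 2 * bform N w w by rewrite -bw /b dotZl; field.
move=> aw; have := dot_ge0 (a + w); rewrite !bformD (dotC w a) aw.
have := NE w; have := Ri0 w; lra.
Qed.

(** By [int_qg_le], a bound on the mean of [q] at the next state, uniform in the current one. *)
Definition rho0 : R := fine (\int[lam]_x (q x * g x)%:E)%E.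

Let mqg0 : measurable_fun setT (fun x => (q x * g x)%:E).
Proof. by apply/measurable_EFinP; exact: measurable_funM. Qed.

Let mgE : measurable_fun setT (fun x => (g x)%:E).
Proof. exact/measurable_EFinP. Qed.

Let rho0_le1 : (\int[lam]_x (q x * g x)%:E <= 1)%E.
Proof.
rewrite -g1; apply: ge0_le_integral => //.
- by move=> x _; rewrite lee_fin mulr_ge0// ltW.
- by move=> x _; rewrite lee_fin ler_piMl.
Qed.

Let rho0E : (\int[lam]_x (q x * g x)%:E = rho0%:E)%E.
Proof.
rewrite /rho0 fineK// ge0_fin_numE ?(le_lt_trans rho0_le1 (ltry _))//.
by apply: integral_ge0 => x _; rewrite lee_fin mulr_ge0// ltW.
Qed.

Lemma rho0_ge0 : 0 <= rho0.
Proof.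
rewrite -lee_fin -rho0E; apply: integral_ge0 => x _.
by rewrite lee_fin mulr_ge0// ltW.
Qed.

(* Equality would force the mass of the kernel to sit at the origin, which
   translation invariance of the Lebesgue measure excludes. *)
Lemma rho0_lt1 : rho0 < 1.
Proof.
rewrite lt_neqAle -[X in _ && X]lee_fin -rho0E rho0_le1 andbT.
apply/negP => /eqP rho1.
pose D x := (g x - q x * g x)%:E.
have D0 x : (0 <= D x)%E by rewrite lee_fin subr_ge0 ler_piMl.
have mD : measurable_fun setT D.
  by apply/measurable_EFinP; apply: measurable_funB => //; exact: measurable_funM.
have intD : (\int[lam]_x D x = 0)%E.
  have : (\int[lam]_x D x + \int[lam]_x (q x * g x)%:E = 1)%E.
    rewrite -ge0_integralD//; last by move=> x _; rewrite lee_fin mulr_ge0// ltW.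
    by rewrite -g1; apply: eq_integral => x _; rewrite -EFinD subrK.
  rewrite rho0E rho1 -[X in _ = X]add0e => /(congr1 (fun z => z - 1%:E)%E).
  by rewrite !addeK.
have aeD : ae_eq lam setT D (cst 0%E).
  apply/ae_eq_integral_abs => //.
  by under eq_integral do rewrite gee0_abs//.
have gpos x : 0 < g x by rewrite /g mulr_gt0 ?expR_gt0.
have ae0 : {ae lam, forall x, x = 0}.
  apply: filterS aeD => x /(_ I)/= [] /eqP.
  rewrite -{1}[g x]mul1r -mulrBl mulf_eq0 (gt_eqF (gpos x)) orbF subr_eq0.
  move=> /eqP; rewrite /q -{1}expR0 => /expR_inj x0.
  by apply: dot_eq0; lra.
pose nz (x : V) : \bar R := if x == 0 then 0%E else 1%E.
have md : measurable_fun setT (fun x : V => dot x x) by exact: measurable_dot.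
have mnz : measurable_fun setT nz.
  rewrite (_ : nz = (fun x => (\1_(~` ((fun x : V => dot x x) @^-1` [set 0])) x)%:E)).
    apply/measurable_EFinP; apply: measurable_indic; apply: measurableC.
    by rewrite -[X in measurable X]setTI; apply: md.
  apply/funext => x; rewrite /nz indicE in_setC.
  have [->|x0] := eqVneq x 0; first by rewrite mem_set//= dot0r.
  rewrite memNset//= => /dot_eq0 x00; by rewrite x00 eqxx in x0.
have nz0 x : (0 <= nz x)%E by rewrite /nz; case: ifP.
have intnz : (\int[lam]_x nz x = 0)%E.
  rewrite (ae_eq_integral (cst 0%E))//; first by rewrite integral0.
  by apply: filterS ae0 => x -> _; rewrite /nz eqxx.
pose v : V := const_mx 1.
have v0 : v != 0.
  apply/eqP => /matrixP/(_ (Ordinal K0) ord0); rewrite !mxE => /eqP.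
  by rewrite oner_eq0.
have intnzv : (\int[lam]_x nz (x + v)%R = 0)%E.
  by rewrite ge0_integral_translate.
have mnzv : measurable_fun setT (fun x : V => nz (x + v)).
  by apply: (measurableT_comp mnz); exact: measurable_addmx.
have aev : ae_eq lam setT (fun x => nz (x + v)) (cst 0%E).
  apply/ae_eq_integral_abs => //.
  by under eq_integral do rewrite gee0_abs//.
have gg : ae_eq lam setT (fun x => (g x)%:E) (cst 0%E).
  apply: filterS2 ae0 aev => x -> /(_ I).
  rewrite /= /nz add0r (negbTE v0) => -[] /eqP.
  by rewrite oner_eq0.
have := ae_eq_integral (cst 0%E) _ measurableT mgE (measurable_cst _) gg.
by rewrite g1 integral0 => /eqP; rewrite eqe oner_eq0.
Qed.

Let u (y : V) : R := expR (- (dot y y / 2)).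
Let C0 : R := cI * zg (2%:M : 'M[R]_K).

Let mu : measurable_fun setT u.
Proof.
apply: measurableT_comp => //; apply: measurableT_comp => //.
by apply: measurable_funM => //; exact: measurable_dot.
Qed.

Let u0 x : 0 < u x. Proof. exact: expR_gt0. Qed.
Let u1 x : u x <= 1.
Proof. by rewrite /u -[leRHS]expR0 ler_expR; have := dot_ge0 x; lra. Qed.

Let two_ge1 (x : V) : dot x x <= bform (2%:M : 'M[R]_K) x x.
Proof. by rewrite -scalemx1 bformZm bform1; have := dot_ge0 x; lra. Qed.

Let int_uphi (x : V) : (\int[lam]_v (u (x + v) * phi v)%:E = (C0 * q x)%:E)%E.
Proof.
have E v : u (x + v) * phi v = gf (ln cI - dot x x / 2) (- x) 2%:M v.
  rewrite /u /phi /gf -{1}(lnK (x := cI))// mulrCA -!expRD; congr expR.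
  by rewrite -scalemx1 bformZm bform1 !bformD (dotC v x); field.
under eq_integral do rewrite E.
rewrite integral_gf ?tr_scalar_mx ?(dot_le_unitmx two_ge1)//.
rewrite (ZgE Z1_gt0 Z1_lty two_ge1) -EFinM; congr EFin.
rewrite invmx_scalar -[(2^-1)%:M]scalemx1 bformZm bform1 !bformD /C0 /q.
have -> : ln cI - dot x x / 2 + 2^-1 * - - dot x x / 2 = ln cI + - (dot x x / 4).
  by field.
by rewrite expRD lnK ?posrE//; ring.
Qed.

Let C00 : 0 < C0.
Proof. by rewrite /C0 mulr_gt0// zg_gt0. Qed.

Let muphi (x : V) : measurable_fun setT (fun v : V => (u (x + v) * phi v)%:E).
Proof.
apply/measurable_EFinP; apply: measurable_funM => //.
by apply: (measurableT_comp mu); exact: measurable_mxD.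
Qed.

Let C01 : C0 <= 1.
Proof.
have -> : C0 = C0 * q 0 by rewrite /q dot0r mul0r oppr0 expR0 mulr1.
rewrite -lee_fin -int_uphi -[leRHS]phi1; apply: ge0_le_integral => //.
- by move=> x _; rewrite lee_fin mulr_ge0// ltW.
- by apply/measurable_EFinP; exact: mphi.
- by move=> x _; rewrite lee_fin ler_piMl.
Qed.

(** Makes [rho0 = 1 - 2 * eta], so that in the product of [1 + eta * C0 * rho0] and
    [1 - eta * (1 - eta) * C0] the terms linear in [C0] add up to [- eta^2 * C0]. *)
Let eta : R := (1 - rho0) / 2.
Let eta0 : 0 < eta. Proof. by rewrite /eta; have := rho0_lt1; lra. Qed.
Let eta1 : eta < 1. Proof. by rewrite /eta; have := rho0_ge0; lra. Qed.

(** Test function for a Cauchy-Schwarz bound, the root of [Lam] being the root of [G * Lam] times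
    that of [1 / G]. After a transition, signal plus noise meets the bump at the origin less often
    than noise alone: its mean is at most [C0 * rho0] instead of [C0]. *)
Let G y : R := 1 + eta * u y.
Let G0 y : 0 < G y.
Proof. by rewrite /G addr_gt0// mulr_gt0. Qed.

Let mG : measurable_fun setT G.
Proof. by apply: measurable_funD => //; exact: measurable_funM. Qed.

Let mphiE : measurable_fun setT (fun x => (phi x)%:E).
Proof. exact/measurable_EFinP. Qed.

Let int_Gphi (x : V) :
  (\int[lam]_v ((G (x + v))%:E * (phi v)%:E) = 1 + (eta * C0 * q x)%:E)%E.
Proof.
transitivity (\int[lam]_v ((phi v)%:E + eta%:E * (u (x + v) * phi v)%:E))%E.
  apply: eq_integral => v _; rewrite -!EFinM -EFinD /G; congr EFin; ring.
have up0 v : (0 <= (u (x + v) * phi v)%:E)%E by rewrite lee_fin mulr_ge0// ltW.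
have e0 : (0 <= eta%:E)%E by rewrite lee_fin ltW.
rewrite ge0_integralD; [|exact: measurableT|by move=> v _; rewrite lee_fin|
  exact: mphiE|by move=> v _; rewrite mule_ge0|
  by apply: emeasurable_funM => //; exact: muphi].
rewrite ge0_integralZl; [|exact: measurableT|exact: muphi|by []|exact: e0].
by rewrite phi1 int_uphi -EFinM mulrA.
Qed.

Let int_invG : (\int[lam]_y (((G y)^-1)%:E * (phi y)%:E) <=
  (1 - eta * (1 - eta) * C0)%:E)%E.
Proof.
pose k := eta * (1 - eta).
have k0 : 0 <= k by rewrite mulr_ge0 ?ltW// subr_gt0.
have mGi : measurable_fun setT (fun y => ((G y)^-1)%:E).
  by apply/measurable_EFinP; apply: measurable_invr_ge0 => // y; exact: ltW.
have Gi0 y : (0 <= ((G y)^-1)%:E)%E by rewrite lee_fin invr_ge0 ltW.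
have p0 y : (0 <= (phi y)%:E)%E by rewrite lee_fin.
have up0 y : (0 <= (u (0 + y) * phi y)%:E)%E by rewrite lee_fin mulr_ge0// ltW.
have kE : (0 <= k%:E)%E by rewrite lee_fin.
have : (\int[lam]_y (((G y)^-1)%:E * (phi y)%:E) + k%:E * C0%:E <= 1)%E.
  have -> : C0 = C0 * q 0 by rewrite /q dot0r mul0r oppr0 expR0 mulr1.
  rewrite -int_uphi -ge0_integralZl; [|exact: measurableT|exact: muphi|by []|exact: kE].
  have mGp : measurable_fun setT (fun y => ((G y)^-1)%:E * (phi y)%:E)%E.
    exact: emeasurable_funM.
  have mup : measurable_fun setT (fun y : V => k%:E * (u (0 + y) * phi y)%:E)%E.
    by apply: emeasurable_funM => //; exact: muphi.
  rewrite -ge0_integralD; [|exact: measurableT|by move=> y _; rewrite mule_ge0|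
    exact: mGp|by move=> y _; rewrite mule_ge0|exact: mup].
  rewrite -phi1; apply: ge0_le_integral => //.
  + by move=> y _; apply: adde_ge0; rewrite mule_ge0.
  + exact: emeasurable_funD.
  (* Pointwise, [1 / (1 + eta u) <= 1 - eta (1 - eta) u], because [u] lies between 0 and 1. *)
  + move=> y _; rewrite add0r -!EFinM -EFinD lee_fin.
    have -> : (G y)^-1 * phi y + k * (u y * phi y) = ((G y)^-1 + k * u y) * phi y by ring.
      rewrite ler_piMl// -lerBrDr -[leLHS]mul1r ler_pdivrMr// /k /G.
    have e0 := eta0; have e1 := eta1.
    have uw : (1 - eta) * u y <= (1 - eta) * 1 by rewrite ler_wpM2l// subr_ge0 ltW.
    have : 0 <= u y * (eta * eta) * (1 - (1 - eta) * u y).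
      apply: mulr_ge0; last by lra.
      by apply: mulr_ge0; [exact: ltW|apply: mulr_ge0; exact: ltW].
    lra.
by rewrite -EFinM -leeBrDr// -EFinB.
Qed.

Let F y0 (f : V -> \bar R) := filt A g y0 f.

(** A filtering step precedes the averaged one, so the state is [A *m x] plus an innovation and
    [rho0] applies for every [x]. An arbitrary density, concentrated near the origin, would give no
    such gain. *)
Let int_GLam y0 f : measurable_fun setT f -> (forall x, 0 <= f x)%E ->
  (\int[lam]_y ((G y)%:E * Lam A g (filt A g y (F y0 f)) [::] * (phi y)%:E) <=
    (1 + eta * C0 * rho0)%:E * Lam A g (F y0 f) [::])%E.
Proof.
move=> mf f0.
have mF : measurable_fun setT (F y0 f) by exact: measurable_filt.
have F0 x : (0 <= F y0 f x)%E by exact: filt_ge0.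
have mGE : measurable_fun setT (fun y => (G y)%:E) by exact/measurable_EFinP.
have mqE : measurable_fun setT (fun y => (q y)%:E) by exact/measurable_EFinP.
have G0E y : (0 <= (G y)%:E)%E by rewrite lee_fin ltW.
have q0E y : (0 <= (q y)%:E)%E by rewrite lee_fin ltW.
rewrite (integral_phi_Lam A mg g0 g1 mphi phi0 std_gaussB mF F0 mGE G0E).
under eq_integral do rewrite int_Gphi.
have g0E y : (0 <= (g y)%:E)%E by rewrite lee_fin.
have ec0 : 0 <= eta * C0 by rewrite mulr_ge0// ltW.
rewrite [leLHS](_ : _ = \int[lam]_x
    (F y0 f x + (eta * C0)%:E * ((q x)%:E * F y0 f x)))%E; last first.
  apply: eq_integral => x _.
  rewrite ge0_muleDl ?mul1e//; first by rewrite EFinM muleA.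
  by rewrite lee_fin mulr_ge0// ltW.
have ecE : (0 <= (eta * C0)%:E)%E by rewrite lee_fin.
have mqF : measurable_fun setT (fun x => (q x)%:E * F y0 f x)%E.
  exact: emeasurable_funM.
rewrite ge0_integralD; [|exact: measurableT|by []|exact: mF|
  by move=> x _; rewrite !mule_ge0|exact: emeasurable_funM].
rewrite ge0_integralZl; [|exact: measurableT|exact: mqF|
  by move=> x _; rewrite mule_ge0|exact: ecE].
rewrite EFinD [(eta * C0 * rho0)%:E]EFinM ge0_muleDl ?mul1e//; last first.
  by rewrite mule_ge0// lee_fin rho0_ge0.
apply: leeD => //; rewrite -muleA; apply: lee_wpmul2l; first by rewrite lee_fin.
rewrite (integral_filt A mg g0 y0 mf f0 mqE q0E) Lam_filt//.
have mE : measurable_fun setT (fun x : V => (expo x y0)%:E).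
  by apply/measurable_EFinP; exact: measurable_expo.
have e0 x : (0 <= (expo x y0)%:E * f x)%E by rewrite mule_ge0// lee_fin expo_ge0.
have mef : measurable_fun setT (fun x => (expo x y0)%:E * f x)%E.
  exact: emeasurable_funM.
have r0 := rho0_ge0.
rewrite -ge0_integralZl//; apply: ge0_le_integral => //.
- by move=> x _; rewrite mule_ge0//; apply: integral_ge0 => x' _; rewrite mule_ge0.
- apply: emeasurable_funM => //.
  apply: (measurable_param_integral (F := fun x x' : V => ((q (A *m x + x'))%:E * (g x')%:E)%E)).
    apply: emeasurable_funM; apply/measurable_EFinP.
      apply: (measurableT_comp mq); apply: measurable_mxD => //.
      exact: measurable_mulmxr.
    exact: (measurableT_comp mg).
  by move=> x x'; rewrite mule_ge0.
- exact: emeasurable_funM.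
- move=> x _; apply: lee_wpmul2r => //; rewrite -rho0E.
  by apply: le_trans (int_qg_le (A *m x)).
Qed.

Section contraction.
Variables (L c1 : R) (f1 : V -> \bar R).
Hypotheses (L0 : 0 <= L) (RiL : forall x, bform Ri x x <= L * dot x x).
Hypotheses (f1G : isG L f1) (f1_1 : (\int[lam]_x f1 x = 1)%E).

Local Notation LamR := (LamR A Ri cR f1).

Lemma measurable_LamR_rcons ys :
  measurable_fun setT (fun y : V => LamR (rcons ys y)).
Proof.
have mf1 := isG_measurable f1G; have f10 x := isG_ge0 x f1G.
have mal : measurable_fun setT (alpha A g f1 ys) by exact: measurable_alpha.
have al0 x : (0 <= alpha A g f1 ys x)%E by exact: alpha_ge0.
have := @measurable_param_Lam _ _ A g mg g0 _ V unit (fun _ y => y) [:: tt]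
  (fun _ => alpha A g f1 ys) (fun _ _ => @measurable_id _ _ setT) (measurableT_comp mal measurable_snd)
  (fun _ => al0).
move=> /= m1; apply: measurableT_comp => //.
by under eq_fun do rewrite -cats1 Lam_cat.
Qed.

Lemma sqrt_LamR_contraction : exists2 b : R, 0 <= b < 1 &
  forall ys y0, (\int[lam]_y ((Num.sqrt (LamR (rcons (rcons ys y0) y)))%:E * (phi y)%:E)
    <= (b * Num.sqrt (LamR (rcons ys y0)))%:E)%E.
Proof.
pose b1 := 1 + eta * C0 * rho0; pose b2 := 1 - eta * (1 - eta) * C0.
have e0 := eta0; have e1 := eta1; have r0 := rho0_ge0; have r1 := rho0_lt1.
have c0 := C00; have c1' := C01.
have ec0 : 0 < eta * C0 by rewrite mulr_gt0.
have b10 : 1 <= b1 by rewrite /b1 lerDl mulr_ge0// ltW.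
have b20 : 0 < b2.
  have : eta * (1 - eta) * C0 <= eta * (1 - eta) * 1.
    by rewrite ler_wpM2l// mulr_ge0 ?ltW// subr_gt0.
  have : eta * (1 - eta) < 1 * 1.
    by apply: ltr_pM => //; [exact: ltW|lra|lra].
  rewrite /b2; lra.
have b12 : b1 * b2 < 1.
  have : 0 < eta * eta * C0 * (1 + (1 - eta) * rho0 * C0).
    have h0 : 0 <= (1 - eta) * rho0 * C0.
      by apply: mulr_ge0; [apply: mulr_ge0; [lra|]|exact: ltW].
    apply: mulr_gt0; last lra.
    by rewrite -mulrA mulr_gt0.
  have rE : rho0 = 1 - 2 * eta by rewrite /eta; field.
  have -> : eta * eta * C0 * (1 + (1 - eta) * rho0 * C0) = 1 - b1 * b2.
    by rewrite /b1 /b2 rE; ring.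
  by rewrite subr_gt0.
have b120 : 0 < b1 * b2 by rewrite mulr_gt0//; lra.
exists (Num.sqrt (b1 * b2)).
  by rewrite sqrtr_ge0 -[X in _ < X]sqrtr1 ltr_sqrt.
move=> ys y0.
have mf1 := isG_measurable f1G; have f10 x := isG_ge0 x f1G.
have Lg0 zs : 0 < LamR zs.
  exact: (LamR_gt0 A RiT Ri0 cR0 Z1_gt0 Z1_lty g1 L0 RiL f1G f1_1 zs).
have LgE zs : Lam A g f1 zs = (LamR zs)%:E.
  exact: (LamRE A RiT Ri0 cR0 Z1_gt0 Z1_lty g1 L0 RiL f1G f1_1 zs).
have l0 := Lg0 (rcons ys y0).
set l := LamR (rcons ys y0) in l0 *.
have bl0 : 0 < b1 * l by rewrite mulr_gt0//; lra.
pose t := Num.sqrt (b1 * b2 * l).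
have t0 : 0 < t by rewrite sqrtr_gt0 mulr_gt0.
have tE : t * t = b1 * b2 * l by rewrite -expr2 sqr_sqrtr// mulr_ge0// ltW.
(* Balances the two terms of the inequality: it minimises [s / 2 * (b1 * l) + b2 / (2 * s)], and the
   minimum is [t]. *)
pose s := t / (b1 * l).
have s0 : 0 < s by rewrite divr_gt0.
have sE : s = t / (b1 * l) by [].
clearbody s.
have mal : measurable_fun setT (alpha A g f1 ys) by exact: measurable_alpha.
have al0 x : (0 <= alpha A g f1 ys x)%E by exact: alpha_ge0.
have int1 := int_GLam y0 mal al0.
have LE y : Lam A g (filt A g y (F y0 (alpha A g f1 ys))) [::] =
    (LamR (rcons (rcons ys y0) y))%:E.
  by rewrite -LgE /Lam !alpha_rcons.
have lE : Lam A g (F y0 (alpha A g f1 ys)) [::] = l%:E.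
  by rewrite -LgE /Lam !alpha_rcons.
have {}int1 : (\int[lam]_y (G y * LamR (rcons (rcons ys y0) y) * phi y)%:E <=
    (b1 * l)%:E)%E.
  rewrite EFinM -lE; apply: le_trans int1.
  by under [leRHS]eq_integral do rewrite LE -!EFinM.
have int2 : (\int[lam]_y ((G y)^-1 * phi y)%:E <= b2%:E)%E.
  by under eq_integral do rewrite EFinM; exact: int_invG.
have mL := measurable_LamR_rcons (rcons ys y0).
have mGi : measurable_fun setT (fun y => (G y)^-1).
  by apply: measurable_invr_ge0 => // y; exact: ltW.
have L_gt0 y : 0 < LamR (rcons (rcons ys y0) y) by exact: Lg0.
have m1 : measurable_fun setT (fun y => (G y * LamR (rcons (rcons ys y0) y) * phi y)%:E).
  by apply/measurable_EFinP; apply: measurable_funM => //; exact: measurable_funM.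
have m2 : measurable_fun setT (fun y => ((G y)^-1 * phi y)%:E).
  by apply/measurable_EFinP; exact: measurable_funM.
have p1 y : (0 <= (G y * LamR (rcons (rcons ys y0) y) * phi y)%:E)%E.
  by rewrite lee_fin; apply: mulr_ge0 => //; apply: mulr_ge0; exact: ltW.
have p2 y : (0 <= ((G y)^-1 * phi y)%:E)%E.
  by rewrite lee_fin; apply: mulr_ge0 => //; rewrite invr_ge0 ltW.
have s20 : (0 <= (s / 2)%:E)%E by rewrite lee_fin divr_ge0// ltW.
have si20 : (0 <= (s^-1 / 2)%:E)%E by rewrite lee_fin divr_ge0 ?invr_ge0// ltW.
apply: (@le_trans _ _ (\int[lam]_y ((s / 2)%:E * (G y * LamR (rcons (rcons ys y0) y) * phi y)%:E
   + (s^-1 / 2)%:E * ((G y)^-1 * phi y)%:E))%E).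
  apply: ge0_le_integral => //.
  - by move=> y _; rewrite mule_ge0 ?lee_fin ?sqrtr_ge0.
  - apply: emeasurable_funM => //; apply/measurable_EFinP.
    by apply: measurable_sqrtr_ge0 => // y; exact: ltW.
  - by apply: emeasurable_funD; exact: emeasurable_funM.
  - move=> y _; rewrite -!EFinM -EFinD lee_fin.
    set v := LamR _; have v0 : 0 < v by exact: L_gt0.
    have -> : s / 2 * (G y * v * phi y) + s^-1 / 2 * ((G y)^-1 * phi y) =
      (s * G y * v + (s * G y)^-1) / 2 * phi y by rewrite (invfM s (G y)); ring.
    rewrite ler_wpM2r//; set k := s * G y.
    have k0 : 0 < k by rewrite mulr_gt0.
    (* AM-GM *)
    set r := Num.sqrt v; have r_ge0 : 0 <= r by rewrite sqrtr_ge0.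
    have vE : r * r = v by rewrite -expr2 sqr_sqrtr// ltW.
    rewrite ler_pdivlMr// -(ler_pM2l k0).
    have -> : k * (k * v + k^-1) = (k * r) * (k * r) + 1.
      by rewrite mulrDr mulfV ?gt_eqF// -vE; ring.
    by have := sqr_ge0 (k * r - 1); lra.
rewrite ge0_integralD; [|exact: measurableT|by move=> y _; rewrite mule_ge0|
  exact: emeasurable_funM|by move=> y _; rewrite mule_ge0|exact: emeasurable_funM].
rewrite ge0_integralZl; [|exact: measurableT|exact: m1|by []|exact: s20].
rewrite ge0_integralZl; [|exact: measurableT|exact: m2|by []|exact: si20].
apply: (@le_trans _ _ ((s / 2)%:E * (b1 * l)%:E + (s^-1 / 2)%:E * b2%:E)%E).
  by apply: leeD; exact: lee_wpmul2l.
rewrite -!EFinM -EFinD lee_fin -sqrtrM ?(ltW b120)// -/t sE invf_div.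
have -> : t / (b1 * l) / 2 * (b1 * l) = t / 2.
  by rewrite mulrAC divfK ?gt_eqF.
have -> : b1 * l / t / 2 * b2 = (b1 * b2 * l) / t / 2 by ring.
by rewrite -tE mulfK ?gt_eqF//; lra.
Qed.

End contraction.

End affinity.

(** * Independence of processes *)

Section process_independence.
Local Open Scope ereal_scope.
Context d (Omega : measurableType d) (R : realType) (P : probability Omega R).
Context (m n : nat).
Implicit Types (Z : nat -> Omega -> 'M[R]_(m, n)) (D : set nat).

Lemma sigma_vec_measurable (Z : Omega -> 'M[R]_(m, n)) :
  measurable_fun setT Z -> sigma_vec Z `<=` measurable.
Proof. by move=> mZ _ [B mB <-]; apply: mZ. Qed.

Lemma sigma_process_measurable D Z : (forall t, D t -> measurable_fun setT (Z t)) ->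
  sigma_process D Z `<=` measurable.
Proof.
move=> mZ; apply: smallest_sub; first exact: sigma_algebra_measurable.
by move=> A [t Dt]; apply: sigma_vec_measurable; exact: mZ.
Qed.

Lemma sub_sigma_process D D' Z : D `<=` D' ->
  sigma_process D Z `<=` sigma_process D' Z.
Proof.
move=> DD'; apply: smallest_sub; first exact: smallest_sigma_algebra.
by move=> A [t /DD' Dt] AZ; apply: sub_gen_smallest; exists t.
Qed.

Lemma sigma_process_preimage D Z t B : D t -> measurable B ->
  sigma_process D Z (Z t @^-1` B).
Proof.
move=> Dt mB; apply: sub_gen_smallest; exists t => //.
by exists B => //; rewrite setTI.
Qed.

Let cyl D Z := [set A : set Omega | exists (J : {fset nat}) (E : nat -> set Omega),
  [/\ [set` J] `<=` D, (forall i, i \in J -> sigma_vec (Z i) (E i)) &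
   A = \bigcap_(i in [set` J]) E i]].

Let sigma_vecT (Z : Omega -> 'M[R]_(m, n)) : sigma_vec Z setT.
Proof. by exists setT => //; rewrite setTI preimage_setT. Qed.

Let sigma_vecI (Z : Omega -> 'M[R]_(m, n)) : setI_closed (sigma_vec Z).
Proof.
move=> _ _ [B mB <-] [C mC <-]; exists (B `&` C); first exact: measurableI.
by rewrite !setTI preimage_setI.
Qed.

(** Finite cylinders over [D] form a pi-system generating the sigma-algebra of the process; on a
    cylinder with index set [J], the claim is mutual independence for [J] with [t] added. *)
Lemma process_indep D0 D Z t :
  mutually_independent P D0 (fun t => sigma_vec (Z t)) ->
  (forall t, D0 t -> measurable_fun setT (Z t)) ->
  D `<=` D0 -> D0 t -> ~ D t -> indep_of P (sigma_process D Z) (Z t).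
Proof.
move=> ind mZ DD0 D0t Dt.
have cylD : sigma_process D Z `<=` <<s cyl D Z >>.
  apply: smallest_sub; first exact: smallest_sigma_algebra.
  move=> A [s Ds AZ]; apply: sub_gen_smallest.
  exists [fset s]%fset, (fun=> A); split.
  - by move=> i /=; rewrite inE => /eqP ->.
  - by move=> i; rewrite inE => /eqP ->.
  - by apply/seteqP; split=> [w Aw i _ //|w /(_ s)]; apply; rewrite /= inE.
have cylM : cyl D Z `<=` measurable.
  move=> _ [J [E [JD EZ ->]]]; apply: bigcap_measurableType => i iJ.
  apply: (sigma_vec_measurable (mZ i _)); last exact: EZ.
  exact/DD0/JD.
have cylT : cyl D Z setT.
  exists fset0, (fun=> setT); split=> //.
  by apply/seteqP; split.
have cylI : setI_closed (cyl D Z).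
  move=> _ _ [J [E [JD EZ ->]]] [J' [E' [JD' EZ' ->]]].
  exists (J `|` J')%fset, (fun i => (if i \in J then E i else setT) `&`
    (if i \in J' then E' i else setT)); split.
  - by move=> i /=; rewrite inE => /orP[/JD|/JD'].
  - by move=> i _; apply: sigma_vecI; case: ifP => // iJ;
      [exact: EZ|exact: EZ'].
  - apply/seteqP; split=> [w [wE wE'] i /=|w wE].
      rewrite inE => iJ; split; case: ifP => // h; [exact: wE|exact: wE'].
    split=> i /= iJ.
      by have := wE i; rewrite /= inE iJ => /(_ isT)[].
    by have := wE i; rewrite /= inE iJ orbT => /(_ isT)[].
move=> A B AD mB; apply: (indep_of_pi_system cylI cylT cylM (mZ t D0t)) => //;
  last exact: cylD.
move=> _ C [J [E [JD EZ ->]]] mC.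
have tJ : t \notin J by apply/negP => /JD.
have E' : \bigcap_(i in [set` J]) E i `&` Z t @^-1` C =
    \bigcap_(i in [set` (t |` J)%fset]) (if i == t then Z t @^-1` C else E i).
  apply/seteqP; split=> [w [wE wC] i /=|w wE].
    rewrite !inE => /orP[/eqP ->|iJ]; first by rewrite eqxx.
    by case: ifPn => // _; exact: wE.
  split.
    move=> i /= iJ; have := wE i; rewrite /= !inE iJ orbT => /(_ isT).
    by case: ifPn => // /eqP it; rewrite it (negbTE tJ) in iJ.
  by have := wE t; rewrite /= !inE eqxx => /(_ isT).
rewrite E' ind.
- rewrite big_fsetU1//= eqxx muleC; congr (_ * _).
  rewrite ind//; last by move=> i /JD/DD0.
  apply: eq_big_seq => i iJ; case: ifPn => // /eqP it.
  by rewrite it (negbTE tJ) in iJ.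
- move=> i /=; rewrite !inE => /orP[/eqP -> //|/JD/DD0//].
- move=> i; rewrite !inE => /orP[/eqP ->|iJ].
    by rewrite eqxx; exists C => //; rewrite setTI.
  case: ifPn => [/eqP it|_]; last exact: EZ.
  by rewrite it (negbTE tJ) in iJ.
Qed.

End process_independence.

Section three_independent.
Local Open Scope ereal_scope.
Context d (Omega : measurableType d) (R : realType) (P : probability Omega R).

Lemma mutually_independent3 (G1 G2 G3 : set (set Omega)) E1 E2 E3 :
  mutually_independent P [set: 'I_3] (tnth [tuple G1; G2; G3]) ->
  G1 E1 -> G2 E2 -> G3 E3 ->
  P (E1 `&` E2 `&` E3) = P E1 * P E2 * P E3.
Proof.
move=> ind GE1 GE2 GE3.
pose i0 : 'I_3 := @Ordinal 3 0 isT.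
pose i1 : 'I_3 := @Ordinal 3 1 isT.
pose i2 : 'I_3 := @Ordinal 3 2 isT.
pose E := tnth [tuple E1; E2; E3].
have EE : E1 `&` E2 `&` E3 = \bigcap_(i in [set` [fset i0; i1; i2]%fset]) E i.
  apply/seteqP; split=> [w [[w1 w2] w3] i /=|w wE].
    by rewrite !inE => /orP[/orP[]|] /eqP ->.
  by split; [split|]; [have := wE i0|have := wE i1|have := wE i2]; apply;
    rewrite /= !inE eqxx ?orbT.
rewrite EE ind//.
- rewrite fsetUC big_fsetU1 ?inE//= big_fsetU1 ?inE//= big_seq_fset1.
  by rewrite muleC.
- by move=> i; rewrite !inE => /orP[/orP[]|] /eqP ->.
Qed.

End three_independent.

(** * Change of measure *)

Section density_measure.
Local Open Scope ereal_scope.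
Context d (T : measurableType d) (R : realType) (mu : {measure set T -> \bar R}).
Variables (h : T -> \bar R).
Hypotheses (mh : measurable_fun setT h) (h0 : forall x, 0 <= h x).

Definition density_measure (A : set T) : \bar R := \int[mu]_(x in A) h x.

Let density_measure0 : density_measure set0 = 0.
Proof. exact: integral_set0. Qed.

Let density_measure_ge0 A : 0 <= density_measure A.
Proof. by apply: integral_ge0 => w _; exact: h0. Qed.

Let density_measure_sigma_additive : semi_sigma_additive density_measure.
Proof.
move=> G mG tG mUG; rewrite /density_measure ge0_integral_bigcup//; last first.
  exact: measurable_funTS.
apply/cvg_closeP; split; last by rewrite closeE.
by apply: is_cvg_nneseries => k _ _; exact: density_measure_ge0.
Qed.

HB.instance Definition _ := isMeasure.Build _ _ _ density_measure
  density_measure0 density_measure_ge0 density_measure_sigma_additive.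

Lemma ex_density_measure : exists Q : {measure set T -> \bar R},
  forall A, Q A = \int[mu]_(x in A) h x.
Proof. by exists density_measure. Qed.

End density_measure.

Section indep_sigma.
Local Open Scope ereal_scope.
Context d (Omega : measurableType d) (R : realType) (P : probability Omega R).
Variable (G : set (set Omega)).
Hypothesis GM : G `<=` measurable.
Local Notation T := (g_sigma_algebraType G).

Lemma measurable_sigma_id : measurable_fun setT (fun w : Omega => (w : T)).
Proof.
move=> _ B mB; rewrite setTI.
by move: B mB; apply: smallest_sub GM; exact: sigma_algebra_measurable.
Qed.

(** The identity into [Omega] with the smaller sigma-algebra plays the part of [X], so the integrand
    may depend on the sample point in any way measurable for the past. *)
Lemma indep_integral_sigma m n (Z : Omega -> 'M[R]_(m, n)) (f : 'M[R]_(m, n) -> R)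
    (F : T -> 'M[R]_(m, n) -> \bar R) :
  has_density P Z f -> indep_of P <<s G >> Z ->
  measurable_fun setT (fun z : T * 'M[R]_(m, n) => F z.1 z.2) ->
  (forall w z, 0 <= F w z) ->
  \int[P]_w F w (Z w) =
  \int[P]_w \int[@lebesgue_mx R m n]_z (F w z * (f z)%:E).
Proof.
move=> Zf ind mF F0.
exact: (indep_integral measurable_sigma_id Zf (fun E B mE mB => ind E B mE mB)
  (F := fun z : T * 'M[R]_(m, n) => F z.1 z.2)).
Qed.

End indep_sigma.

Section rectangles.
Context (Omega T : Type).

Definition rect (m : nat) (B : nat -> set T) (z : nat -> Omega -> T) : set Omega :=
  \bigcap_(i in [set i | (1 <= i <= m)%N]) (z i @^-1` B i).

Lemma rectS m B z : rect m.+1 B z = rect m B z `&` z m.+1 @^-1` B m.+1.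
Proof.
apply/seteqP; split=> [w wR|w [wR wm] i /= /andP[i1]].
  split; last by apply: (wR m.+1) => /=; rewrite ltnSn.
  by move=> i /= /andP[i1 im]; apply: wR => /=; rewrite i1 ltnW.
rewrite leq_eqVlt => /orP[/eqP -> //|im].
by apply: wR => /=; rewrite i1.
Qed.

End rectangles.

Section change_of_measure.
Local Open Scope ereal_scope.
Context (R : realType) (K : nat) d (Omega : measurableType d).
Local Notation V := ('cV[R]_K).
Local Notation lam := (@lebesgue_mx R K 1).
Variables (P Pinf : probability Omega R) (A : 'M[R]_K) (g phi f1 : V -> R).
Variables (y nu x omega : nat -> Omega -> V) (t0 : nat).
Hypotheses (t0_ge1 : (1 <= t0)%N).
Hypotheses (nu_dens : forall t, (1 <= t)%N -> has_density P (nu t) phi)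
  (nu_ind : mutually_independent P [set t | (1 <= t)%N] (fun t => sigma_vec (nu t)))
  (om_dens : forall t, (t0 < t)%N -> has_density P (omega t) g)
  (om_ind : mutually_independent P [set t | (t0 < t)%N] (fun t => sigma_vec (omega t)))
  (x_dens : has_density P (x t0) f1)
  (all_ind : mutually_independent P [set: 'I_3] (tnth [tuple
          sigma_process [set t | (1 <= t)%N] nu;
          sigma_process [set t | (t0 < t)%N] omega;
          sigma_vec (x t0)])).
Hypotheses
  (xE : forall t, (t0 < t)%N -> \forall w \ae P, x t w = (A *m x t.-1 w + omega t w)%R)
  (y_before : forall t, (1 <= t < t0)%N -> \forall w \ae P, y t w = nu t w)
  (y_after : forall t, (t0 <= t)%N -> \forall w \ae P, y t w = (x t w + nu t w)%R).
Hypotheses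
  (y_dens : forall t, (1 <= t)%N -> has_density Pinf (y t) phi)
  (y_ind : mutually_independent Pinf [set t | (1 <= t)%N] (fun t => sigma_vec (y t))).
Hypothesis phiB : forall x y, phi (y - x) = (phi y * expo x y)%R.

Local Notation alpha := (alpha A g).
Local Notation Lam := (Lam A g).
Local Notation filt := (filt A g).
Let f1E (v : V) : \bar R := (f1 v)%:E.

(* Versions of the state and of the observations satisfying the model equations
   everywhere. *)
Fixpoint state (k : nat) : Omega -> V :=
  if k is k'.+1 then fun w => (A *m state k' w + omega (t0 + k'.+1)%N w)%R else x t0.

Definition obs (j : nat) (w : Omega) : V :=
  if (j < t0)%N then nu j w else (state (j - t0) w + nu j w)%R.

Let Gnu (m : nat) := sigma_process [set s | (1 <= s <= m)%N] nu.
Let Gom (n : nat) := sigma_process [set s | (t0 < s <= n)%N] omega.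

(** Pi-system for the past of all sources of randomness. Two time bounds are kept because the
    innovation of a given time already enters the state when the observation noise of that time is
    still to be integrated out. *)
Let Pi (m n : nat) : set (set Omega) := [set E | exists E1 E2 E3,
  [/\ Gnu m E1, Gom n E2, sigma_vec (x t0) E3 & E = E1 `&` E2 `&` E3]].

Let mnu t : (1 <= t)%N -> measurable_fun setT (nu t).
Proof. by move=> /nu_dens[]. Qed.
Let mom t : (t0 < t)%N -> measurable_fun setT (omega t).
Proof. by move=> /om_dens[]. Qed.
Let mx0 : measurable_fun setT (x t0). Proof. by case: x_dens. Qed.
Let my t : (1 <= t)%N -> measurable_fun setT (y t).
Proof. by move=> /y_dens[]. Qed.
Let mg : measurable_fun setT g. Proof. by case: (om_dens (ltnSn t0)). Qed.
Let g0 v : (0 <= g v)%R. Proof. by case: (om_dens (ltnSn t0)). Qed.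
Let mphi : measurable_fun setT phi. Proof. by case: (nu_dens t0_ge1). Qed.
Let phi0 v : (0 <= phi v)%R. Proof. by case: (nu_dens t0_ge1). Qed.
Let mf1 : measurable_fun setT f1. Proof. by case: x_dens. Qed.
Let f10 v : (0 <= f1 v)%R. Proof. by case: x_dens. Qed.

Let GnuM m : Gnu m `<=` measurable.
Proof. by apply: sigma_process_measurable => t /= /andP[t1 _]; exact: mnu. Qed.
Let GomM n : Gom n `<=` measurable.
Proof. by apply: sigma_process_measurable => t /= /andP[t1 _]; exact: mom. Qed.
Let GxM : sigma_vec (x t0) `<=` measurable.
Proof. exact: sigma_vec_measurable. Qed.

Let GnuT m : Gnu m setT. Proof. exact: (@measurableT _ (g_sigma_algebraType (\bigcup_(t in _) sigma_vec (nu t)))). Qed.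
Let GomT n : Gom n setT. Proof. exact: (@measurableT _ (g_sigma_algebraType (\bigcup_(t in _) sigma_vec (omega t)))). Qed.
Let GxT : sigma_vec (x t0) setT.
Proof. by exists setT => //; rewrite setTI preimage_setT. Qed.

Let PiM m n : Pi m n `<=` measurable.
Proof.
move=> _ [E1 [E2 [E3 [/GnuM h1 /GomM h2 /GxM h3 ->]]]].
by apply: measurableI => //; exact: measurableI.
Qed.

Let PiT m n : Pi m n setT.
Proof. by exists setT, setT, setT; split => //; rewrite !setTI. Qed.

Let sigI (G : set (set Omega)) (H : set (set Omega)) : H = <<s G >> -> setI_closed H.
Proof.
move=> -> E E' HE HE'.
exact: (@measurableI _ (g_sigma_algebraType G) E E').
Qed.

Let PiI m n : setI_closed (Pi m n).
Proof.
move=> _ _ [E1 [E2 [E3 [h1 h2 h3 ->]]]] [E1' [E2' [E3' [h1' h2' h3' ->]]]].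
exists (E1 `&` E1'), (E2 `&` E2'), (E3 `&` E3'); split.
- exact: (sigI erefl).
- exact: (sigI erefl).
- case: h3 h3' => B mB <- [C mC <-]; exists (B `&` C); first exact: measurableI.
  by rewrite !setTI preimage_setI.
- by rewrite setIACA; congr (_ `&` _); rewrite setIACA.
Qed.

Let all3 E1 E2 E3 : sigma_process [set t | (1 <= t)%N] nu E1 ->
  sigma_process [set t | (t0 < t)%N] omega E2 -> sigma_vec (x t0) E3 ->
  P (E1 `&` E2 `&` E3) = P E1 * P E2 * P E3.
Proof. exact: mutually_independent3. Qed.

Let Gnu_sub m : Gnu m `<=` sigma_process [set t | (1 <= t)%N] nu.
Proof. by apply: sub_sigma_process => t /= /andP[]. Qed.
Let Gom_sub m : Gom m `<=` sigma_process [set t | (t0 < t)%N] omega.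
Proof. by apply: sub_sigma_process => t /= /andP[]. Qed.

Let indep_omega m n : (t0 <= n)%N -> indep_of P <<s Pi m n >> (omega n.+1).
Proof.
move=> tn; apply: indep_of_pi_system; [exact: PiI|exact: PiT|exact: PiM|exact: mom|].
move=> _ B [E1 [E2 [E3 [h1 h2 h3 ->]]]] mB.
have ob : sigma_process [set t | (t0 < t)%N] omega (omega n.+1 @^-1` B).
  exact: sigma_process_preimage.
rewrite setIAC -(setIA E1) all3; [|exact: Gnu_sub h1| |exact: h3]; last first.
  by apply: (sigI erefl) ob; exact: Gom_sub h2.
have ind1 : indep_of P (Gom n) (omega n.+1).
  apply: (process_indep om_ind mom); [by move=> t /= /andP[]|exact: tn|].
  by rewrite /= ltnn andbF.
rewrite ind1// all3; [|exact: Gnu_sub h1|exact: Gom_sub h2|exact: h3].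
by rewrite -!muleA; congr (_ * (_ * _)); rewrite muleC.
Qed.

Let indep_nu m n : indep_of P <<s Pi m n >> (nu m.+1).
Proof.
apply: indep_of_pi_system; [exact: PiI|exact: PiT|exact: PiM|exact: mnu|].
move=> _ B [E1 [E2 [E3 [h1 h2 h3 ->]]]] mB.
have ob : sigma_process [set t | (1 <= t)%N] nu (nu m.+1 @^-1` B).
  exact: sigma_process_preimage.
rewrite setIAC (setIAC E1) all3; [| |exact: Gom_sub h2|exact: h3]; last first.
  by apply: (sigI erefl) ob; exact: Gnu_sub h1.
have ind1 : indep_of P (Gnu m) (nu m.+1).
  apply: (process_indep nu_ind mnu); [by move=> t /= /andP[]|by []|].
  by rewrite /= ltnn.
rewrite ind1// all3; [|exact: Gnu_sub h1|exact: Gom_sub h2|exact: h3].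
by rewrite -!muleA; congr (_ * _); rewrite muleC muleA.
Qed.

Let indep_y m : indep_of Pinf (sigma_process [set s | (1 <= s <= m)%N] y) (y m.+1).
Proof.
apply: (process_indep y_ind my); [by move=> t /= /andP[]|by []|].
by rewrite /= ltnn.
Qed.

Section adapted.
Variables m n : nat.
Local Notation T := (g_sigma_algebraType (Pi m n)).

Lemma measurable_nu_adapted j : (1 <= j <= m)%N ->
  measurable_fun setT (fun w : T => nu j w).
Proof.
move=> jm _ B mB; rewrite setTI; apply: sub_gen_smallest.
exists (nu j @^-1` B), setT, setT; split => //; last by rewrite !setIT.
exact: sigma_process_preimage.
Qed.

Lemma measurable_state_adapted k : (t0 + k <= n)%N ->
  measurable_fun setT (fun w : T => state k w).
Proof.
elim: k => [_ _ B mB|k IH tk]; rewrite ?setTI /=.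
  apply: sub_gen_smallest; exists setT, setT, (x t0 @^-1` B).
  by split => //; [exists B => //; rewrite setTI|rewrite !setTI].
apply: measurable_mxD.
  apply: measurable_mulmxr; apply: IH.
  by rewrite (leq_trans _ tk)// leq_add2l.
move=> _ B mB; rewrite setTI; apply: sub_gen_smallest.
exists setT, (omega (t0 + k.+1)%N @^-1` B), setT; split => //.
  apply: sigma_process_preimage => //=.
  by rewrite tk andbT -addn1 leq_add2l.
by rewrite setTI setIT.
Qed.

Lemma measurable_obs_adapted j : (1 <= j <= m)%N -> (j <= n)%N ->
  measurable_fun setT (fun w : T => obs j w).
Proof.
move=> jm jn; rewrite /obs; case: ltnP => jt0; first exact: measurable_nu_adapted.
apply: measurable_mxD; last exact: measurable_nu_adapted.
by apply: measurable_state_adapted; rewrite subnKC.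
Qed.

Lemma measurable_rect_adapted B k : (forall i, measurable (B i)) ->
  (k <= m)%N -> (k <= n)%N -> measurable (rect k B obs : set T).
Proof.
move=> mB km kn; apply: bigcap_measurableType => i /= /andP[i1 ik].
rewrite -[X in measurable X]setTI; apply: measurable_obs_adapted => //.
  by rewrite i1 (leq_trans ik).
exact: leq_trans kn.
Qed.

End adapted.

Lemma measurable_y_filtration m j : (1 <= j <= m)%N ->
  measurable_fun setT (fun w : g_sigma_algebraType
    (\bigcup_(t in [set s | (1 <= s <= m)%N]) sigma_vec (y t)) => y j w).
Proof. by move=> jm _ B mB; rewrite setTI; exact: sigma_process_preimage. Qed.

Let f1E0 v : 0 <= f1E v. Proof. by rewrite lee_fin. Qed.
Let mf1E : measurable_fun setT f1E. Proof. exact/measurable_EFinP. Qed.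

Section filtration_measurable.
Variable m : nat.
Local Notation T := (g_sigma_algebraType
    (\bigcup_(t in [set s | (1 <= s <= m)%N]) sigma_vec (y t))).

Lemma measurable_rect_filtration B : (forall i, measurable (B i)) ->
  measurable (rect m B y : set T).
Proof.
move=> mB; apply: bigcap_measurableType => i /= ik.
by rewrite -[X in measurable X]setTI; apply: measurable_y_filtration.
Qed.

Lemma measurable_alpha_filtration (s : nat) n : (1 <= s)%N -> (s + n <= m.+1)%N ->
  measurable_fun setT (fun z : T * V => alpha f1E [seq y t z.1 | t <- iota s n] z.2).
Proof.
move=> s1 sn; apply: (@measurable_param_alpha _ _ A g mg g0 _ T _
  (fun t w => y t w) (iota s n) (fun _ => f1E)) => //.
  move=> t; rewrite mem_iota => /andP[st tn]; apply: measurable_y_filtration.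
  by rewrite (leq_trans s1 st)/= -ltnS (leq_trans tn).
exact: (measurableT_comp mf1E measurable_snd).
Qed.

End filtration_measurable.

Let ys n w := [seq y t w | t <- iota t0 n].

Let rect_before B : (forall i, measurable (B i)) ->
  P (rect t0.-1 B nu) = Pinf (rect t0.-1 B y).
Proof.
move=> mB; pose J : {fset nat} := [fset i in iota 1 t0.-1]%fset.
have JE (i : nat) : (i \in J) = (1 <= i <= t0.-1)%N.
  by rewrite !inE /= mem_iota add1n ltnS.
have rectE (z : nat -> Omega -> V) :
    rect t0.-1 B z = \bigcap_(i in [set` J]) (z i @^-1` B i).
  by apply/seteqP; split=> w wR i /=; [rewrite JE => /wR|rewrite -JE => /wR].
have J1 : [set` J] `<=` [set t | (1 <= t)%N] by move=> i /=; rewrite JE => /andP[].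
have vecP (z : nat -> Omega -> V) i : sigma_vec (z i) (z i @^-1` B i).
  by exists (B i) => //; rewrite setTI.
rewrite !rectE (nu_ind J1)// (y_ind J1)//.
apply: eq_big_seq => i; rewrite JE => /andP[i1 _].
have [_ _ _ ->//] := nu_dens i1.
by have [_ _ _ ->] := y_dens i1.
Qed.

Let iver (E : set Omega) (w : Omega) : \bar R := (\1_E w)%:E.
Let iver0 E w : 0 <= iver E w. Proof. by rewrite lee_fin. Qed.

Let int_iver (Q : probability Omega R) E : measurable E ->
  \int[Q]_w iver E w = Q E.
Proof. by move=> mE; rewrite /iver integral_indic// setIT. Qed.

Let iverI E F w : iver (E `&` F) w = iver E w * iver F w.
Proof. by rewrite /iver indicI EFinM. Qed.

(** Before the change the observations are the noise [nu], with the law that [y] has under [Pinf],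
    and [x t0] is independent of them with density [f1]. *)
Let change_base B (G : V -> \bar R) : (forall i, measurable (B i)) ->
  measurable_fun setT G -> (forall v, 0 <= G v) ->
  \int[P]_w (iver (rect t0.-1 B nu) w * G (x t0 w)) =
  \int[Pinf]_w (iver (rect t0.-1 B y) w * \int[lam]_v (G v * f1E v)).
Proof.
move=> mB mG G0.
pose U := \bigcup_(t in [set s | (1 <= s <= t0.-1)%N]) sigma_vec (nu t).
have Um : U `<=` measurable.
  by move=> E [t /= /andP[t1 _]]; apply: sigma_vec_measurable; exact: mnu.
have ind : indep_of P <<s U >> (x t0).
  move=> E C UE mC.
  have UE' : Gnu t0.-1 E by exact: UE.
  have := @all3 E setT (x t0 @^-1` C) (Gnu_sub UE') (Gom_sub (@GomT t0)).
  rewrite setIT probability_setT mule1; apply.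
  by exists C => //; rewrite setTI.
have mR : measurable (rect t0.-1 B nu : set (g_sigma_algebraType U)).
  apply: bigcap_measurableType => i /= ik.
  exact: sigma_process_preimage.
have mR' : measurable (rect t0.-1 B nu).
  apply: bigcap_measurableType => i /= /andP[i1 _].
  by rewrite -[X in measurable X]setTI; apply: mnu.
have mRy : measurable (rect t0.-1 B y).
  apply: bigcap_measurableType => i /= /andP[i1 _].
  by rewrite -[X in measurable X]setTI; apply: my.
rewrite (indep_integral_sigma Um x_dens ind
  (F := fun w v => iver (rect t0.-1 B nu) w * G v)).
- under eq_integral => w _.
    under eq_integral do rewrite -muleA.
    rewrite ge0_integralZl; [|exact: measurableT|exact: emeasurable_funM|
      by move=> v _; rewrite mule_ge0 ?lee_fin|exact: iver0].
    over.
  set c := \int[lam]_v _; have c0 : 0 <= c.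
    by apply: integral_ge0 => v _; rewrite mule_ge0 ?lee_fin.
  rewrite !ge0_integralZr//; [|exact/measurable_EFinP|exact/measurable_EFinP].
  by rewrite !int_iver// rect_before.
- apply: emeasurable_funM; last exact: measurableT_comp.
  have mi : measurable_fun setT (\1_(rect t0.-1 B nu) : g_sigma_algebraType U -> R).
    exact: measurable_indic.
  by apply/measurable_EFinP; apply: (measurableT_comp mi).
- by move=> w v; rewrite mule_ge0.
Qed.

Let obs_before B : rect t0.-1 B obs = rect t0.-1 B nu.
Proof.
have E i w : (i <= t0.-1)%N -> obs i w = nu i w.
  by move=> it; rewrite /obs -(prednK t0_ge1) ltnS it.
apply/seteqP; split=> w wR i /= /andP[i1 it]; have := wR i; rewrite /= i1 it => /(_ isT);
  by rewrite E.
Qed.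

(** Kallianpur-Striebel formula on rectangles: relative to white noise, [alpha] is the unnormalised
    conditional density of the state at time [t0 + n] given the observations up to [t0 + n - 1]. The
    final result takes [G = 1], but the induction needs every test function. *)
Let change_obs n B (G : V -> \bar R) : (forall i, measurable (B i)) ->
  measurable_fun setT G -> (forall v, 0 <= G v) ->
  \int[P]_w (iver (rect (t0.-1 + n) B obs) w * G (state n w)) =
  \int[Pinf]_w (iver (rect (t0.-1 + n) B y) w *
    \int[lam]_v (G v * alpha f1E (ys n w) v)).
Proof.
move=> mB; elim: n G => [|n IH] G mG G0; first by rewrite addn0 obs_before change_base.
have mS : (t0.-1 + n.+1)%N = (t0.-1 + n).+1 by rewrite addnS.
have tS : (t0.-1 + n).+1 = (t0 + n)%N by rewrite -addSn prednK.
pose m := (t0.-1 + n)%N.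
have tm : (t0 + n = m.+1)%N by rewrite -tS.
rewrite mS -/m.
have g0E v : 0 <= (g v)%:E by rewrite lee_fin.
have mgE : measurable_fun setT (fun v => (g v)%:E) by exact/measurable_EFinP.
have phi0E v : 0 <= (phi v)%:E by rewrite lee_fin.
have mphiE : measurable_fun setT (fun v => (phi v)%:E) by exact/measurable_EFinP.
pose H (v : V) : \bar R := \int[lam]_z (G (A *m v + z)%R * (g z)%:E).
have H0 v : 0 <= H v by apply: integral_ge0 => z _; rewrite mule_ge0.
have mAdd : measurable_fun setT (fun z : V * V => (A *m z.1 + z.2)%R : V).
  by apply: measurable_mxD => //; exact: measurable_mulmxr.
have mH : measurable_fun setT H.
  apply: (measurable_param_integral
    (F := fun v z : V => G (A *m v + z)%R * (g z)%:E)).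
    by apply: emeasurable_funM; [exact: (measurableT_comp mG)|exact: (measurableT_comp mgE measurable_snd)].
  by move=> v z; rewrite mule_ge0.
(* The innovation of time [m.+2] is independent of all that happens up to [m.+1]; integrating it out
   turns [G] into [H]. *)
have step1 : \int[P]_w (iver (rect m.+1 B obs) w * G (state n.+1 w)) =
    \int[P]_w (iver (rect m.+1 B obs) w * H (state n w)).
  have mst : measurable_fun setT (fun w : g_sigma_algebraType (Pi m.+1 m.+1) => state n w).
    by apply: measurable_state_adapted; rewrite tm.
  have tm1 : (t0 <= m.+1)%N by rewrite -tm leq_addr.
  have ind1 : indep_of P <<s Pi m.+1 m.+1 >> (omega m.+2) by exact: indep_omega.
  rewrite /= addnS tm (indep_integral_sigma (@PiM m.+1 m.+1) (om_dens (t := m.+2) tm1) ind1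
    (F := fun w z => iver (rect m.+1 B obs) w * G (A *m state n w + z)%R)).
  - apply: eq_integral => w _; rewrite /H -ge0_integralZl//.
    + by apply: eq_integral => z _; rewrite muleA.
    + apply: emeasurable_funM => //; apply: (measurableT_comp mG).
      exact: measurable_mxD.
    + by move=> z _; rewrite mule_ge0.
  - apply: emeasurable_funM.
      have mi : measurable_fun setT
          (\1_(rect m.+1 B obs) : g_sigma_algebraType (Pi m.+1 m.+1) -> R).
        by apply: measurable_indic; exact: measurable_rect_adapted.
      by apply/measurable_EFinP; exact: (measurableT_comp mi).
    apply: (measurableT_comp mG); apply: measurable_mxD => //.
    by apply: measurable_mulmxr; exact: (measurableT_comp mst).
  - by move=> w z; rewrite mule_ge0.
rewrite step1.
pose b (v : V) : \bar R := (\1_(B m.+1) v)%:E.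
have b0 v : 0 <= b v by rewrite lee_fin.
have mb : measurable_fun setT b by apply/measurable_EFinP; exact: measurable_indic.
pose bphi (v : V) : \bar R := \int[lam]_z (b (v + z)%R * (phi z)%:E).
have bphi0 v : 0 <= bphi v by apply: integral_ge0 => z _; rewrite mule_ge0.
have mbphi : measurable_fun setT bphi.
  apply: (measurable_param_integral (F := fun v z : V => b (v + z)%R * (phi z)%:E)).
    apply: emeasurable_funM; last exact: (measurableT_comp mphiE measurable_snd).
    by apply: (measurableT_comp mb); exact: measurable_mxD.
  by move=> v z; rewrite mule_ge0.
(* The observation at [m.+1] is the state plus [nu m.+1]; integrating this noise out turns its
   indicator into [bphi]. *)
have step2 : \int[P]_w (iver (rect m.+1 B obs) w * H (state n w)) =
    \int[P]_w (iver (rect m B obs) w * (bphi (state n w) * H (state n w))).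
  have mst : measurable_fun setT (fun w : g_sigma_algebraType (Pi m m.+1) => state n w).
    by apply: measurable_state_adapted; rewrite tm.
  transitivity (\int[P]_w (iver (rect m B obs) w *
      (b (state n w + nu m.+1 w)%R * H (state n w)))).
    apply: eq_integral => w _; rewrite rectS iverI muleA; congr (_ * _ * _).
    by rewrite /iver /b !indicE /obs -tm ltnNge leq_addr/= addKn.
  have ind1 : indep_of P <<s Pi m m.+1 >> (nu m.+1) by exact: indep_nu.
  rewrite (indep_integral_sigma (@PiM m m.+1) (nu_dens (t := m.+1) isT) ind1
    (F := fun w z => iver (rect m B obs) w * (b (state n w + z)%R * H (state n w))))//.
  - apply: eq_integral => w _; rewrite /bphi.
    rewrite -ge0_integralZr//; last 2 first.
    + apply: emeasurable_funM => //; apply: (measurableT_comp mb).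
      exact: measurable_mxD.
    + by move=> z _; rewrite mule_ge0.
    rewrite -ge0_integralZl//.
    + by apply: eq_integral => z _; rewrite -!muleA; congr (_ * (_ * _)); rewrite muleC.
    + apply: emeasurable_funM => //; apply: emeasurable_funM => //.
      by apply: (measurableT_comp mb); exact: measurable_mxD.
    + by move=> z _; rewrite !mule_ge0.
  - apply: emeasurable_funM.
      have mi : measurable_fun setT
          (\1_(rect m B obs) : g_sigma_algebraType (Pi m m.+1) -> R).
        by apply: measurable_indic; exact: measurable_rect_adapted.
      by apply/measurable_EFinP; exact: (measurableT_comp mi).
    apply: emeasurable_funM; last first.
      by apply: (measurableT_comp mH); exact: (measurableT_comp mst).
    apply: (measurableT_comp mb); apply: measurable_mxD => //.
    exact: (measurableT_comp mst).
  - by move=> w z; rewrite !mule_ge0.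
rewrite step2 (IH (fun v => bphi v * H v)); last 2 first.
- exact: emeasurable_funM.
- by move=> v; rewrite mule_ge0.
rewrite -/m.
have ysS w : ys n.+1 w = rcons (ys n w) (y m.+1 w).
  by rewrite /ys -[n.+1]addn1 iotaD map_cat/= cats1 tm.
pose al w := alpha f1E (ys n w).
have al0 w v : 0 <= al w v by exact: alpha_ge0.
have mal w : measurable_fun setT (al w) by exact: measurable_alpha.
(* On the white noise side the last observation is integrated out as well; [integral_filt] and
   [integral_phi_Lam] produce the same [H] and [bphi]. *)
transitivity (\int[Pinf]_w (iver (rect m B y) w *
    (b (y m.+1 w) * \int[lam]_v (G v * filt (y m.+1 w) (al w) v)))); last first.
  apply: eq_integral => w _; rewrite rectS iverI muleA; congr (_ * _ * _).
  by apply: eq_integral => v _; rewrite ysS alpha_rcons.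
pose U := \bigcup_(t in [set s | (1 <= s <= m)%N]) sigma_vec (y t).
have Um : U `<=` measurable.
  by move=> E [t /= /andP[t1 _]]; apply: sigma_vec_measurable; exact: my.
have malU : measurable_fun setT (fun z : g_sigma_algebraType U * V => al z.1 z.2).
  by apply: measurable_alpha_filtration; rewrite ?tm.
have ind1 : indep_of Pinf <<s U >> (y m.+1) by exact: indep_y.
rewrite (indep_integral_sigma Um (y_dens (t := m.+1) isT) ind1
  (F := fun w z => iver (rect m B y) w * (b z * \int[lam]_v (G v * filt z (al w) v))))//.
- apply: eq_integral => w _; apply/esym.
  have inn z : \int[lam]_v (G v * filt z (al w) v) =
      Lam (filt z (fun v => H v * al w v)) [::].
    rewrite (integral_filt A mg g0 z (mal w) (al0 w) mG G0).
    have g1 : \int[lam]_v (g v)%:E = 1.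
      by have [_ _ _ /(_ setT measurableT)] := om_dens (ltnSn t0);
        rewrite preimage_setT probability_setT => <-.
    rewrite (Lam_filt A mg g0 g1); last 2 first.
    + exact: emeasurable_funM.
    + by move=> v; rewrite mule_ge0.
    by apply: eq_integral => v _; rewrite muleCA.
  have g1 : \int[lam]_v (g v)%:E = 1.
    by have [_ _ _ /(_ setT measurableT)] := om_dens (ltnSn t0);
      rewrite preimage_setT probability_setT => <-.
  have mHal : measurable_fun setT (fun v => H v * al w v) by exact: emeasurable_funM.
  have Hal0 v : 0 <= H v * al w v by rewrite mule_ge0.
  transitivity (\int[lam]_z (iver (rect m B y) w *
      (b z * Lam (filt z (fun v => H v * al w v)) [::] * (phi z)%:E))).
    by apply: eq_integral => z _; rewrite inn -muleA.
  rewrite ge0_integralZl//; last 2 first.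
  + apply: emeasurable_funM => //; apply: emeasurable_funM => //.
    apply: (@measurable_param_Lam _ _ A g mg g0 _ V _ (fun _ z => z) [:: tt]
      (fun _ v => H v * al w v)) => //.
    exact: (measurableT_comp mHal measurable_snd).
  + by move=> z _; rewrite !mule_ge0// Lam_ge0// => v; exact: filt_ge0.
  congr (_ * _).
  rewrite (integral_phi_Lam A mg g0 g1 mphi phi0 phiB mHal Hal0 mb b0).
  by apply: eq_integral => v _; rewrite /bphi muleA.
- apply: emeasurable_funM.
    have mi : measurable_fun setT (\1_(rect m B y) : g_sigma_algebraType U -> R).
      by apply: measurable_indic; exact: measurable_rect_filtration.
    by apply/measurable_EFinP; exact: (measurableT_comp mi).
  apply: emeasurable_funM; first exact: measurableT_comp.
  have mfil : measurable_fun setT (fun z : (g_sigma_algebraType U * V) * V =>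
      filt z.1.2 (al z.1.1) z.2).
    have mp : measurable_fun setT (fun z : (g_sigma_algebraType U * V) * V => (z.1.1, z.2)).
      apply: measurable_fun_pair => //.
      exact: (measurableT_comp measurable_fst measurable_fst).
    have malp : measurable_fun setT (fun z : (g_sigma_algebraType U * V) * V => al z.1.1 z.2).
      exact: (measurableT_comp malU mp).
    have m2 : measurable_fun setT (fun z : g_sigma_algebraType U * V => z.2).
      exact: measurable_snd.
    exact: (@measurable_param_filt _ _ A g mg g0 _ (g_sigma_algebraType U * V)%type _
      (fun z => al z.1) m2 malp (fun z => al0 z.1)).
  have mGs : measurable_fun setT (fun z : (g_sigma_algebraType U * V) * V => G z.2).
    exact: (measurableT_comp mG measurable_snd).
  have mGf := emeasurable_funM mGs mfil.
  have := @measurable_param_integral _ _ _ (g_sigma_algebraType U * V)%type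
    (fun z v => G v * filt z.2 (al z.1) v) mGf.
  by apply=> z v; rewrite mule_ge0// filt_ge0.
- move=> w z; rewrite !mule_ge0// integral_ge0// => v _.
  by rewrite mule_ge0// filt_ge0.
Qed.

Let state_ae k : \forall w \ae P, x (t0 + k)%N w = state k w.
Proof.
elim: k => [|k IH]; first by rewrite addn0; apply: aeW.
have tk : (t0 < t0 + k.+1)%N by rewrite addnS ltnS leq_addr.
have := xE tk; rewrite addnS /= -addnS.
by apply: filterS2 IH => w -> ->.
Qed.

Let obs_ae : \forall w \ae P, forall j, (1 <= j)%N -> y j w = obs j w.
Proof.
apply: ae_foralln => j; case: (ltnP j t0) => jt0.
  case: j jt0 => [|j] jt0; first exact: aeW.
  have jt : (1 <= j.+1 < t0)%N by [].
  by apply: filterS (y_before jt) => w yE _; rewrite /obs jt0.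
have := state_ae (j - t0); rewrite subnKC//.
apply: filterS2 (y_after jt0) => w yE xs _.
by rewrite /obs ltnNge jt0 /= yE xs.
Qed.

Let rect_obs m B : (forall i, measurable (B i)) -> P (rect m B y) = P (rect m B obs).
Proof.
move=> mB.
have m1 : measurable (rect m B y).
  apply: bigcap_measurableType => i /= /andP[i1 _].
  by rewrite -[X in measurable X]setTI; apply: my.
have m2 : measurable (rect m B obs).
  have := @measurable_rect_adapted m m B m mB (leqnn _) (leqnn _).
  move: (rect m B obs); apply: smallest_sub; last exact: PiM.
  exact: sigma_algebra_measurable.
rewrite -!int_iver//; apply: ge0_ae_eq_integral => //.
- by apply/measurable_EFinP; exact: measurable_indic.
- by apply/measurable_EFinP; exact: measurable_indic.
apply: filterS obs_ae => w yo _; rewrite /iver !indicE.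
suff -> : (w \in rect m B y) = (w \in rect m B obs) by [].
apply/idP/idP => /set_mem wR; apply/mem_set => i /= /andP[i1 im]; have := wR i;
  by rewrite /= i1 im yo// => /(_ isT).
Qed.

Lemma measurable_Lam_obs n : measurable_fun setT (fun w => Lam f1E (ys n w)).
Proof.
apply: (@measurable_param_Lam _ _ A g mg g0 _ Omega _ (fun t w => y t w) (iota t0 n)
  (fun _ => f1E)) => //.
  by move=> t; rewrite mem_iota => /andP[t0t _]; apply: my; exact: leq_trans t0t.
exact: (measurableT_comp mf1E measurable_snd).
Qed.

(** Rectangles form a pi-system generating the filtration, so [change_obs] with a constant test
    function is enough; the almost sure model equations let [y] be exchanged for [obs]. *)
Theorem change_of_measure n E : filtration y (t0.-1 + n) E ->
  P E = \int[Pinf]_(w in E) Lam f1E (ys n w).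
Proof.
set m := (t0.-1 + n)%N.
have L0 w : 0 <= Lam f1E (ys n w) by exact: Lam_ge0.
have mL := measurable_Lam_obs n.
have [Q QE] := ex_density_measure Pinf mL L0.
pose G := [set C | exists B : nat -> set V, (forall i, measurable (B i)) /\ C = rect m B y].
have mR B : (forall i, measurable (B i)) -> measurable (rect m B y).
  move=> mB; apply: bigcap_measurableType => i /= /andP[i1 _].
  by rewrite -[X in measurable X]setTI; apply: my.
have GE : sigma_process [set s | (1 <= s <= m)%N] y `<=` <<s G >>.
  apply: smallest_sub; first exact: smallest_sigma_algebra.
  move=> _ [t /= tm [B mB <-]]; apply: sub_gen_smallest.
  exists (fun i => if i == t then B else setT); split; first by move=> i; case: ifP.
  rewrite setTI; apply/seteqP; split=> [w wB i /= im|w wR].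
    by case: eqP => // ->.
  by have := wR t; rewrite /= eqxx; apply.
move=> FE; rewrite -QE; apply: (@eq_probability_pi_system _ _ _ P G) => //; last exact: GE.
- move=> _ _ [B [mB ->]] [B' [mB' ->]]; exists (fun i => B i `&` B' i); split.
    by move=> i; exact: measurableI.
  apply/seteqP; split=> [w [wB wB'] i im|w wR].
    by split; [exact: wB|exact: wB'].
  by split=> i im; have [] := wR i im.
- exists (fun=> setT); split => //; apply/seteqP; split => //.
- by move=> _ [B [mB ->]]; exact: mR.
move=> _ [B [mB ->]]; rewrite QE rect_obs// -int_iver; last first.
  have := @measurable_rect_adapted m m B m mB (leqnn _) (leqnn _).
  move: (rect m B obs); apply: smallest_sub; last exact: PiM.
  exact: sigma_algebra_measurable.
transitivity (\int[P]_w (iver (rect m B obs) w * cst 1 (state n w))).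
  by apply: eq_integral => w _; rewrite /= mule1.
rewrite (change_obs n mB (measurable_cst _) (fun _ => lee01)).
rewrite [RHS]integral_mkcond; apply: eq_integral => w _.
have -> : \int[lam]_v (cst 1 v * alpha f1E (ys n w) v) = Lam f1E (ys n w).
  by apply: eq_integral => v _; rewrite /= mul1e.
by rewrite /iver patchE indicE; case: ifP => _; rewrite ?mul1e ?mul0e.
Qed.

End change_of_measure.

(** * White noise observations *)

Section white_noise.
Local Open Scope ereal_scope.
Context (R : realType) (K : nat) d (Omega : measurableType d).
Local Notation V := ('cV[R]_K).
Local Notation lam := (@lebesgue_mx R K 1).
Variables (Pinf : probability Omega R) (phi : V -> R) (y : nat -> Omega -> V).
Hypotheses
  (y_dens : forall t, (1 <= t)%N -> has_density Pinf (y t) phi)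
  (y_ind : mutually_independent Pinf [set t | (1 <= t)%N] (fun t => sigma_vec (y t))).

Let my t : (1 <= t)%N -> measurable_fun setT (y t).
Proof. by move=> /y_dens[]. Qed.
Let mphi : measurable_fun setT phi. Proof. by case: (@y_dens 1%N isT). Qed.
Let phi0 v : (0 <= phi v)%R. Proof. by case: (@y_dens 1%N isT). Qed.

Lemma filtration_indep m : indep_of Pinf (filtration y m) (y m.+1).
Proof.
apply: (process_indep y_ind my); [by move=> t /= /andP[]|by []|].
by rewrite /= ltnn.
Qed.

Lemma filtration_measurable m : filtration y m `<=` measurable.
Proof. by apply: sigma_process_measurable => t /= /andP[t1 _]; exact: my. Qed.

Lemma sub_filtration m n : (m <= n)%N -> filtration y m `<=` filtration y n.
Proof.
move=> mn; apply: sub_sigma_process => t /= /andP[-> tm]; exact: leq_trans mn.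
Qed.

Lemma filtrationT m : filtration y m setT.
Proof. exact: (@measurableT _ (g_sigma_algebraType (\bigcup_(t in _) sigma_vec (y t)))). Qed.

Lemma filtrationI m E F : filtration y m E -> filtration y m F -> filtration y m (E `&` F).
Proof.
exact: (@measurableI _ (g_sigma_algebraType (\bigcup_(t in _) sigma_vec (y t)))).
Qed.

Lemma filtration_preimage m t B : (1 <= t <= m)%N -> measurable B ->
  filtration y m (y t @^-1` B).
Proof. by move=> tm mB; exact: sigma_process_preimage. Qed.

Definition filtrationType m := g_sigma_algebraType
  (\bigcup_(t in [set s | (1 <= s <= m)%N]) sigma_vec (y t)).

HB.instance Definition _ m := Measurable.on (filtrationType m).

Lemma measurable_filtration_y m t : (1 <= t <= m)%N ->
  measurable_fun setT (fun w : filtrationType m => y t w).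
Proof. by move=> tm _ B mB; rewrite setTI; exact: filtration_preimage. Qed.

Lemma filtration_block m s n C : (1 <= s)%N -> (s + n <= m.+1)%N -> measurable C ->
  filtration y m (block y s n @^-1` C).
Proof.
move=> s1 sn mC.
have mb : measurable_fun setT (fun w : filtrationType m => block y s n w).
  apply/measurable_fun_mxP => i j.
  apply: (eq_measurable_fun (fun w : filtrationType m => y (s + j)%N w i ord0)).
    by move=> w _; rewrite mxE.
  apply: (measurableT_comp (measurable_entry i ord0)).
  have sjm : (1 <= s + j <= m)%N.
    by rewrite (leq_trans s1 (leq_addr _ _))/= -ltnS (leq_trans _ sn)// ltn_add2l.
  exact: (measurable_filtration_y sjm).
by have := mb measurableT C mC; rewrite setTI.
Qed.

Lemma indep_integral_filtration m (F : filtrationType m -> V -> \bar R) :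
  measurable_fun setT (fun z : filtrationType m * V => F z.1 z.2) ->
  (forall w z, 0 <= F w z) ->
  \int[Pinf]_w F w (y m.+1 w) =
  \int[Pinf]_w \int[lam]_z (F w z * (phi z)%:E).
Proof.
move=> mF F0.
have GM : \bigcup_(t in [set s | (1 <= s <= m)%N]) sigma_vec (y t) `<=` measurable.
  by move=> E [t /= /andP[t1 _]]; apply: sigma_vec_measurable; exact: my.
exact: (@indep_integral_sigma _ _ _ _ _ GM _ _ _ _ _ (y_dens (t := m.+1) isT)
  (filtration_indep (m := m)) mF F0).
Qed.

Section martingale.
Variables (A : 'M[R]_K) (g : V -> R).
Hypotheses (mg : measurable_fun setT g) (g0 : forall x, (0 <= g x)%R).
Hypothesis g1 : \int[lam]_x (g x)%:E = 1.
Hypothesis phiB : forall x y, phi (y - x) = (phi y * expo x y)%R.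
Hypothesis phi1 : \int[lam]_x (phi x)%:E = 1.

(** Induction on the observations, each of which preserves the mean mass. The starting density may
    depend on the past, so the statement covers both a rescaled filter and the part of the filter
    outside a ball. *)
Lemma Lam_martingale n m (E : set Omega) (h : Omega -> V -> \bar R) :
  filtration y m E ->
  measurable_fun setT (fun z : filtrationType m * V => h z.1 z.2) ->
  (forall w x, 0 <= h w x) ->
  \int[Pinf]_(w in E) Lam A g (h w) [seq y t w | t <- iota m.+1 n] =
  \int[Pinf]_(w in E) \int[lam]_x h w x.
Proof.
elim: n m E h => [//|n IH] m E h FE mh h0.
have mh' : measurable_fun setT (fun z : filtrationType m.+1 * V => h z.1 z.2).
  have mid : measurable_fun setT (fun w : filtrationType m.+1 => (w : filtrationType m)).
    move=> _ B mB; rewrite setTI; have : filtration y m B by exact: mB.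
    by apply: sub_filtration.
  have mp : measurable_fun setT (fun z : filtrationType m.+1 * V => (z.1 : filtrationType m, z.2)).
    by apply: measurable_fun_pair => //; exact: (measurableT_comp mid measurable_fst).
  exact: (measurableT_comp mh mp).
have E1 := IH m.+1 E (fun w => filt A g (y m.+1 w) (h w)).
rewrite [LHS]E1; last 3 first.
- exact: (sub_filtration (leqnSn m)).
- apply: (@measurable_param_filt _ _ A g mg g0 _ (filtrationType m.+1)
    (fun w => y m.+1 w) h _ mh' h0).
  by apply: measurable_filtration_y; rewrite leqnn.
- by move=> w x; exact: filt_ge0.
have mhw w : measurable_fun setT (h w).
  have mp : measurable_fun setT (fun x : V => (w : filtrationType m, x)).
    exact: measurable_fun_pair.
  exact: (measurableT_comp mh mp).
pose ie (w : Omega) : \bar R := (\1_E w)%:E.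
have ie0 w : 0 <= ie w by rewrite lee_fin.
have mkc (k : Omega -> \bar R) : \int[Pinf]_(w in E) k w = \int[Pinf]_w (ie w * k w).
  rewrite integral_mkcond; apply: eq_integral => w _.
  by rewrite /ie patchE indicE; case: ifP => _; rewrite ?mul1e ?mul0e.
rewrite !mkc.
have mLamz : measurable_fun setT (fun z : filtrationType m * V =>
    Lam A g (filt A g z.2 (h z.1)) [::]).
  have mp : measurable_fun setT (fun z : (filtrationType m * V) * V => (z.1.1, z.2)).
    apply: measurable_fun_pair => //.
    exact: (measurableT_comp measurable_fst measurable_fst).
  have mhp : measurable_fun setT (fun z : (filtrationType m * V) * V => h z.1.1 z.2).
    exact: (measurableT_comp mh mp).
  have m2 : measurable_fun setT (fun z : filtrationType m * V => z.2).
    exact: measurable_snd.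
  have mfil := @measurable_param_filt _ _ A g mg g0 _ (filtrationType m * V)%type _
      (fun z => h z.1) m2 mhp (fun z => h0 z.1).
  apply: (@measurable_param_integral _ _ _ (filtrationType m * V)%type
    (fun z x => filt A g z.2 (h z.1) x)) => //.
  by move=> z x; exact: filt_ge0.
have mie : measurable_fun setT (ie : filtrationType m -> \bar R).
  by apply/measurable_EFinP; apply: measurable_indic; exact: FE.
have := @indep_integral_filtration m
  (fun w z => ie w * Lam A g (filt A g z (h w)) [::]).
move=> ->; last 2 first.
- by apply: emeasurable_funM => //; exact: (measurableT_comp mie measurable_fst).
- by move=> w z; apply: mule_ge0; [exact: ie0|apply: Lam_ge0 => // x; exact: filt_ge0].
apply: eq_integral => w _.
under eq_integral do rewrite -muleA.
have mL : measurable_fun setT (fun z : V => Lam A g (filt A g z (h w)) [::] * (phi z)%:E).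
  apply: emeasurable_funM; last exact/measurable_EFinP.
  have mp : measurable_fun setT (fun z : V => (w : filtrationType m, z)).
    exact: measurable_fun_pair.
  exact: (measurableT_comp mLamz mp).
have L0 z : 0 <= Lam A g (filt A g z (h w)) [::] * (phi z)%:E.
  by apply: mule_ge0; [apply: Lam_ge0 => // x; exact: filt_ge0|rewrite lee_fin].
rewrite ge0_integralZl; [|exact: measurableT|exact: mL|by move=> z _; exact: L0|exact: ie0].
by rewrite (integral_Lam_filt A mg g0 g1 mphi phi0 phiB phi1).
Qed.

End martingale.

Section shift.
Variable n : nat.
Implicit Types (B : 'I_n -> set V).

Let mxrect B : set 'M[R]_(K, n) := [set M | forall j, B j (col j M)].

Let measurable_col j : measurable_fun setT (fun M : 'M[R]_(K, n) => col j M).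
Proof.
apply/measurable_fun_mxP => i k; under eq_fun do rewrite mxE.
exact: measurable_entry.
Qed.

Let mxrect_measurable B : (forall j, measurable (B j)) -> measurable (mxrect B).
Proof.
move=> mB; rewrite (_ : mxrect B = \bigcap_(j in [set: 'I_n])
    ((fun M : 'M[R]_(K, n) => col j M) @^-1` B j)); last first.
  by apply/seteqP; split=> M MB j; [move=> _; exact: (MB j)|exact: (MB j I)].
apply: fin_bigcap_measurable => // j _.
by rewrite -[X in measurable X]setTI; apply: measurable_col.
Qed.

Let col_block s w (j : 'I_n) : col j (block y s n w) = y (s + j)%N w.
Proof. by apply/matrixP => i k; rewrite !mxE (ord1 k). Qed.

Let rect_prob m E B : filtration y m E -> (forall j, measurable (B j)) ->
  Pinf (E `&` block y m.+1 n @^-1` mxrect B) =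
  Pinf E * \prod_(j < n) \int[lam]_(v in B j) (phi v)%:E.
Proof.
move=> FE mB.
pose Bn (i : nat) : set V := if insub i is Some j then B j else setT.
have mBn i : measurable (Bn i) by rewrite /Bn; case: insub.
pose rec k := \bigcap_(i in [set i | (i < k)%N]) (y (m.+1 + i)%N @^-1` Bn i).
have rE : block y m.+1 n @^-1` mxrect B = rec n.
  apply/seteqP; split=> [w wB i /= i_n|w wr j].
    have := wB (Ordinal i_n); rewrite col_block /= /Bn.
    by case: insubP => [j _ ji|]; [rewrite -(_ : j = Ordinal i_n)//; exact: val_inj|rewrite i_n].
  rewrite col_block; have := wr j (ltn_ord j); rewrite /= /Bn.
  by case: insubP => [j' _ /val_inj -> //|]; rewrite ltn_ord.
have recS k : rec k.+1 = rec k `&` y (m.+1 + k)%N @^-1` Bn k.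
  apply/seteqP; split=> [w wr|w [wr wk] i /=].
    by split; [move=> i /= ik; apply: wr => /=; exact: ltnW|apply: (wr k) => /=].
  by rewrite ltnS leq_eqVlt => /orP[/eqP ->//|]; exact: wr.
have H k : filtration y (m + k) (E `&` rec k) /\ Pinf (E `&` rec k) =
    Pinf E * \prod_(0 <= i < k) \int[lam]_(v in Bn i) (phi v)%:E.
  elim: k => [|k [Fk Pk]].
    have -> : rec 0%N = setT by apply/seteqP; split.
    by rewrite setIT addn0 big_geq// mule1.
  rewrite recS setIA; split.
    apply: filtrationI; first by apply: sub_filtration Fk; rewrite leq_add2l.
    by apply: filtration_preimage => //; rewrite addSn addnS ltnSn.
  have -> : (m.+1 + k = (m + k).+1)%N by rewrite addSn.
  rewrite filtration_indep// Pk big_nat_recr//= muleA; congr (_ * _).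
  by have [_ _ _ ->] := y_dens (t := (m + k).+1) isT.
rewrite rE; have [_ ->] := H n; congr (_ * _).
rewrite big_mkord; apply: eq_bigr => j _; rewrite /Bn.
by case: insubP => [j' _ /val_inj -> //|]; rewrite ltn_ord.
Qed.

(** Both sides are finite measures in [C]; on sets that constrain each column separately they agree
    because the columns are identically distributed and independent of each other and of [E]. *)
Lemma block_shift m E C : filtration y m E -> measurable C ->
  Pinf (E `&` block y m.+1 n @^-1` C) = Pinf E * Pinf (block y 1 n @^-1` C).
Proof.
move=> FE mC.
have mE := filtration_measurable FE.
have mb s : (1 <= s)%N -> measurable_fun setT (block y s n).
  move=> s1 _ B mB; rewrite setTI; apply: (@filtration_measurable (s + n)%N).
  by apply: filtration_block.
pose b s (s1 : (1 <= s)%N) : {mfun Omega >-> 'M[R]_(K, n)} :=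
  HB.pack_for {mfun Omega >-> 'M[R]_(K, n)} (block y s n)
  (isMeasurableFun.Build _ _ _ _ _ (mb s s1)).
have PE : Pinf E \is a fin_num by exact: fin_num_measure.
pose k := NngNum (fine_ge0 (measure_ge0 Pinf E)).
pose mu1 := pushforward (mrestr Pinf mE) (b m.+1 isT).
pose mu2 := mscale k (distribution Pinf (b 1%N isT)).
have mu2E D : mu2 D = Pinf E * Pinf (block y 1 n @^-1` D).
  by rewrite /mu2 /mscale /= fineK.
have mu1E D : mu1 D = Pinf (E `&` block y m.+1 n @^-1` D).
  by rewrite /mu1 /pushforward/= /mrestr setIC.
rewrite -mu1E -mu2E.
pose G := [set C | exists B, (forall j, measurable (B j)) /\ C = mxrect B].
have GM : G `<=` measurable by move=> _ [B [mB ->]]; exact: mxrect_measurable.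
have GT : G setT.
  by exists (fun=> setT); split => //; apply/seteqP; split.
apply: (@g_sigma_algebra_measure_unique _ _ _ G GM (fun=> setT)) => //.
- by rewrite bigcup_const.
- move=> _ _ [B [mB ->]] [B' [mB' ->]]; exists (fun j => B j `&` B' j); split.
    by move=> j; exact: measurableI.
  apply/seteqP; split=> [M [MB MB'] j|M MB]; first by split.
  by split=> j; have [] := MB j.
- move=> _ [B [mB ->]]; rewrite [LHS]mu1E [RHS]mu2E rect_prob//.
  have := @rect_prob 0%N setT B (@filtrationT 0%N) mB.
  by rewrite setTI probability_setT mul1e => ->.
- by move=> _; rewrite [ltLHS]mu1E preimage_setT setIT ltey_eq PE.
- move: C mC; apply: smallest_sub; first exact: smallest_sigma_algebra.
  move=> _ [[i j] _ [B mB <-]]; apply: sub_gen_smallest; rewrite setTI.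
  exists (fun j' => if j' == j then (fun v : V => v i ord0) @^-1` B else setT); split.
    move=> j'; case: ifP => // _; rewrite -[X in measurable X]setTI.
    exact: measurable_entry.
  apply/seteqP; split=> [M MB j' /=|M MB].
    by case: eqP => // ->; rewrite /= mxE.
  by have := MB j; rewrite eqxx /= mxE.
Qed.

End shift.

End white_noise.

(** * Likelihood ratios of observation blocks *)

Section observed_likelihood.
Local Open Scope ereal_scope.
Context (R : realType) (K : nat) d (Omega : measurableType d).
Local Notation V := ('cV[R]_K).
Local Notation lam := (@lebesgue_mx R K 1).
Variables (Pinf : probability Omega R) (phi : V -> R) (y : nat -> Omega -> V).
Hypotheses
  (y_dens : forall t, (1 <= t)%N -> has_density Pinf (y t) phi)
  (y_ind : mutually_independent Pinf [set t | (1 <= t)%N] (fun t => sigma_vec (y t))).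
Variables (A : 'M[R]_K) (g : V -> R) (f : V -> \bar R).
Hypotheses (mg : measurable_fun setT g) (g0 : forall x, (0 <= g x)%R).
Hypotheses (mf : measurable_fun setT f) (f0 : forall x, 0 <= f x).
Variable LR : seq V -> R.
Hypotheses (LRE : forall ys, Lam A g f ys = (LR ys)%:E).
Hypotheses (LR_gt0 : forall ys, (0 < LR ys)%R).

Definition lik s n w := LR [seq y t w | t <- iota s n].

Lemma measurable_lik_filtration m s n : (1 <= s)%N -> (s + n <= m.+1)%N ->
  measurable_fun setT (fun w : filtrationType y m => lik s n w).
Proof.
move=> s1 sn; apply/measurable_EFinP.
apply: (eq_measurable_fun (fun w : filtrationType y m =>
    Lam A g f [seq y t w | t <- iota s n])); first by move=> w _; rewrite LRE.
apply: (@measurable_param_Lam _ _ A g mg g0 _ (filtrationType y m) _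
  (fun t w => y t w) (iota s n) (fun _ => f)) => //.
  move=> t; rewrite mem_iota => /andP[st tn].
  have tm : (1 <= t <= m)%N by rewrite (leq_trans s1 st)/= -ltnS (leq_trans tn).
  exact: measurable_filtration_y.
exact: (measurableT_comp mf measurable_snd).
Qed.

Lemma measurable_lik s n : (1 <= s)%N -> measurable_fun setT (lik s n).
Proof.
move=> s1; have := measurable_lik_filtration (m := (s + n)%N) s1 (leqnSn _).
move=> ml _ B mB; rewrite setTI; apply: (filtration_measurable y_dens (m := (s + n)%N)).
by have := ml measurableT B mB; rewrite setTI.
Qed.

Definition lik_mx t (M : 'M[R]_(K, t)) := LR [seq col j M | j <- enum 'I_t].

Lemma measurable_lik_mx t : measurable_fun setT (@lik_mx t).
Proof.
apply/measurable_EFinP.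
apply: (eq_measurable_fun (fun M : 'M[R]_(K, t) =>
    Lam A g f [seq col j M | j <- enum 'I_t])); first by move=> w _; rewrite LRE.
apply: (@measurable_param_Lam _ _ A g mg g0 _ 'M[R]_(K, t) _
  (fun j M => col j M) (enum 'I_t) (fun _ => f)) => //.
  move=> j _; apply/measurable_fun_mxP => i k.
  by apply: (eq_measurable_fun (fun M : 'M[R]_(K, t) => M i j));
    [move=> M _; rewrite mxE|exact: measurable_entry].
exact: (measurableT_comp mf measurable_snd).
Qed.

Lemma lik_mx_block s t w : lik_mx (block y s t w) = lik s t w.
Proof.
congr LR; rewrite -{2}(addn0 s) iotaDl -val_enum_ord -!map_comp.
apply: eq_map => j /=; apply/matrixP => i k.
by rewrite !mxE (ord1 k).
Qed.

(** Densities are determined only up to null sets, and the ratio also needs [pinf] nonzero. The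
    exceptional set is taken in the filtration so that a change of measure can make it null under
    the other laws too. *)
Lemma likelihood_ratio_ae (P1 : probability Omega R) t p1 pinf :
  (forall E, filtration y t E -> P1 E = \int[Pinf]_(w in E) (lik 1 t w)%:E) ->
  has_density P1 (block y 1 t) p1 -> has_density Pinf (block y 1 t) pinf ->
  exists N, [/\ filtration y t N, Pinf N = 0 &
    forall w, ~ N w -> (p1 (block y 1 t w) / pinf (block y 1 t w))%R = lik 1 t w].
Proof.
move=> com [mb mp1 p10 P1E] pinf_dens; have [_ mp p0 PE] := pinf_dens.
pose leb := @lebesgue_mx R K t.
pose q M := (lik_mx M * pinf M)%R.
have mq : measurable_fun setT q by apply: measurable_funM => //; exact: measurable_lik_mx.
have lik0 M : (0 <= @lik_mx t M)%R by exact/ltW/LR_gt0.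
have FB C : measurable C -> filtration y t (block y 1 t @^-1` C).
  by move=> mC; exact: filtration_block.
have intE C : measurable C -> \int[leb]_(M in C) (p1 M)%:E = \int[leb]_(M in C) (q M)%:E.
  move=> mC; rewrite -P1E// com; last exact: FB.
  rewrite [LHS]integral_mkcond [RHS]integral_mkcond.
  pose h M := (\1_C M)%:E * (lik_mx M)%:E.
  transitivity (\int[Pinf]_w h (block y 1 t w)).
    apply: eq_integral => w _; rewrite /h patchE indicE lik_mx_block.
    have -> : (w \in block y 1 t @^-1` C) = (block y 1 t w \in C).
      by apply/idP/idP => /set_mem ?; exact/mem_set.
    by case: ifP => _; rewrite ?mul1e ?mul0e.
  rewrite (has_density_integral pinf_dens).
  - apply: eq_integral => M _; rewrite /h patchE indicE /q.
    by case: ifP => _; rewrite ?mul1e ?mul0e.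
  - apply: emeasurable_funM; apply/measurable_EFinP; first exact: measurable_indic.
    exact: measurable_lik_mx.
  - by move=> M; rewrite /h mule_ge0 ?lee_fin.
have p1i : leb.-integrable setT (EFin \o p1).
  apply/integrableP; split; first exact/measurable_EFinP.
  under eq_integral => M _ do rewrite /= ger0_norm//.
  by rewrite -(P1E _ measurableT) preimage_setT probability_setT ltry.
have mqe : measurable_fun setT (EFin \o q) by exact/measurable_EFinP.
have mpe : measurable_fun setT (EFin \o p1) by exact/measurable_EFinP.
have aeq : ae_eq leb setT (EFin \o p1) (EFin \o q).
  by apply: integral_ae_eq => // E _ mE; exact: intE.
pose N1 := [set M | (p1 M)%:E != (q M)%:E].
have mN1 : measurable N1.
  have := measurable_neqe measurableT mpe mqe; by rewrite setTI.
pose N2 := [set M | pinf M = 0%R].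
have mN2 : measurable N2.
  have := mp measurableT [set 0%R] (measurable_set1 _); by rewrite setTI.
have leb0 : leb N1 = 0.
  apply/negligibleP => //; apply: negligibleS aeq => M /= /eqP h1 h2.
  by apply: h1; exact: h2.
exists (block y 1 t @^-1` (N1 `|` N2)); split.
- by apply: FB; exact: measurableU.
- apply/eqP; rewrite eq_le measure_ge0 andbT preimage_setU.
  have m1 := filtration_measurable y_dens (FB _ mN1).
  have m2 := filtration_measurable y_dens (FB _ mN2).
  apply: (le_trans (measureU2 _ m1 m2)).
  have h1 : Pinf (block y 1 t @^-1` N1) = 0.
    rewrite PE//; apply: null_set_integral => //.
    by apply: measurable_funTS; exact/measurable_EFinP.
  have h2 : Pinf (block y 1 t @^-1` N2) = 0.
    by rewrite PE// integral0_eq// => M ->.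
  by rewrite [X in X + _]h1 [X in _ + X]h2 adde0.
- move=> w /not_orP[/negP]; rewrite negbK => /eqP[->] /eqP p00.
  by rewrite /q mulfK// lik_mx_block.
Qed.

End observed_likelihood.

(** * The CuSum process *)

Section cusum_process.
Context (R : realType) (T : Type) (L : nat -> T -> R) (c : R).

(** The CuSum of an arbitrary process [L], so that the ratio of the given densities can be exchanged
    for [Lam]. *)
Definition cstat t w : R := \big[Num.max/0]_(i < t.+1) (ln (L t w) - ln (L i w)).

Definition ctime w : \bar R := ereal_inf [set (t%:R%:E : \bar R) | t in
    [set t : nat | (1 <= t)%N /\ c <= cstat t w]].

Definition run n : set T := [set w | forall t, (1 <= t <= n)%N -> cstat t w < c].

Lemma cstat_lt t w : 0 < c ->
  cstat t w < c <-> forall i, (i <= t)%N -> ln (L t w) - ln (L i w) < c.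
Proof.
move=> c0; split=> [/bigmax_ltP[_ H] i it|H].
  by have := H (inord i) isT; rewrite inordK.
by apply/bigmax_ltP; split=> // i _; apply: H; rewrite -ltnS.
Qed.

Lemma cstat_ge0 t w : 0 <= cstat t w.
Proof. by rewrite /cstat bigmax_ge_id. Qed.

Lemma run0 : run 0 = setT.
Proof. by apply/seteqP; split=> // w _ t /andP[t1]; rewrite leqNgt t1. Qed.

Lemma sub_run m n : (m <= n)%N -> run n `<=` run m.
Proof. by move=> mn w wr t /andP[t1 tm]; apply: wr; rewrite t1 (leq_trans tm). Qed.

(** Tail-sum formula, counting the times from [t0] on at which no alarm has been raised; if there is
    never an alarm, both sides are infinite. *)
Lemma delay_run t0 w :
  maxe 0%E (ctime w - t0%:R%:E)%E = (\sum_(n <oo) (\1_(run (t0 + n)) w)%:E)%E.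
Proof.
have [[t [t1 ct]]|nt] := pselect (exists t : nat, (1 <= t)%N /\ c <= cstat t w).
  have ex : exists t, (1 <= t)%N && (c <= cstat t w) by exists t; rewrite t1.
  case: (ex_minnP ex) => m /andP[m1 cm] mmin.
  have cE : ctime w = m%:R%:E.
    apply/eqP; rewrite eq_le; apply/andP; split.
      by apply: ereal_inf_lbound; exists m.
    apply: le_ereal_inf_tmp => _ [s [s1 cs] <-]; rewrite lee_fin ler_nat.
    by apply: mmin; rewrite s1.
  have rE n : (\1_(run n) w : R) = (n < m)%N%:R.
    rewrite indicE; congr (_%:R); congr nat_of_bool.
    apply/idP/idP => [/set_mem wr|nm].
      rewrite ltnNge; apply/negP => mn.
      by have := wr m; rewrite m1 mn ltNge cm => /(_ isT).
    apply/mem_set => s /andP[s1 sn]; rewrite ltNge; apply/negP => cs.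
    by have := mmin s; rewrite s1 cs leqNgt (leq_ltn_trans sn nm) => /(_ isT).
  have sE N : (\sum_(0 <= n < N) (\1_(run (t0 + n)) w)%:E)%E =
      ((minn N (m - t0))%:R%:E : \bar R).
    elim: N => [|N IH]; first by rewrite big_geq// min0n.
    rewrite big_nat_recr//= IH rE -EFinD -natrD; congr (_%:R%:E).
    rewrite -ltn_subRL; case: ltnP => h; rewrite /= ?addn1 ?addn0.
      by rewrite (minn_idPl h).
    by rewrite (minn_idPr (leqW h)).
  transitivity (((m - t0)%N%:R)%:E : \bar R).
    rewrite cE -EFinB; case: (leqP t0 m) => h.
      by rewrite natrB// max_r// lee_fin subr_ge0 ler_nat.
    rewrite max_l; last by rewrite lee_fin subr_le0 ler_nat ltnW.
    by rewrite (_ : (m - t0)%N = 0%N)//; apply/eqP; rewrite subn_eq0 ltnW.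
  apply/esym/cvg_lim => //; under eq_fun do rewrite sE.
  by apply: cvg_near_cst; exists (m - t0)%N => // N /= h; rewrite (minn_idPr h).
have rE n : (\1_(run n) w : R) = 1.
  rewrite indicE mem_set// => s /andP[s1 _]; rewrite ltNge; apply/negP => cs.
  by apply: nt; exists s.
have -> : ctime w = +oo%E.
  rewrite /ctime (_ : [set _ | _ in _] = set0) ?ereal_inf0//.
  by apply/seteqP; split=> // x [s sP _]; apply: nt; exists s.
rewrite max_r ?leey//=.
apply/esym/cvg_lim => //; under eq_fun do (under eq_bigr do rewrite rE).
under eq_fun do rewrite sumEFin sumr_const_nat subn0.
by apply/cvgeryP; exact: cvgr_idn.
Qed.

Lemma ctime_run w : ctime w = (\sum_(n <oo) (\1_(run n) w)%:E)%E.
Proof.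
rewrite -(delay_run 0) sube0 max_r//; apply: le_ereal_inf_tmp => _ [s _ <-].
by rewrite lee_fin ler0n.
Qed.

End cusum_process.

Section measurable_run.
Context (R : realType) d (T : measurableType d) (L : nat -> T -> R) (c : R).

Lemma measurable_run n : (forall t, (t <= n)%N -> measurable_fun setT (L t)) ->
  measurable (run L c n).
Proof.
move=> mL; have [c0|c0] := ltP 0 c; last first.
  case: n mL => [|n] mL; first by rewrite run0.
  rewrite (_ : run _ _ _ = set0)//; apply/seteqP; split=> // w wr.
  by have := wr 1%N isT; rewrite ltNge (le_trans c0 (cstat_ge0 _ _ _)).
rewrite (_ : run _ _ _ = \bigcap_(t in [set t | (1 <= t <= n)%N])
    \bigcap_(i in [set i | (i <= t)%N]) [set w | ln (L t w) - ln (L i w) < c]); last first.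
  by apply/seteqP; split=> w wr t tn; [apply/(cstat_lt _ _ _ c0)|apply/(cstat_lt _ _ _ c0)]; exact: wr.
apply: bigcap_measurableType => t /= /andP[t1 tn].
apply: bigcap_measurableType => i /= it.
have mD : measurable_fun setT (fun w => ln (L t w) - ln (L i w)).
  apply: measurable_funB; apply: measurableT_comp => //; apply: mL => //.
  exact: leq_trans tn.
have := mD measurableT [set` `]-oo, c[] (measurable_itv _).
by rewrite setTI; congr (measurable _); apply/seteqP; split=> w; rewrite /= in_itv.
Qed.

End measurable_run.

(** * False alarms *)

Section integral_run.
Local Open Scope ereal_scope.
Context (R : realType) d (T : measurableType d) (L : nat -> T -> R) (c : R).
Hypothesis mL : forall t, measurable_fun setT (L t).
Variable P : probability T R.

Let mrun n : measurable (run L c n). Proof. by apply: measurable_run => t _. Qed.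
Let m1 n : measurable_fun setT (fun w => (\1_(run L c n) w : R)%:E).
Proof. by apply/measurable_EFinP; exact: measurable_indic. Qed.

Lemma measurable_delay t0 : measurable_fun setT (fun w => maxe 0 (ctime L c w - t0%:R%:E)).
Proof.
under eq_fun do rewrite delay_run.
by apply: ge0_emeasurable_sum => // n w _ _; rewrite lee_fin.
Qed.

Lemma integral_delay t0 E : measurable E ->
  \int[P]_(w in E) maxe 0 (ctime L c w - t0%:R%:E) =
  \sum_(n <oo) P (E `&` run L c (t0 + n)).
Proof.
move=> mE; under eq_integral do rewrite delay_run.
rewrite integral_nneseries//; last by move=> n; exact: measurable_funTS.
by apply: eq_eseriesr => n _; rewrite integral_indic// setIC.
Qed.

Lemma integral_ctime : \int[P]_w ctime L c w = \sum_(n <oo) P (run L c n).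
Proof.
under eq_integral do rewrite ctime_run.
rewrite integral_nneseries//.
by apply: eq_eseriesr => n _; rewrite integral_indic// setIT.
Qed.

End integral_run.

Section false_alarm.
Local Open Scope ereal_scope.
Context (R : realType) (K : nat) d (Omega : measurableType d).
Local Notation V := ('cV[R]_K).
Local Notation lam := (@lebesgue_mx R K 1).
Variables (Pinf : probability Omega R) (phi : V -> R) (y : nat -> Omega -> V).
Hypotheses
  (y_dens : forall t, (1 <= t)%N -> has_density Pinf (y t) phi)
  (y_ind : mutually_independent Pinf [set t | (1 <= t)%N] (fun t => sigma_vec (y t))).
Variables (A : 'M[R]_K) (g : V -> R) (f : V -> \bar R).
Hypotheses (mg : measurable_fun setT g) (g0 : forall x, (0 <= g x)%R).
Hypothesis g1 : \int[lam]_x (g x)%:E = 1.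
Hypotheses (mf : measurable_fun setT f) (f0 : forall x, 0 <= f x).
Hypothesis phiB : forall x y, phi (y - x) = (phi y * expo x y)%R.
Hypothesis phi1 : \int[lam]_x (phi x)%:E = 1.
Variable LR : seq V -> R.
Hypotheses (LRE : forall ys, Lam A g f ys = (LR ys)%:E).
Hypotheses (LR_gt0 : forall ys, (0 < LR ys)%R).
Local Notation lr := (lik y LR).
Local Notation FT := (filtrationType y).

(** Given the past, the likelihood ratio of the next observation has mean 1: this is
    [Lam_martingale] for one observation, started from the current filter multiplied by [k] and
    divided by its mass. *)
Lemma integral_lik_step m E (k : Omega -> R) : filtration y m E ->
  measurable_fun setT (fun w : FT m => k w) -> (forall w, (0 <= k w)%R) ->
  \int[Pinf]_(w in E) (k w * (lr 1 m.+1 w / lr 1 m w))%:E =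
  \int[Pinf]_(w in E) (k w)%:E.
Proof.
move=> FE mk k0.
pose a w x := alpha A g f [seq y t w | t <- iota 1 m] x.
pose q w : R := (k w / lr 1 m w)%R.
have q0 w : (0 <= q w)%R by exact: (divr_ge0 (k0 w) (ltW (LR_gt0 _))).
have a0 w x : 0 <= a w x by exact: alpha_ge0.
have ma : measurable_fun setT (fun z : FT m * V => a z.1 z.2).
  apply: (@measurable_param_alpha _ _ A g mg g0 _ (FT m) _
    (fun t w => y t w) (iota 1 m) (fun _ => f)) => //.
    by move=> t; rewrite mem_iota add1n ltnS => tm; exact: measurable_filtration_y.
  exact: (measurableT_comp mf measurable_snd).
have mlik : measurable_fun setT (fun w : FT m => lr 1 m w).
  by apply: (measurable_lik_filtration mg g0 mf f0 LRE).
have mq : measurable_fun setT (fun w : FT m => q w).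
  apply: measurable_funM => //; apply: measurable_invr_ge0 => // w.
  exact: (ltW (LR_gt0 _)).
have mh : measurable_fun setT (fun z : FT m * V => (q z.1)%:E * a z.1 z.2).
  apply: emeasurable_funM => //; apply/measurable_EFinP.
  exact: (measurableT_comp mq measurable_fst).
have h0 w x : 0 <= (q w)%:E * a w x by rewrite mule_ge0// lee_fin.
have maw w : measurable_fun setT (a w) by exact: measurable_alpha.
have := Lam_martingale y_dens y_ind A mg g0 g1 phiB phi1 1%N FE mh h0.
have E1 w : Lam A g (fun x => (q w)%:E * a w x) [seq y t w | t <- iota m.+1 1] =
    (k w * (lr 1 m.+1 w / lr 1 m w))%:E.
  rewrite LamZ// -Lam_cat -map_cat -iotaD addn1 LRE -EFinM.
  by rewrite /q -/(lr 1 m.+1 w) mulrAC mulrA.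
have E2 w : \int[lam]_x ((q w)%:E * a w x) = (k w)%:E.
  rewrite ge0_integralZl//; [|exact: q0].
  by rewrite -LamE LRE -EFinM /q -/(lr 1 m w) divfK ?gt_eqF//; exact: LR_gt0.
under eq_integral do rewrite E1.
by under [X in _ = X -> _]eq_integral do rewrite E2.
Qed.

Variable c : R.
Hypothesis c0 : (0 < c)%R.
Local Notation run := (run (lr 1) c).

Lemma filtration_run n : filtration y n (run n).
Proof.
apply: (@measurable_run R _ (FT n) (fun t w => lr 1 t w) c n) => t tn.
by apply: (measurable_lik_filtration mg g0 mf f0 LRE) => //; rewrite add1n ltnS.
Qed.

Let mrun n : measurable (run n).
Proof. by apply: (filtration_measurable y_dens (m := n)); exact: filtration_run. Qed.

(** The Shiryaev-Roberts statistic, at least the exponential of the CuSum whenever the latter is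
    positive. *)
Let Rn n w : R := (\sum_(i < n) lr 1 n w / lr 1 i w)%R.

Let RnS n w : Rn n.+1 w = ((Rn n w + 1) * (lr 1 n.+1 w / lr 1 n w))%R.
Proof.
rewrite /Rn big_ord_recr/= mulrDl mul1r mulr_suml; congr (_ + _)%R.
apply: eq_bigr => i _.
have ni := lt0r_neq0 (LR_gt0 [seq y t w | t <- iota 1 i]).
have nn := lt0r_neq0 (LR_gt0 [seq y t w | t <- iota 1 n]).
by rewrite /lik; field; rewrite ni nn.
Qed.

Let Rn_ge0 n w : (0 <= Rn n w)%R.
Proof. by apply: sumr_ge0 => i _; rewrite divr_ge0//; exact: (ltW (LR_gt0 _)). Qed.

Let mRn n : measurable_fun setT (fun w : FT n => Rn n w).
Proof.
apply: measurable_sum => i; apply: measurable_funM.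
  by apply: (measurable_lik_filtration mg g0 mf f0 LRE) => //; rewrite add1n.
apply: measurable_invr_ge0 => [|w]; last exact: (ltW (LR_gt0 _)).
by apply: (measurable_lik_filtration mg g0 mf f0 LRE) => //; rewrite add1n ltnS ltnW.
Qed.

Let stop_Rn n w : ~ run n.+1 w -> run n w -> (expR c <= Rn n.+1 w)%R.
Proof.
move=> r1 r0; have /existsNP[i] : ~ forall i, (i <= n.+1)%N ->
    (ln (lr 1 n.+1 w) - ln (lr 1 i w) < c)%R.
  move=> H; apply: r1 => t /andP[t1]; rewrite leq_eqVlt => /orP[/eqP ->|].
    exact/(cstat_lt _ _ _ c0).
  by rewrite ltnS => tn; apply: r0; rewrite t1.
move=> /not_implyP[]; rewrite leq_eqVlt => /orP[/eqP -> |i_n].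
  (* The index equal to the current time gives the value 0, below [c]; the alarm therefore comes
     from an earlier index, whose ratio is a term of [Rn]. *)
  by rewrite subrr c0.
move=> /negP; rewrite -leNgt -ln_div ?posrE; [|exact: LR_gt0|exact: LR_gt0].
have q0 : (0 < lr 1 n.+1 w / lr 1 i w)%R by rewrite divr_gt0//; exact: LR_gt0.
move=> cq; apply: (@le_trans _ _ (lr 1 n.+1 w / lr 1 i w)%R).
  by rewrite -ler_ln ?posrE ?expR_gt0// expRK.
rewrite /Rn (bigD1 (Ordinal i_n))//= lerDl; apply: sumr_ge0 => j _.
by rewrite divr_ge0//; exact: (ltW (LR_gt0 _)).
Qed.

Let a n := fine (Pinf (run n)).

Let aE n : Pinf (run n) = (a n)%:E.
Proof. by rewrite fineK// fin_num_measure. Qed.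

(** Optional stopping by hand: [b] is the mean of the statistic where no alarm has occurred, and
    what has been stopped contributes at least [expR c] times the probability [1 - a n] of an
    alarm. *)
Let potential n : exists b : R, [/\ (0 <= b)%R,
  \int[Pinf]_(w in run n) (Rn n w)%:E = b%:E &
  (b + expR c <= \sum_(t < n) a t + expR c * a n)%R].
Proof.
elim: n => [|n [b [b0 bE IH]]].
  exists 0%R; split=> //; first by apply: integral0_eq => w _; rewrite /Rn big_ord0.
  by rewrite big_ord0 !add0r /a run0 probability_setT mulr1.
have mE m : measurable_fun setT (fun w => (Rn m w)%:E).
  apply/measurable_EFinP => _ B mB; rewrite setTI.
  apply: (filtration_measurable y_dens (m := m)).
  by have := @mRn m measurableT B mB; rewrite setTI.
have I1 : \int[Pinf]_(w in run n) (Rn n.+1 w)%:E = (b + a n)%:E.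
  under eq_integral do rewrite RnS.
  rewrite integral_lik_step//; last 3 first.
  - exact: filtration_run.
  - by apply: measurable_funD.
  - by move=> w; rewrite addr_ge0.
  under eq_integral do rewrite EFinD.
  rewrite ge0_integralD//; last 2 first.
  - by move=> w _; rewrite lee_fin.
  - by apply: measurable_funTS; exact: mE.
  by rewrite bE integral_cst// mul1e [X in _ + X]aE.
pose D := run n `\` run n.+1.
have mD : measurable D by exact: measurableD.
have rD : run n = run n.+1 `|` D.
  by apply/esym/setDUK; exact: sub_run.
have dD : [disjoint run n.+1 & D] by apply/disj_setPS => w [r1 [_ /(_ r1)]].
have PD : (a n)%:E = (a n.+1)%:E + Pinf D.
  by rewrite -!aE {1}rD measureU//; apply/disj_set2P.
have PDfin : Pinf D \is a fin_num by exact: fin_num_measure.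
have DE : fine (Pinf D) = (a n - a n.+1)%R.
  have -> : a n = (a n.+1 + fine (Pinf D))%R by apply: EFin_inj; rewrite EFinD (fineK PDfin).
  by rewrite addrAC subrr add0r.
have ID : (expR c)%:E * Pinf D <= \int[Pinf]_(w in D) (Rn n.+1 w)%:E.
  rewrite -integral_cst//; apply: ge0_le_integral => //.
  - by move=> w _; rewrite lee_fin expR_ge0.
  - by apply: measurable_funTS; exact: mE.
  - by move=> w [r0 r1]; rewrite lee_fin; exact: stop_Rn.
have := I1; rewrite {1}rD ge0_integral_setU//;
  [|by apply: measurable_funTS; exact: mE|by move=> w _; rewrite lee_fin].
set J1 := integral _ _ _; set J2 := integral _ _ _ => J12.
have J1ge : 0 <= J1 by apply: integral_ge0 => w _; rewrite lee_fin.
have J2ge : 0 <= J2 by apply: integral_ge0 => w _; rewrite lee_fin.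
have J1fin : J1 \is a fin_num.
  by rewrite ge0_fin_numE// (le_lt_trans _ (ltry (b + a n)))// -J12 leeDl.
exists (fine J1); split; [exact: fine_ge0|by rewrite fineK|].
have : (fine J1)%:E + (expR c * (a n - a n.+1))%:E <= (b + a n)%:E.
  by rewrite -J12 fineK// leeD2lE// -DE EFinM fineK.
rewrite lee_fin big_ord_recr/=; lra.
Qed.

(** If the mean [r] were below [expR c], [potential] would keep every no-alarm probability above the
    positive number [1 - r / expR c], and their sum, which is the mean, would be infinite. *)
Lemma false_alarm : (expR c)%:E <= \int[Pinf]_w ctime (lr 1) c w.
Proof.
rewrite integral_ctime; last by move=> t; exact: (measurable_lik y_dens mg g0 mf f0 LRE).
set I := (X in _ <= X).
have sI n : (\sum_(t < n) a t)%:E <= I.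
  rewrite -sumEFin; under eq_bigr do rewrite -aE.
  by rewrite -(big_mkord xpredT (fun t => Pinf (run t))); exact: nneseries_lim_ge.
have I0 : 0 <= I by rewrite (le_trans _ (sI 0%N))// big_ord0.
case: I I0 sI => [r| |] // r0 sI; last by rewrite leey.
rewrite lee_fin leNgt; apply/negP => rc.
have ec := expR_gt0 c.
pose e := (1 - r / expR c)%R.
have e0 : (0 < e)%R by rewrite subr_gt0 ltr_pdivrMr// mul1r.
have ae n : (e <= a n)%R.
  have [b [b0 _ H]] := potential n; have := sI n; rewrite lee_fin => sr.
  rewrite -(ler_pM2l ec) mulrBr mulr1 mulrCA divff ?gt_eqF// mulr1; lra.
have := sI (Num.truncn (r / e)).+1; rewrite lee_fin leNgt => /negP; apply.
rewrite (@lt_le_trans _ _ ((Num.truncn (r / e)).+1%:R * e))%R//.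
  by rewrite -ltr_pdivrMr// truncnS_gt.
apply: (@le_trans _ _ (\sum_(t < (Num.truncn (r / e)).+1) e)%R).
  by rewrite sumr_const card_ord mulr_natl.
by apply: ler_sum => t _; exact: ae.
Qed.

End false_alarm.

(** * Detection delay *)

Section shift_integral.
Local Open Scope ereal_scope.
Context (R : realType) (K : nat) d (Omega : measurableType d).
Local Notation V := ('cV[R]_K).
Variables (Pinf : probability Omega R) (phi : V -> R) (y : nat -> Omega -> V).
Hypotheses
  (y_dens : forall t, (1 <= t)%N -> has_density Pinf (y t) phi)
  (y_ind : mutually_independent Pinf [set t | (1 <= t)%N] (fun t => sigma_vec (y t))).

Lemma measurable_block s n : (1 <= s)%N -> measurable_fun setT (block y s n).
Proof.
move=> s1 _ B mB; rewrite setTI; apply: (filtration_measurable y_dens (m := (s + n)%N)).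
by apply: filtration_block.
Qed.

Lemma integral_block_shift n m E (F : 'M[R]_(K, n) -> \bar R) :
  filtration y m E -> measurable_fun setT F -> (forall M, 0 <= F M) ->
  \int[Pinf]_(w in E) F (block y m.+1 n w) =
  Pinf E * \int[Pinf]_w F (block y 1 n w).
Proof.
move=> FE mF F0; have mE := filtration_measurable y_dens FE.
have PE : Pinf E < +oo by rewrite ltey_eq fin_num_measure.
pose k := NngNum (fine_ge0 (measure_ge0 Pinf E)).
have kE : k%:num%:E = Pinf E by rewrite /= fineK// fin_num_measure.
pose nu : {finite_measure set Omega -> \bar R} := mfrestr mE PE.
have m1E : measurable_fun setT (fun w => (\1_E w : R)%:E).
  by apply/measurable_EFinP; exact: measurable_indic.
have mb s : (1 <= s)%N -> measurable_fun setT (block y s n) by exact: measurable_block.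
have mFb s : (1 <= s)%N -> measurable_fun setT (fun w => F (block y s n w)).
  by move=> s1; apply: (measurableT_comp mF); exact: mb.
transitivity (\int[nu]_w F (block y m.+1 n w)).
  have i0 w : 0 <= (\1_E w : R)%:E by rewrite lee_fin.
  have nuE C : measurable C -> nu C = \int[Pinf]_(w in C) (\1_E w : R)%:E.
    by move=> mC; rewrite /nu /mfrestr/= /mrestr integral_indic// setIC.
  rewrite (density_integral m1E i0 nuE)//; last exact: (mFb m.+1).
  rewrite integral_mkcond; apply: eq_integral => w _.
  by rewrite patchE indicE; case: ifP => _; rewrite ?mule1 ?mule0.
pose b s (s1 : (1 <= s)%N) : {mfun Omega >-> 'M[R]_(K, n)} :=
  HB.pack_for {mfun Omega >-> 'M[R]_(K, n)} (block y s n)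
  (isMeasurableFun.Build _ _ _ _ _ (mb s s1)).
pose mu1 : {measure set 'M[R]_(K, n) -> \bar R} := distribution Pinf (b 1%N isT).
transitivity (\int[mscale k mu1]_M F M); last first.
  rewrite ge0_integral_mscale// kE; congr (_ * _).
  by rewrite ge0_integral_distribution.
have := ge0_integral_pushforward (mb m.+1 isT) nu measurableT mF (fun M _ => F0 M).
rewrite preimage_setT => <-.
apply: eq_measure_integral => [|? C mC _]; first exact: (mb m.+1 isT).
rewrite [RHS](_ : _ = k%:num%:E * Pinf (block y 1 n @^-1` C))// kE.
rewrite -(block_shift y_dens y_ind FE mC).
by rewrite /pushforward /mfrestr/= /mrestr setIC.
Qed.

End shift_integral.

Lemma measurable_param_tail (R : realType) K d (T : measurableType d) (rho : R)
    (h : T -> 'cV[R]_K -> \bar R) :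
  measurable_fun setT (fun z : T * 'cV[R]_K => h z.1 z.2) ->
  measurable_fun setT (fun z : T * 'cV[R]_K => tail rho (h z.1) z.2).
Proof.
move=> mh; apply: measurable_fun_ifT => //.
by apply: measurable_fun_ler => //; apply: measurable_dot; exact: measurable_snd.
Qed.

Section measurable_comparison.
Context d (T : measurableType d) (R : realType) (f g : T -> R).
Hypotheses (mf : measurable_fun setT f) (mg : measurable_fun setT g).

Lemma measurable_set_lt : measurable [set x | f x < g x].
Proof.
have := measurable_fun_ltr mf mg measurableT (_ : measurable [set true]).
by rewrite setTI; exact.
Qed.

Lemma measurable_set_le : measurable [set x | f x <= g x].
Proof.
have := measurable_fun_ler mf mg measurableT (_ : measurable [set true]).
by rewrite setTI; exact.
Qed.

End measurable_comparison.

(** * Probability of no alarm [n] steps after the change *)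

Section delay_tail.
Local Open Scope ereal_scope.
Context (R : realType) (K : nat) d (Omega : measurableType d).
Local Notation V := ('cV[R]_K).
Local Notation lam := (@lebesgue_mx R K 1).
Variables (Pinf : probability Omega R) (phi : V -> R) (y : nat -> Omega -> V).
Hypotheses
  (y_dens : forall t, (1 <= t)%N -> has_density Pinf (y t) phi)
  (y_ind : mutually_independent Pinf [set t | (1 <= t)%N] (fun t => sigma_vec (y t))).
Variables (A : 'M[R]_K) (g : V -> R) (f : V -> \bar R).
Hypotheses (mg : measurable_fun setT g) (g0 : forall x, (0 <= g x)%R).
Hypothesis g1 : \int[lam]_x (g x)%:E = 1.
Hypotheses (mf : measurable_fun setT f) (f0 : forall x, 0 <= f x).
Hypothesis phiB : forall x y, phi (y - x) = (phi y * expo x y)%R.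
Hypothesis phi1 : \int[lam]_x (phi x)%:E = 1.
Variable LR : seq V -> R.
Hypotheses (LRE : forall ys, Lam A g f ys = (LR ys)%:E).
Hypotheses (LR_gt0 : forall ys, (0 < LR ys)%R).
Local Notation lr := (lik y LR).
Variables (P1 Pt : probability Omega R) (m : nat).
Hypothesis com1 : forall n E, filtration y n E ->
  P1 E = \int[Pinf]_(w in E) (lr 1 n w)%:E.
Hypothesis comt : forall n E, filtration y (m + n) E ->
  Pt E = \int[Pinf]_(w in E) (lr m.+1 n w)%:E.
Variables (c T r2 rho : R) (k n : nat).
Hypotheses (c0 : (0 < c)%R) (kn : (k <= n)%N).
Hypothesis dichotomy : forall xs ys zs, size ys = k ->
  (forall i, (i < size xs)%N -> (LR (take i.+1 xs) <= expR c * LR (take i xs))%R) ->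
  (forall y, y \in ys -> (dot y y <= r2)%R) ->
  (LR (xs ++ ys ++ zs) <= expR c * LR (xs ++ ys))%R ->
  (LR (ys ++ zs) <= T)%R \/
  Lam A g f (ys ++ zs) <= 2%:E * Lam A g (tail rho (alpha A g f ys)) zs.

Definition big_obs : set Omega :=
  [set w | exists2 i, (1 <= i <= k)%N & (r2 < dot (y i w) (y i w))%R].

Definition low_lik : set Omega := [set w | (lr 1 n w <= T)%R].

(** In the model, the probability that the state [k] steps after a change at time 1 lies outside the
    ball, expressed with the filter under white noise. *)
Definition mean_tail : \bar R := \int[Pinf]_w \int[lam]_x
  tail rho (alpha A g f [seq y t w | t <- iota 1 k]) x.

Let cols j (M : 'M[R]_(K, j)) := [seq col i M | i <- enum 'I_j].

Let cols_block s j w : cols (block y s j w) = [seq y t w | t <- iota s j].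
Proof.
rewrite /cols -{2}(addn0 s) iotaDl -val_enum_ord -!map_comp.
apply: eq_map => i /=; apply/matrixP => i1 i2.
by rewrite !mxE (ord1 i2).
Qed.

Let measurable_col j (i : 'I_j) : measurable_fun setT (fun M : 'M[R]_(K, j) => col i M).
Proof.
apply/measurable_fun_mxP => i1 i2.
by apply: (eq_measurable_fun (fun M : 'M[R]_(K, j) => M i1 i));
  [move=> M _; rewrite mxE|exact: measurable_entry].
Qed.

Let Bad : set 'M[R]_(K, n) :=
  [set M | exists2 j : 'I_n, (j < k)%N & (r2 < dot (col j M) (col j M))%R]
  `|` [set M | (lik_mx LR M <= T)%R].

Let mBad : measurable Bad.
Proof.
apply: measurableU; last first.
  have ml : measurable_fun setT (@lik_mx _ _ LR n).
    exact: (measurable_lik_mx mg g0 mf f0 LRE).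
  exact: (measurable_set_le ml (measurable_cst T)).
rewrite (_ : [set M | _] = \bigcup_(j in [set j : 'I_n | (j < k)%N])
    [set M | (r2 < dot (col j M) (col j M))%R]); last first.
  by apply/seteqP; split=> M [j jk Mj]; exists j.
apply: fin_bigcup_measurable => // j _.
have md : measurable_fun setT (fun M : 'M[R]_(K, n) => dot (col j M) (col j M)).
  by apply: measurable_dot; exact: measurable_col.
exact: (measurable_set_lt (measurable_cst r2) md).
Qed.

Let Bad_block w : Bad (block y 1 n w) -> big_obs w \/ low_lik w.
Proof.
move=> [[j jk Mj]|]; last by rewrite /= (lik_mx_block y); right.
left; exists (1 + j)%N; first by rewrite add1n.
rewrite (_ : y (1 + j)%N w = col j (block y 1 n w))//.
by apply/matrixP => i1 i2; rewrite !mxE (ord1 i2).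
Qed.

Let F1 M := (lik_mx LR M)%:E * (\1_Bad M)%:E.

Let mF1 : measurable_fun setT F1.
Proof.
apply: emeasurable_funM; apply/measurable_EFinP; last exact: measurable_indic.
exact: (measurable_lik_mx mg g0 mf f0 LRE).
Qed.

Let F1_ge0 M : 0 <= F1 M.
Proof. by rewrite mule_ge0// lee_fin//; exact/ltW/LR_gt0. Qed.

Let F2 (M : 'M[R]_(K, k)) := \int[lam]_x tail rho (alpha A g f (cols M)) x.

Let alpha_ge0' ys x : 0 <= alpha A g f ys x.
Proof. exact: alpha_ge0. Qed.

Let tail0 ys x : 0 <= tail rho (alpha A g f ys) x.
Proof. by rewrite /tail; case: ifP. Qed.

Let mF2 : measurable_fun setT F2.
Proof.
have mc : measurable_fun setT (fun z : 'M[R]_(K, k) * V => alpha A g f (cols z.1) z.2).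
  apply: (@measurable_param_alpha _ _ A g mg g0 _ 'M[R]_(K, k) _
    (fun j M => col j M) (enum 'I_k) (fun _ => f)) => //.
    by move=> j _; exact: measurable_col.
  exact: (measurableT_comp mf measurable_snd).
have mt := @measurable_param_tail R K _ 'M[R]_(K, k) rho
  (fun M => alpha A g f (cols M)) mc.
exact: (@measurable_param_integral _ _ _ 'M[R]_(K, k)
  (fun M => tail rho (alpha A g f (cols M))) mt (fun M => tail0 (cols M))).
Qed.

Let ysw w := [seq y t w | t <- iota m.+1 k].
Let zsw w := [seq y t w | t <- iota (m + k).+1 (n - k)].
Let G w := Lam A g (tail rho (alpha A g f (ysw w))) (zsw w).

Let G_ge0 w : 0 <= G w.
Proof. by apply: Lam_ge0 => // x; exact: tail0. Qed.

Let mtail : measurable_fun setT (fun z : filtrationType y (m + k) * V =>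
  tail rho (alpha A g f (ysw z.1)) z.2).
Proof.
apply: (@measurable_param_tail R K _ (filtrationType y (m + k)) rho
  (fun w => alpha A g f (ysw w))).
apply: (@measurable_param_alpha _ _ A g mg g0 _ (filtrationType y (m + k)) _
    (fun t w => y t w) (iota m.+1 k) (fun _ => f)) => //.
  move=> t; rewrite mem_iota => /andP[mt tm].
  have tmk : (1 <= t <= m + k)%N by rewrite (leq_ltn_trans _ mt).
  exact: measurable_filtration_y.
exact: (measurableT_comp mf measurable_snd).
Qed.

Let mG : measurable_fun setT G.
Proof.
apply: (@measurable_param_Lam _ _ A g mg g0 _ Omega _
    (fun t w => y t w) (iota (m + k).+1 (n - k)) (fun w => tail rho (alpha A g f (ysw w)))) => //.
- move=> t; rewrite mem_iota => /andP[mt tm].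
  by have [] := y_dens (leq_ltn_trans (leq0n _) mt).
- apply: (@measurable_param_tail R K _ Omega rho (fun w => alpha A g f (ysw w))).
  apply: (@measurable_param_alpha _ _ A g mg g0 _ Omega _
    (fun t w => y t w) (iota m.+1 k) (fun _ => f)) => //.
    move=> t; rewrite mem_iota => /andP[mt tm].
    by have [] := y_dens (leq_ltn_trans (leq0n _) mt).
  exact: (measurableT_comp mf measurable_snd).
Qed.

Let int_G E : filtration y m E -> \int[Pinf]_(w in E) G w = Pinf E * mean_tail.
Proof.
move=> FE.
have FE' : filtration y (m + k) E by apply: sub_filtration FE; exact: leq_addr.
rewrite (Lam_martingale y_dens y_ind A mg g0 g1 phiB phi1 (n - k) FE' mtail
  (fun w => tail0 (ysw w))).
transitivity (\int[Pinf]_(w in E) F2 (block y m.+1 k w)).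
  by apply: eq_integral => w _; rewrite /F2 cols_block.
rewrite (integral_block_shift y_dens y_ind FE mF2); last first.
  by move=> M; apply: integral_ge0 => x _; exact: tail0.
by congr (_ * _); apply: eq_integral => w _; rewrite /F2 cols_block.
Qed.

Lemma measurable_big_obs : measurable big_obs.
Proof.
rewrite (_ : big_obs = \bigcup_(i in [set i | (1 <= i <= k)%N])
    [set w | (r2 < dot (y i w) (y i w))%R]); last first.
  by apply/seteqP; split=> w [i ik wi]; exists i.
apply: bigcup_measurable => i /= /andP[i1 _].
have [my _ _ _] := y_dens i1.
have md := measurable_dot my my.
exact: (measurable_set_lt (measurable_cst r2) md).
Qed.

Lemma measurable_low_lik : measurable low_lik.
Proof.
have ml : measurable_fun setT (lr 1 n) by exact: (measurable_lik y_dens mg g0 mf f0 LRE).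
exact: (measurable_set_le ml (measurable_cst T)).
Qed.

Let int_F1 : \int[Pinf]_w F1 (block y 1 n w) <= P1 big_obs + P1 low_lik.
Proof.
have FB : filtration y n (block y 1 n @^-1` Bad) by exact: filtration_block.
have -> : \int[Pinf]_w F1 (block y 1 n w) = P1 (block y 1 n @^-1` Bad).
  rewrite (com1 FB) [RHS]integral_mkcond; apply: eq_integral => w _.
  rewrite /F1 patchE indicE lik_mx_block.
  have -> : (w \in block y 1 n @^-1` Bad) = (block y 1 n w \in Bad).
    by apply/idP/idP => /set_mem ?; exact/mem_set.
  by case: ifP => _; rewrite ?mule1 ?mule0.
apply: le_trans (measureU2 P1 measurable_big_obs measurable_low_lik); apply: le_measure; rewrite ?inE.
- exact: (filtration_measurable y_dens FB).
- exact: (measurableU _ _ measurable_big_obs measurable_low_lik).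
- exact: Bad_block.
Qed.

Local Notation run := (run (lr 1) c).

Let run_lik i j w : run i w -> (j <= i)%N -> forall l, (l <= j)%N ->
  (lr 1 j w <= expR c * lr 1 l w)%R.
Proof.
case: j => [|j] wr ji l.
  rewrite leqn0 => /eqP ->; rewrite ler_peMl//; first exact/ltW/LR_gt0.
  by rewrite -expR0 ler_expR ltW.
move=> lj; have /(cstat_lt _ _ _ c0)/(_ l lj) := wr j.+1 ji.
rewrite -ln_div ?posrE; [|exact: LR_gt0|exact: LR_gt0] => /ltW lc.
rewrite -ler_pdivrMr; last exact: LR_gt0.
rewrite -ler_ln ?posrE ?expR_gt0 ?expRK//.
by rewrite divr_gt0//; exact: LR_gt0.
Qed.

Let take_obs s j i w : (i <= j)%N ->
  take i [seq y t w | t <- iota s j] = [seq y t w | t <- iota s i].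
Proof. by move=> ij; rewrite -map_take take_iota (minn_idPl ij). Qed.

(** If a burn-in observation is large or the likelihood low, the block is in [Bad] and [F1] is the
    likelihood itself; otherwise the dichotomy leaves the tail term [G]. Neither bound involves the
    observations up to [m]. *)
Let lik_le w : run (m + n) w -> (lr m.+1 n w)%:E <= F1 (block y m.+1 n w) + 2%:E * G w.
Proof.
move=> wr; pose xs := [seq y t w | t <- iota 1 m].
have yzE : ysw w ++ zsw w = [seq y t w | t <- iota m.+1 n].
  by rewrite -map_cat -addSn -iotaD subnKC.
have [|big] := pselect (forall z, z \in ysw w -> (dot z z <= r2)%R); last first.
  have H : Bad (block y m.+1 n w).
    left; apply: contrapT => nb; apply: big => _ /mapP[t + ->].
    rewrite mem_iota => /andP[mt tm]; rewrite leNgt; apply/negP => ry; apply: nb.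
    have tn : (t - m.+1 < n)%N by rewrite ltn_subLR// (leq_trans tm)// leq_add2l.
    exists (Ordinal tn); first by rewrite /= ltn_subLR.
    rewrite (_ : col _ _ = y t w)//; apply/matrixP => i1 i2.
    by rewrite !mxE (ord1 i2)/= subnKC.
  rewrite /F1 indicE mem_set// mule1 lik_mx_block leeDl// mule_ge0//.
have := @dichotomy xs (ysw w) (zsw w).
rewrite size_map size_iota => /(_ erefl) dic sm.
have [| |low|] := dic _ sm _.
- rewrite size_map size_iota => i im.
  rewrite !take_obs//; last exact: ltnW.
  by apply: (run_lik wr) => //; rewrite (leq_trans im)// leq_addr.
- have -> : xs ++ ysw w ++ zsw w = [seq y t w | t <- iota 1 (m + n)].
    by rewrite yzE iotaD map_cat.
  have -> : xs ++ ysw w = [seq y t w | t <- iota 1 (m + k)].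
    by rewrite iotaD map_cat.
  apply: (run_lik wr); first by rewrite leqnn.
  by rewrite leq_add2l.
- have H : Bad (block y m.+1 n w).
    by right; rewrite /= lik_mx_block; rewrite yzE in low.
  by rewrite /F1 indicE mem_set// mule1 lik_mx_block leeDl// mule_ge0.
- rewrite yzE LRE => /le_trans; apply.
  by rewrite leeDr.
Qed.

(** [E] belongs to the past and the bounding functions to the later observations, so [Pinf E]
    factors out. Stationarity moves the block to time 1, where [F1] integrates to a
    [P1]-probability, and the martingale property removes the observations after the burn-in from
    [G]. *)
Lemma delay_tail E : filtration y m E ->
  Pt (E `&` run (m + n)) <= Pinf E * (P1 big_obs + P1 low_lik + 2%:E * mean_tail).
Proof.
move=> FE; have mE := filtration_measurable y_dens FE.
have FR : filtration y (m + n) (E `&` run (m + n)).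
  apply: filtrationI; first by apply: sub_filtration FE; exact: leq_addr.
  exact: (filtration_run mg g0 mf f0 LRE).
have mR := filtration_measurable y_dens FR.
have mF1b : measurable_fun setT (fun w => F1 (block y m.+1 n w)).
  by apply: (measurableT_comp mF1); exact: (measurable_block y_dens).
rewrite (comt FR).
apply: (@le_trans _ _ (\int[Pinf]_(w in E `&` run (m + n))
    (F1 (block y m.+1 n w) + 2%:E * G w))).
  apply: ge0_le_integral => //.
  - by move=> w _; rewrite lee_fin; exact/ltW/LR_gt0.
  - apply: measurable_funTS; apply/measurable_EFinP.
    exact: (measurable_lik y_dens mg g0 mf f0 LRE).
  - apply: measurable_funTS; apply: emeasurable_funD => //.
    exact: measurable_funeM.
  - by move=> w [_ wr]; exact: lik_le.
have mFG : measurable_fun setT (fun w => F1 (block y m.+1 n w) + 2%:E * G w).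
  by apply: emeasurable_funD => //; exact: measurable_funeM.
have G20 w : 0 <= 2%:E * G w by rewrite mule_ge0.
apply: (@le_trans _ _ (\int[Pinf]_(w in E) (F1 (block y m.+1 n w) + 2%:E * G w))).
  apply: ge0_subset_integral => //; first exact: measurable_funTS.
  by move=> w _; rewrite adde_ge0.
rewrite ge0_integralD//; last 2 first.
- exact: measurable_funTS.
- by apply: measurable_funTS; exact: measurable_funeM.
rewrite ge0_integralZl//; last exact: measurable_funTS.
rewrite int_G// (integral_block_shift y_dens y_ind FE mF1 F1_ge0).
rewrite muleCA -ge0_muleDr//.
- by apply: lee_wpmul2l => //; apply: leeD2r; exact: int_F1.
- by apply: integral_ge0 => w _; exact: F1_ge0.
- rewrite mule_ge0//; apply: integral_ge0 => w _; apply: integral_ge0 => x _.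
  exact: tail0.
Qed.

End delay_tail.

Lemma small_decreasing d (T : measurableType d) (R : realType)
    (mu : {measure set T -> \bar R}) (C : nat -> set T) (e : R) :
  (mu (C 0%N) < +oo)%E -> (forall i, measurable (C i)) ->
  (forall i j, (i <= j)%N -> C j `<=` C i) -> mu (\bigcap_n C n) = 0%E -> 0 < e ->
  exists N, forall n, (N <= n)%N -> (mu (C n) < e%:E)%E.
Proof.
move=> C0 mC dC muC e0.
have mI : measurable (\bigcap_n C n) by exact: bigcap_measurable.
have [| |N _ NP] := @nonincreasing_cvg_mu _ _ _ mu C C0 mC mI _ [set x | (x < e%:E)%E].
- by move=> i j ij; apply/subsetPset; exact: dC.
- rewrite muC; apply: open_nbhs_nbhs; split; last by rewrite /= lte_fin.
  exact: open_ereal_lt_ereal.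
- by exists N.
Qed.

Section geometric_bound.
Context (R : realType).

Lemma sum_weights_le (r e B : R) N M n : 0 < r < 1 -> 0 <= e -> 0 <= B ->
  \sum_(i < n) (if (i < N)%N then 1 else if (i < M)%N then e else B * r ^+ (i - M))
    <= N%:R + M%:R * e + B / (1 - r).
Proof.
move=> /andP[r0 r1] e0 B0; have r1' : 0 < 1 - r by rewrite subr_gt0.
pose a i : R := (i < N)%N%:R; pose b i : R := (i < M)%N%:R * e.
pose g i : R := if (i < M)%N then 0 else r ^+ (i - M).
have sa k : \sum_(i < k) a i <= (minn k N)%:R.
  elim: k => [|k IH]; first by rewrite big_ord0.
  rewrite big_ord_recr/= /a; move: IH; case: (ltnP k N) => kN IH.
    by rewrite (minn_idPl kN) -natr1 lerD2r.
  by rewrite addr0 (minn_idPr (leqW kN)).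
have sb k : \sum_(i < k) b i <= (minn k M)%:R * e.
  elim: k => [|k IH]; first by rewrite big_ord0 min0n mul0r.
  rewrite big_ord_recr/= /b; move: IH; case: (ltnP k M) => kN IH.
    by rewrite (minn_idPl kN) -natr1 mulrDl lerD2r.
  by rewrite mul0r addr0 (minn_idPr (leqW kN)).
(* Adding the part of the geometric series still to come makes the induction close. *)
have sg k : \sum_(i < k) g i + r ^+ (k - M) / (1 - r) <= (1 - r)^-1.
  elim: k => [|k IH]; first by rewrite big_ord0 add0r sub0n expr0 mul1r.
  rewrite big_ord_recr/= /g; move: IH; case: (ltnP k M) => kM IH.
    rewrite addr0; apply: le_trans IH.
    by rewrite (eqP (_ : k - M == 0)%N) ?subn_eq0 1?ltnW// (eqP (_ : k.+1 - M == 0)%N) ?subn_eq0.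
  rewrite -addrA; apply: le_trans IH; rewrite lerD2l subSn// exprS.
  have -> : r ^+ (k - M) + r * r ^+ (k - M) / (1 - r) = r ^+ (k - M) / (1 - r).
    by field; rewrite gt_eqF.
  exact: lexx.
apply: (@le_trans _ _ (\sum_(i < n) (a i + b i + B * g i))).
  apply: ler_sum => i _; rewrite /a /b /g.
  case: ltnP => _; case: ltnP => _; rewrite ?mul0r ?mul1r ?addr0 ?add0r//.
  - by rewrite mulr0 addr0 lerDl.
  - by rewrite lerDl mulr_ge0// exprn_ge0// ltW.
  - by rewrite mulr0 addr0.
rewrite !big_split/=; apply: lerD; first apply: lerD.
- by apply: (le_trans (sa n)); rewrite ler_nat geq_minr.
- by apply: (le_trans (sb n)); rewrite ler_wpM2r// ler_nat geq_minr.
- rewrite -mulr_sumr ler_wpM2l//; apply: le_trans (sg n).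
  by rewrite lerDl mulr_ge0 ?invr_ge0 ?exprn_ge0 ?ltW.
Qed.

End geometric_bound.

(** * Bounds for the burn-in observations and for the state *)

Section estimates.
Local Open Scope ereal_scope.
Context (R : realType) (K : nat) d (Omega : measurableType d).
Local Notation V := ('cV[R]_K).
Local Notation lam := (@lebesgue_mx R K 1).
Variables (Pinf : probability Omega R) (phi : V -> R) (y : nat -> Omega -> V).
Hypotheses
  (y_dens : forall t, (1 <= t)%N -> has_density Pinf (y t) phi)
  (y_ind : mutually_independent Pinf [set t | (1 <= t)%N] (fun t => sigma_vec (y t))).
Variables (A : 'M[R]_K) (g : V -> R) (f : V -> \bar R).
Hypotheses (mg : measurable_fun setT g) (g0 : forall x, (0 <= g x)%R).
Hypothesis g1 : \int[lam]_x (g x)%:E = 1.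
Hypotheses (mf : measurable_fun setT f) (f0 : forall x, 0 <= f x).
Hypothesis phiB : forall x y, phi (y - x) = (phi y * expo x y)%R.
Hypothesis phi1 : \int[lam]_x (phi x)%:E = 1.
Variable LR : seq V -> R.
Hypotheses (LRE : forall ys, Lam A g f ys = (LR ys)%:E).
Hypotheses (LR_gt0 : forall ys, (0 < LR ys)%R).
Local Notation lr := (lik y LR).
Variable P1 : probability Omega R.
Hypothesis com1 : forall n E, filtration y n E ->
  P1 E = \int[Pinf]_(w in E) (lr 1 n w)%:E.

Lemma big_obs_small k (e : R) : (0 < e)%R ->
  exists2 r2 : R, (0 <= r2)%R & P1 (big_obs y r2 k) < e%:E.
Proof.
move=> e0.
have [||||N NP] := @small_decreasing _ _ _ P1 (fun n => big_obs y n%:R k) e _ _ _ _ e0.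
- by rewrite ltey_eq fin_num_measure//; exact: (measurable_big_obs y_dens).
- by move=> i; exact: (measurable_big_obs y_dens).
- move=> i j ij w [l lk wl]; exists l => //; apply: le_lt_trans wl.
  by rewrite ler_nat.
- rewrite (_ : \bigcap_n _ = set0) ?measure0//; apply/seteqP; split=> // w H.
  pose s := (\sum_(i < k.+1) dot (y i w) (y i w))%R.
  have [i /andP[i1 ik]] := H (Num.truncn s).+1 I.
  apply/negP; rewrite -leNgt; apply: (@le_trans _ _ s); last exact/ltW/truncnS_gt.
  have ik1 : (i < k.+1)%N by [].
  rewrite /s (bigD1 (Ordinal ik1))//= lerDl; apply: sumr_ge0 => j _.
  exact: dot_ge0.
- by exists N%:R => //; exact: NP.
Qed.

(** By Tonelli the quantity is the mass outside a ball of a measure whose density is the averaged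
    filter; this measure has mass one because the likelihood ratio has mean 1 under white noise. *)
Lemma mean_tail_small k (e : R) : (0 < e)%R ->
  exists2 rho : R, (0 <= rho)%R & mean_tail Pinf y A g f rho k < e%:E.
Proof.
move=> e0.
pose a w x := alpha A g f [seq y t w | t <- iota 1 k] x.
have a0 w x : 0 <= a w x by exact: alpha_ge0.
have ma : measurable_fun setT (fun z : Omega * V => a z.1 z.2).
  apply: (@measurable_param_alpha _ _ A g mg g0 _ Omega _
    (fun t w => y t w) (iota 1 k) (fun _ => f)) => //.
    by move=> t; rewrite mem_iota => /andP[/y_dens[]].
  exact: (measurableT_comp mf measurable_snd).
pose h x := \int[Pinf]_w a w x.
have mh : measurable_fun setT h.
  exact: (measurable_fun_fubini_tonelli_G (m1 := Pinf) (fun z : Omega * V => a z.1 z.2)).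
have h0 x : 0 <= h x by apply: integral_ge0.
have [Q QE] := ex_density_measure lam mh h0.
pose C n := [set x : V | (n%:R < dot x x)%R].
have md : measurable_fun setT (fun x : V => dot x x) by exact: measurable_dot.
have mC n : measurable (C n) by exact: (measurable_set_lt (measurable_cst (n%:R : R)%R) md).
have tailE rho : mean_tail Pinf y A g f rho k = Q [set x | (rho < dot x x)%R].
  rewrite QE /mean_tail.
  rewrite (fubini_tonelli (m1 := Pinf) (m2 := lam)
    (fun z : Omega * V => tail rho (a z.1) z.2))/=; last 2 first.
  - exact: (@measurable_param_tail R K _ Omega rho a ma).
  - by move=> z; rewrite /tail; case: ifP.
  rewrite [RHS]integral_mkcond; apply: eq_integral => x _.
  rewrite patchE /tail; case: (leP (dot x x) rho) => xr.
    by rewrite integral0 memNset//; apply/negP; rewrite -leNgt.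
  by rewrite mem_set.
have QT : Q setT = 1.
  rewrite QE -(fubini_tonelli (m1 := Pinf) (m2 := lam) (fun z : Omega * V => a z.1 z.2))//=.
  transitivity (\int[Pinf]_w (lr 1 k w)%:E).
    by apply: eq_integral => w _; rewrite -LRE LamE.
  rewrite -com1; last exact: filtrationT.
  exact: probability_setT.
have [|||N NP] := @small_decreasing _ _ _ Q C e _ mC _ _ e0.
- apply: (@le_lt_trans _ _ 1); last exact: ltry.
  by rewrite -QT; apply: le_measure; rewrite ?inE.
- by move=> i j ij x; apply: le_lt_trans; rewrite ler_nat.
- rewrite (_ : \bigcap_n _ = set0) ?measure0//; apply/seteqP; split=> // x H.
  by have := H (Num.truncn (dot x x)).+1 I; rewrite /C/= ltNge ltW// truncnS_gt.
- by exists N%:R => //; rewrite tailE; exact: NP.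
Qed.

End estimates.

(** * Lower tail of the likelihood ratio after a change *)

Section low_likelihood.
Local Open Scope ereal_scope.
Context (R : realType) (K : nat) d (Omega : measurableType d).
Local Notation V := ('cV[R]_K).
Local Notation lam := (@lebesgue_mx R K 1).
Variables (Pinf : probability Omega R) (phi : V -> R) (y : nat -> Omega -> V).
Hypotheses
  (y_dens : forall t, (1 <= t)%N -> has_density Pinf (y t) phi)
  (y_ind : mutually_independent Pinf [set t | (1 <= t)%N] (fun t => sigma_vec (y t))).
Variables (A : 'M[R]_K) (g : V -> R) (f : V -> \bar R).
Hypotheses (mg : measurable_fun setT g) (g0 : forall x, (0 <= g x)%R).
Hypotheses (mf : measurable_fun setT f) (f0 : forall x, 0 <= f x).
Variable LR : seq V -> R.
Hypotheses (LRE : forall ys, Lam A g f ys = (LR ys)%:E).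
Hypotheses (LR_gt0 : forall ys, (0 < LR ys)%R).
Local Notation lr := (lik y LR).
Variable P1 : probability Omega R.
Hypothesis com1 : forall n E, filtration y n E ->
  P1 E = \int[Pinf]_(w in E) (lr 1 n w)%:E.

Let mlr n : measurable_fun setT (lr 1 n).
Proof. exact: (measurable_lik y_dens mg g0 mf f0 LRE). Qed.

Let lr0 n w : (0 < lr 1 n w)%R. Proof. exact: LR_gt0. Qed.

Let obsS n w : [seq y t w | t <- iota 1 n.+1] =
  rcons [seq y t w | t <- iota 1 n] (y n.+1 w).
Proof. by rewrite -map_rcons -cats1 -(iotaD 1 n 1) addn1. Qed.

Let lrS n w : lr 1 n.+1 w = LR (rcons [seq y t w | t <- iota 1 n] (y n.+1 w)).
Proof. by rewrite /lik obsS. Qed.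

Let msq n : measurable_fun setT (fun w => (Num.sqrt (lr 1 n w))%:E).
Proof.
apply/measurable_EFinP; apply: measurable_sqrtr_ge0 => // w; exact/ltW/lr0.
Qed.

Section sqrt_moment.
Variable b : R.
Hypothesis b0 : (0 <= b)%R.
Hypothesis ctr : forall ys y0,
  \int[lam]_z ((Num.sqrt (LR (rcons (rcons ys y0) z)))%:E * (phi z)%:E)
    <= (b * Num.sqrt (LR (rcons ys y0)))%:E.

(** The first ratio is handled by [sqrt t <= (1 + t) / 2] and its unit mean; each later observation
    gains a factor [b]. The contraction requires an earlier observation, hence the exponent [n] for
    [n.+1] observations. *)
Lemma sqrt_lik_moment n : \int[Pinf]_w (Num.sqrt (lr 1 n.+1 w))%:E <= (b ^+ n)%:E.
Proof.
elim: n => [|n IH].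
  have e0 w : 0 <= (lr 1 1 w)%:E by rewrite lee_fin; exact/ltW/lr0.
  have h0 : 0 <= (2^-1 : R)%:E by rewrite lee_fin invr_ge0.
  have mE : measurable_fun setT (fun w => (lr 1 1 w)%:E) by exact/measurable_EFinP.
  have E1 : \int[Pinf]_w (2^-1%:E + 2^-1%:E * (lr 1 1 w)%:E) = 1.
    rewrite ge0_integralD//; last 2 first.
    - by move=> w _; exact: mule_ge0.
    - exact: measurable_funeM.
    rewrite ge0_integralZl// integral_cst// [X in _ * X + _]probability_setT mule1.
    rewrite -com1; last exact: filtrationT.
    by rewrite probability_setT mule1 -EFinD -[RHS]/(1%R%:E); congr EFin; field.
  rewrite expr0 -[leRHS]E1; apply: ge0_le_integral => //.
  - by apply: emeasurable_funD => //; exact: measurable_funeM.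
  - move=> w _; rewrite -EFinM -EFinD lee_fin.
    have := sqr_ge0 (Num.sqrt (lr 1 1 w) - 1)%R.
    rewrite sqrrB sqr_sqrtr; last exact/ltW/lr0.
    rewrite mulr1 expr1n; lra.
pose F w z : \bar R := (Num.sqrt (LR (rcons [seq y t w | t <- iota 1 n.+1] z)))%:E.
have mF : measurable_fun setT (fun z : filtrationType y n.+1 * V => F z.1 z.2).
  apply/measurable_EFinP; apply: measurable_sqrtr_ge0 => [|z]; last exact/ltW/LR_gt0.
  apply/measurable_EFinP.
  pose Y (o : option nat) (z : filtrationType y n.+1 * V) :=
    if o is Some t then y t z.1 else z.2.
  pose s := rcons (map Some (iota 1 n.+1)) None.
  apply: (eq_measurable_fun (fun z => Lam A g f [seq Y o z | o <- s])).
    by move=> z _; rewrite LRE /s map_rcons -map_comp.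
  apply: (@measurable_param_Lam _ _ A g mg g0 _ (filtrationType y n.+1 * V)%type _
    Y s (fun _ => f)) => //.
    move=> o; rewrite mem_rcons inE => /orP[/eqP ->|/mapP[t + ->]].
      exact: measurable_snd.
    rewrite mem_iota => /andP[t1 tn].
    have tn1 : (1 <= t <= n.+1)%N by rewrite t1.
    exact: (measurableT_comp (measurable_filtration_y tn1) measurable_fst).
  exact: (measurableT_comp mf measurable_snd).
have F0 w z : 0 <= F w z by rewrite lee_fin.
have [_ mphi phi0 _] := y_dens (isT : (1 <= 1)%N).
apply: (@le_trans _ _ (\int[Pinf]_w (b%:E * (Num.sqrt (lr 1 n.+1 w))%:E))).
  rewrite (eq_integral (fun w => F w (y n.+2 w))); last by move=> w _; rewrite lrS.
  rewrite (indep_integral_filtration y_dens y_ind mF F0).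
  apply: ge0_le_integral => //.
  - by move=> w _; apply: integral_ge0 => z _; rewrite mule_ge0// lee_fin.
  - have mFphi : measurable_fun setT (fun z : filtrationType y n.+1 * V =>
        F z.1 z.2 * (phi z.2)%:E).
      apply: emeasurable_funM => //; apply/measurable_EFinP.
      exact: (measurableT_comp mphi measurable_snd).
    have Fp0 (w : filtrationType y n.+1) z : 0 <= F w z * (phi z)%:E.
      by rewrite mule_ge0// lee_fin.
    have mI := @measurable_param_integral _ _ _ (filtrationType y n.+1)
      (fun w z => F w z * (phi z)%:E) mFphi Fp0.
    move=> _ B mB; rewrite setTI; apply: (filtration_measurable y_dens (m := n.+1)).
    by have := mI measurableT B mB; rewrite setTI.
  - by apply: measurable_funeM.
  - move=> w _; rewrite -EFinM /F lrS.
    by under eq_integral do rewrite obsS; exact: ctr.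
rewrite ge0_integralZl//.
by rewrite exprS EFinM lee_wpmul2l// lee_fin.
Qed.

(** Markov inequality with exponent one half: on the event the likelihood is at most [Num.sqrt T]
    times its own square root. *)
Lemma low_lik_le n (T : R) : (0 <= T)%R ->
  P1 (low_lik y LR T n.+1) <= (Num.sqrt T * b ^+ n)%:E.
Proof.
move=> T0.
have mlow := measurable_low_lik y_dens mg g0 mf f0 LRE T n.+1.
have Flow : filtration y n.+1 (low_lik y LR T n.+1).
  apply: (@measurable_set_le _ (filtrationType y n.+1) _ (fun w => lr 1 n.+1 w) (fun=> T)) => //.
  exact: (measurable_lik_filtration mg g0 mf f0 LRE).
rewrite (com1 Flow) EFinM.
apply: (@le_trans _ _ (\int[Pinf]_(w in low_lik y LR T n.+1)
    ((Num.sqrt T)%:E * (Num.sqrt (lr 1 n.+1 w))%:E))).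
  apply: ge0_le_integral => //.
  - by move=> w _; rewrite lee_fin; exact/ltW/lr0.
  - by apply: measurable_funTS; exact/measurable_EFinP.
  - by apply: measurable_funTS; exact: measurable_funeM.
  - move=> w lw; rewrite -EFinM lee_fin -{1}(sqr_sqrtr (ltW (lr0 n.+1 w))) expr2.
    by rewrite ler_wpM2r ?sqrtr_ge0// ler_wsqrtr.
rewrite ge0_integralZl//; last by apply: measurable_funTS.
apply: lee_wpmul2l; first by rewrite lee_fin.
apply: le_trans (sqrt_lik_moment n); apply: ge0_subset_integral => //.
Qed.

End sqrt_moment.

(** Almost sure convergence becomes a small probability through the unions of the events over all
    [t] from [n] on, which decrease to a null set. *)
Lemma low_lik_small (kappa kappa' e : R) : (kappa' < kappa)%R -> (0 < e)%R ->
  (\forall w \ae P1, (fun t => t%:R^-1 * ln (lr 1 t w))%R @ \oo --> kappa) ->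
  exists N, forall n, (N <= n)%N ->
    P1 (low_lik y LR (expR (n%:R * kappa')) n) < e%:E.
Proof.
move=> kk e0 lim.
pose low n := low_lik y LR (expR (n%:R * kappa')) n.
have mlow n : measurable (low n).
  exact: (measurable_low_lik y_dens mg g0 mf f0 LRE).
pose C n := \bigcup_(t in [set t | (n <= t)%N]) low t.
have mC n : measurable (C n) by apply: bigcup_measurable => t _; exact: mlow.
have C0 : P1 (C 0%N) < +oo by rewrite ltey_eq fin_num_measure.
have [||N NP] := @small_decreasing _ _ _ P1 C e C0 mC _ _ e0.
- by move=> i j ij w [t /= jt wt]; exists t => //=; exact: leq_trans jt.
- apply/negligibleP; first exact: bigcap_measurable.
  apply: negligibleS lim => w Cw /= lw.
  have : \forall t \near \oo, (kappa' < t%:R^-1 * ln (lr 1 t w))%R.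
    by apply: (cvgr_gt kappa).
  move=> [N _ NP]; have [t /= tN] := Cw N.+1 I.
  rewrite /low/= /low_lik/= leNgt => /negP; apply.
  have t0 : (0 < t%:R :> R)%R by rewrite ltr0n (leq_ltn_trans _ tN).
  have := NP t (ltnW tN); rewrite /= ltr_pdivlMl// => ltk.
  by rewrite -(lnK (lr0 t w)) ltr_expR.
- exists N => n Nn; apply: le_lt_trans (NP n Nn); apply: le_measure; rewrite ?inE.
  + exact: mlow.
  + exact: mC.
  + by move=> w lw; exists n => /=.
Qed.

End low_likelihood.

(** * Summation of the no-alarm probabilities *)

Section delay_bound.
Local Open Scope ereal_scope.
Context (R : realType) (K : nat) d (Omega : measurableType d).
Local Notation V := ('cV[R]_K).
Local Notation lam := (@lebesgue_mx R K 1).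
Variables (Pinf : probability Omega R) (phi : V -> R) (y : nat -> Omega -> V).
Hypotheses
  (y_dens : forall t, (1 <= t)%N -> has_density Pinf (y t) phi)
  (y_ind : mutually_independent Pinf [set t | (1 <= t)%N] (fun t => sigma_vec (y t))).
Variables (A : 'M[R]_K) (g : V -> R) (f : V -> \bar R).
Hypotheses (mg : measurable_fun setT g) (g0 : forall x, (0 <= g x)%R).
Hypothesis g1 : \int[lam]_x (g x)%:E = 1.
Hypotheses (mf : measurable_fun setT f) (f0 : forall x, 0 <= f x).
Hypothesis phiB : forall x y, phi (y - x) = (phi y * expo x y)%R.
Hypothesis phi1 : \int[lam]_x (phi x)%:E = 1.
Variable LR : seq V -> R.
Hypotheses (LRE : forall ys, Lam A g f ys = (LR ys)%:E).
Hypotheses (LR_gt0 : forall ys, (0 < LR ys)%R) (LR_nil : LR [::] = 1%R).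
Local Notation lr := (lik y LR).
Variable P : nat -> probability Omega R.
Hypothesis com : forall t0 n E, (1 <= t0)%N -> filtration y (t0.-1 + n) E ->
  P t0 E = \int[Pinf]_(w in E) (lr t0 n w)%:E.
Variables (D p C Q theta : R).
Hypotheses (p0 : (0 <= p)%R) (Q0 : (0 <= Q)%R)
  (theta01 : (0 <= theta < 1)%R).
Hypothesis dichotomy : forall (c r2 rho : R) xs ys zs, (0 <= c)%R -> (0 <= r2)%R ->
  (0 <= rho)%R ->
  (forall i, (i < size xs)%N -> (LR (take i.+1 xs) <= expR c * LR (take i xs))%R) ->
  (forall y, y \in ys -> (dot y y <= r2)%R) ->
  (LR (xs ++ ys ++ zs) <= expR c * LR (xs ++ ys))%R ->
  (LR (ys ++ zs) <= expR (c + theta ^+ size ys * (p * c) + D +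
      (size ys)%:R * (C + r2) + Q * rho))%R \/
  Lam A g f (ys ++ zs) <= 2%:E * Lam A g (tail rho (alpha A g f ys)) zs.
Variable b : R.
Hypothesis b01 : (0 <= b < 1)%R.
Hypothesis ctr : forall ys y0,
  \int[lam]_z ((Num.sqrt (LR (rcons (rcons ys y0) z)))%:E * (phi z)%:E)
    <= (b * Num.sqrt (LR (rcons ys y0)))%:E.
Variables (Cf l : R).
Hypotheses (Cf0 : (0 <= Cf)%R) (l0 : (0 < l)%R).
Hypothesis f_tail : forall rho, (0 <= rho)%R ->
  \int[lam]_x tail rho f x <= (Cf * expR (- (l * rho)))%:E.
Variable kappa : R.
Hypothesis kappa0 : (0 < kappa)%R.
Hypothesis lim_lr :
  \forall w \ae P 1%N, (fun t => t%:R^-1 * ln (lr 1 t w))%R @ \oo --> kappa.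

Let com1 n E : filtration y n E -> P 1%N E = \int[Pinf]_(w in E) (lr 1 n w)%:E.
Proof. by move=> FE; exact: com. Qed.

Let tail_bound (c r2 rho : R) k n t0 E : (0 < c)%R -> (0 <= r2)%R -> (0 <= rho)%R ->
  (k <= n)%N -> (1 <= t0)%N -> filtration y t0.-1 E ->
  P t0 (E `&` run (lr 1) c (t0.-1 + n)) <= Pinf E *
    (P 1%N (big_obs y r2 k) + P 1%N (low_lik y LR (expR (c + theta ^+ k * (p * c) + D +
      k%:R * (C + r2) + Q * rho)) n) + 2%:E * mean_tail Pinf y A g f rho k).
Proof.
move=> c0 r20 rho0 kn t01 FE.
apply: (delay_tail y_dens y_ind mg g0 g1 mf f0 phiB phi1 LRE LR_gt0 com1) => //.
- by move=> j F FF; rewrite prednK//; exact: com.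
- by move=> xs ys zs <-; apply: dichotomy => //; exact: ltW.
Qed.

(** No burn-in, [k = 0], and a ball whose squared radius grows linearly in [n]: the threshold on the
    likelihood then grows more slowly than the Hellinger bound decays, and the tail of [f] decays
    exponentially too. *)
Let crude : exists a1 a3 A0 : R, [/\ (0 <= a1)%R, (0 < a3)%R, (0 <= A0)%R &
  forall c t0 E n, (0 < c)%R -> (1 <= t0)%N -> filtration y t0.-1 E ->
  P t0 (E `&` run (lr 1) c (t0 + n)) <=
    Pinf E * (A0 * expR (a1 * c - a3 * n%:R))%:E].
Proof.
have /andP[b0 b1] := b01.
(* The maximum excludes [b = 0], so that the rate [beta] is a genuine positive logarithm. *)
pose b' := Num.max b (2^-1)%R.
have b'0 : (0 < b')%R by rewrite lt_max invr_gt0 ltr0n orbT.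
have b'1 : (b' < 1)%R by rewrite gt_max b1 invf_lt1 ?ltr1n.
pose beta := (- ln b')%R.
have beta0 : (0 < beta)%R by rewrite oppr_gt0 ln_lt0// b'0.
(* Keeps the loss [Q * rho / 2] in the exponent below half of the gain [beta * n]. *)
pose eta := (beta / (Q + 1))%R.
have Q1 : (0 < Q + 1)%R by have := Q0; lra.
have eta0 : (0 < eta)%R by rewrite divr_gt0.
have Qeta : (Q * eta <= beta)%R.
  by rewrite /eta mulrA ler_pdivrMr// mulrDr mulr1 (mulrC Q) lerDl ltW.
pose a3 := Num.min (beta / 2)%R (l * eta)%R.
have a30 : (0 < a3)%R by rewrite lt_min divr_gt0//= mulr_gt0.
exists ((1 + p) / 2)%R, a3, (expR (D / 2) + 2 * Cf)%R; split => //.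
- by rewrite divr_ge0// addr_ge0.
- by rewrite addr_ge0 ?expR_ge0// mulr_ge0.
move=> c t0 E n c0 t01 FE.
have -> : (t0 + n = t0.-1 + n.+1)%N by rewrite addnS -addSn prednK.
have rho0 : (0 <= eta * n%:R)%R by rewrite mulr_ge0// ltW.
have := tail_bound c0 (lexx 0%R) rho0 (leq0n n.+1) t01 FE.
move=> /le_trans; apply; apply: lee_wpmul2l => //.
have -> : big_obs y 0 0 = set0.
  by apply/seteqP; split=> // w [i /andP[i1]]; rewrite leqNgt i1.
rewrite measure0 add0e expr0 mul1r mul0r addr0.
set T := expR _.
have low : P 1%N (low_lik y LR T n.+1) <=
    (expR (D / 2) * expR ((1 + p) / 2 * c - a3 * n%:R))%:E.
  have /le_trans := low_lik_le y_dens y_ind mg g0 mf f0 LRE LR_gt0 com1 b0 ctr n (expR_ge0 _ : 0 <= T)%R.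
  apply; rewrite lee_fin.
  apply: (@le_trans _ _ (expR ((c + p * c + D + Q * (eta * n%:R)) / 2) * b' ^+ n)%R).
    apply: ler_pM; rewrite ?sqrtr_ge0 ?exprn_ge0//.
      rewrite -(ler_pXn2r (ltn0Sn 1)) ?nnegrE ?sqrtr_ge0 ?expR_ge0//.
      rewrite sqr_sqrtr ?expR_ge0// -expRM_natl /T ler_expR.
      by rewrite [leRHS]mulrC divfK ?pnatr_eq0.
    by rewrite lerXn2r ?nnegrE ?(ltW b'0)// le_max lexx.
  rewrite -[b'](lnK)// -expRM_natl -!expRD ler_expR.
  have : (a3 * n%:R <= beta / 2 * n%:R)%R by rewrite ler_wpM2r// ge_min lexx.
  have : (Q * eta * n%:R <= beta * n%:R)%R by rewrite ler_wpM2r.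
  rewrite /beta; lra.
have tl : mean_tail Pinf y A g f (eta * n%:R) 0 <=
    (Cf * expR ((1 + p) / 2 * c - a3 * n%:R))%:E.
  rewrite /mean_tail /= integral_cst// [X in _ * X]probability_setT mule1.
  apply: (le_trans (f_tail rho0)); rewrite lee_fin ler_wpM2l// ler_expR.
  have : (a3 * n%:R <= l * eta * n%:R)%R by rewrite ler_wpM2r// ge_min lexx orbT.
  have : (0 <= (1 + p) / 2 * c)%R by rewrite mulr_ge0 ?divr_ge0 ?addr_ge0// ltW.
  lra.
have h2 : 0 <= (2%:R : R)%:E by rewrite lee_fin.
apply: (le_trans (leeD low (lee_wpmul2l h2 tl))).
by rewrite -EFinM -EFinD lee_fin [leRHS]mulrDl -(mulrA 2%R).
Qed.

(** Of the surplus [eps / 2 * c] above [c], one half pays for the memory of the past, through the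
    choice of [k], and the other for the constants, through [c] large. *)
Let sharp (eps e : R) : (0 < eps)%R -> (0 < e)%R ->
  exists2 c1 : R, (0 < c1)%R & forall c n t0 E, (c1 <= c)%R ->
  ((1 + eps) * c / kappa <= n%:R)%R -> (1 <= t0)%N -> filtration y t0.-1 E ->
  P t0 (E `&` run (lr 1) c (t0.-1 + n)) <= Pinf E * e%:E.
Proof.
move=> eps0 e0; have /andP[th0 th1] := theta01.
have e1 : (0 < 1 + eps)%R by rewrite addr_gt0.
(* A rate below [kappa] for which [n >= (1 + eps) c / kappa] still gives
   [n * kp >= (1 + eps / 2) c]. *)
pose kp := (kappa * (1 + eps / 2) / (1 + eps))%R.
have kpk : (kp < kappa)%R.
  rewrite /kp ltr_pdivrMr// ltr_pM2l// ltrD2l; lra.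
have kp0 : (0 < kp)%R by rewrite /kp divr_gt0// mulr_gt0// addr_gt0// divr_gt0.
have [k kP] : exists k, (theta ^+ k * p <= eps / 4)%R.
  have cv : (fun k => theta ^+ k * p)%R @ \oo --> (0 * p)%R.
    by apply: cvgM; [apply: cvg_expr; rewrite ger0_norm|exact: cvg_cst].
  have e4 : (0 * p < eps / 4)%R by rewrite mul0r divr_gt0.
  have [k _ kP] := cvgr_lt _ cv _ e4.
  by exists k; apply/ltW/kP => /=.
have e4 : (0 < e / 4)%R by rewrite divr_gt0.
have e8 : (0 < e / 8)%R by rewrite divr_gt0.
have [r2 r20 r2P] := big_obs_small y_dens (P 1%N) k e4.
have [rho rho0 rhoP] := mean_tail_small y_dens mg g0 mf f0 LRE com1 k e8.
have [N NP] := low_lik_small y_dens mg g0 mf f0 LRE LR_gt0 kpk e4 lim_lr.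
pose K0 := (D + k%:R * (C + r2) + Q * rho)%R.
(* Ensures [N <= n], [k <= n] and [K0 <= eps / 4 * c]. *)
pose c1 := (1 + N%:R * kappa + k%:R * kappa + `|K0| * 4 / eps)%R.
have Nk : (0 <= N%:R * kappa)%R by rewrite mulr_ge0// ltW.
have kk : (0 <= k%:R * kappa)%R by rewrite mulr_ge0// ltW.
have K00 : (0 <= `|K0| * 4 / eps)%R by rewrite !mulr_ge0// invr_ge0 ltW.
exists c1; first by rewrite /c1; lra.
move=> c n t0 E cc nc t01 FE.
have c0 : (0 < c)%R by move: cc; rewrite /c1; lra.
have cn : (c / kappa <= n%:R)%R.
  apply: le_trans nc; rewrite -mulrA ler_peMl ?divr_ge0 ?ltW//; lra.
have Nn : (N <= n)%N.
  rewrite -(ler_nat R); apply: le_trans cn; rewrite ler_pdivlMr//.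
  by move: cc; rewrite /c1; lra.
have kn : (k <= n)%N.
  rewrite -(ler_nat R); apply: le_trans cn; rewrite ler_pdivlMr//.
  by move: cc; rewrite /c1; lra.
apply: (le_trans (tail_bound c0 r20 rho0 kn t01 FE)); apply: lee_wpmul2l => //.
have low : P 1%N (low_lik y LR (expR (c + theta ^+ k * (p * c) + D +
    k%:R * (C + r2) + Q * rho)) n) <= (e / 4)%:E.
  apply: le_trans (ltW (NP n Nn)); apply: le_measure; rewrite ?inE.
  - exact: (measurable_low_lik y_dens mg g0 mf f0 LRE).
  - exact: (measurable_low_lik y_dens mg g0 mf f0 LRE).
  move=> w; rewrite /low_lik /= => /le_trans; apply; rewrite ler_expR.
  have h1 : ((1 + eps / 2) * c <= n%:R * kp)%R.
    have -> : ((1 + eps / 2) * c = (1 + eps) * c / kappa * kp)%R.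
      by rewrite /kp; field; rewrite !gt_eqF.
    by rewrite ler_wpM2r// ltW.
  have h2 : (theta ^+ k * (p * c) <= eps / 4 * c)%R.
    by rewrite mulrA ler_wpM2r// ltW.
  have h3 : (K0 <= eps / 4 * c)%R.
    have : (`|K0| * 4 / eps <= c)%R by move: cc; rewrite /c1; lra.
    by rewrite ler_pdivrMr//; have := ler_norm K0; lra.
  move: h3; rewrite /K0; lra.
have h2 : 0 <= (2%:R : R)%:E by rewrite lee_fin.
apply: (le_trans (leeD (leeD (ltW r2P) low) (lee_wpmul2l h2 (ltW rhoP)))).
rewrite -EFinM -!EFinD lee_fin; lra.
Qed.

(** Each third of [eps] has its use: the starting time [N] of the sharp bound, the stretch from
    there to the crude bound, and the terms that do not grow with [c]. *)
Lemma delay_bound (eps : R) : (0 < eps)%R ->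
  exists2 c1 : R, (0 < c1)%R & forall c t0 E, (c1 <= c)%R -> (1 <= t0)%N ->
  filtration y t0.-1 E ->
  \int[P t0]_(w in E) maxe 0 (ctime (lr 1) c w - t0%:R%:E) <=
    Pinf E * (c / kappa * (1 + eps))%:E.
Proof.
move=> eps0; have [a1 [a3 [A0 [a10 a30 A00 cr]]]] := crude.
have eps3 : (0 < eps / 3)%R by rewrite divr_gt0.
(* The stretch up to [M] has about [a1 / a3 * c] terms of size [e]; this value makes them cost at
   most [eps / 3 * (c / kappa) + e]. *)
pose e := (eps / 3 / (kappa * (a1 / a3 + 1)))%R.
have a13 : (0 <= a1 / a3)%R by rewrite divr_ge0// ltW.
have a131 : (0 < a1 / a3 + 1)%R by rewrite ltr_wpDl.
have e0 : (0 < e)%R by rewrite divr_gt0// mulr_gt0.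
have [c1 c10 sh] := sharp eps3 e0.
pose r := expR (- a3).
have r01 : (0 < r < 1)%R by rewrite expR_gt0 -expR0 ltr_expR oppr_lt0.
pose B := (1 + e + A0 / (1 - r))%R.
have B0 : (0 <= B)%R.
  have /andP[r0 r1] := r01.
  have : (0 <= A0 / (1 - r))%R by apply: divr_ge0 => //; rewrite subr_ge0 ltW.
  by rewrite /B; lra.
pose c2 := (c1 + B * kappa / (eps / 3))%R.
have c2c1 : (c1 <= c2)%R by rewrite lerDl; apply: divr_ge0; [apply: mulr_ge0 => //; exact: ltW|exact: ltW].
exists c2; first exact: lt_le_trans c2c1.
move=> c t0 E cc t01 FE.
have c0 : (0 < c)%R by exact: lt_le_trans (le_trans c2c1 cc).
have mE := filtration_measurable y_dens FE.
have mlr n : measurable_fun setT (lr 1 n) by exact: (measurable_lik y_dens mg g0 mf f0 LRE).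
have mrun n : measurable (run (lr 1) c n) by exact: measurable_run.
rewrite integral_delay//.
pose X := ((1 + eps / 3) * c / kappa)%R.
have X0 : (0 <= X)%R by apply/ltW; rewrite /X divr_gt0// mulr_gt0// addr_gt0.
pose N := (Num.truncn X).+1.
pose M := (Num.truncn (a1 * c / a3)).+1.
have XN : (X <= N%:R)%R by rewrite ltW// truncnS_gt.
have NX : (N%:R <= X + 1)%R.
  by rewrite /N -natr1 lerD2r; have /andP[] := truncn_itv X0.
have Y0 : (0 <= a1 * c / a3)%R.
  by apply: divr_ge0; [apply: mulr_ge0 => //; exact: ltW|exact: ltW].
have MY : (M%:R <= a1 * c / a3 + 1)%R.
  by rewrite /M -natr1 lerD2r; have /andP[] := truncn_itv Y0.
have YM : (a1 * c <= a3 * M%:R)%R.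
  by rewrite [leRHS]mulrC -ler_pdivrMr// ltW// truncnS_gt.
pose w_ (i : nat) : R := if (i < N)%N then 1%R else if (i < M)%N then e else (A0 * r ^+ (i - M))%R.
have FPE : P t0 E = Pinf E.
  have FE0 : filtration y (t0.-1 + 0) E by rewrite addn0.
  rewrite (com t01 FE0) (eq_integral (cst 1)) ?integral_cst ?mul1e// => w _.
  by rewrite /lik/= LR_nil.
have qw i : P t0 (E `&` run (lr 1) c (t0 + i)) <= Pinf E * (w_ i)%:E.
  rewrite /w_; case: ltnP => iN.
    rewrite mule1 -FPE; apply: le_measure; rewrite ?inE//; exact: measurableI.
  case: ltnP => iM.
    (* Between [N] and [M] the probability is bounded by its value at [N], since the events of no
       alarm decrease. *)
    apply: le_trans (sh c N t0 E (le_trans c2c1 cc) XN t01 FE).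
    apply: le_measure; rewrite ?inE; [exact: measurableI|exact: measurableI|].
    apply: setIS; apply: sub_run.
    by apply: leq_add => //; exact: leq_pred.
  apply: (le_trans (cr c t0 E i c0 t01 FE)); apply: lee_wpmul2l => //.
  rewrite lee_fin ler_wpM2l// /r -expRM_natl ler_expR natrB//; lra.
apply: lime_le; first by apply: is_cvg_nneseries.
apply: nearW => n.
apply: (@le_trans _ _ (\sum_(i < n) (Pinf E * (w_ i)%:E))).
  by rewrite big_mkord; apply: lee_sum => i _; exact: qw.
rewrite -ge0_sume_distrr; last first.
  move=> i _; rewrite lee_fin /w_; case: ifP => // _; case: ifP => _; first exact: ltW.
  by rewrite mulr_ge0// exprn_ge0// expR_ge0.
apply: lee_wpmul2l => //; rewrite sumEFin lee_fin.
apply: (le_trans (sum_weights_le N M n r01 (ltW e0) A00)).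
have h1 : (B <= c / kappa * (eps / 3))%R.
  rewrite mulrAC ler_pdivlMr// -ler_pdivrMr//.
  by apply: le_trans cc; rewrite lerDr ltW.
have h2 : (M%:R * e <= eps / 3 * (c / kappa) + e)%R.
  apply: (@le_trans _ _ ((a1 * c / a3 + 1) * e)%R); first by rewrite ler_wpM2r// ltW.
  rewrite mulrDl mul1r lerD2r.
  have -> : (eps / 3 * (c / kappa) = (a1 * c / a3 + c) * e)%R.
    have h13 : (0 < a1 + a3)%R by rewrite ltr_wpDl.
    by rewrite /e; field; rewrite (gt_eqF kappa0) (gt_eqF a30) (gt_eqF h13).
  by rewrite ler_wpM2r ?lerDl// ltW.
have h3 : (X = c / kappa + eps / 3 * (c / kappa))%R by rewrite /X; ring.
move: h1 NX; rewrite h3 /B; lra.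
Qed.

End delay_bound.

(** * Bounds for the Ergodic CuSum *)

Lemma eq_ctime (R : realType) (T : Type) (L L' : nat -> T -> R) (c : R) w :
  (forall t, L t w = L' t w) -> ctime L c w = ctime L' c w.
Proof.
move=> LL; rewrite /ctime; congr ereal_inf.
have cs t : cstat L t w = cstat L' t w.
  by rewrite /cstat; apply: eq_bigr => i _; rewrite !LL.
by apply/seteqP; split=> _ [t [t1 ct] <-]; exists t => //; split=> //;
  [rewrite -cs|rewrite cs].
Qed.

Lemma measurable_ctime (R : realType) d (T : measurableType d) (L : nat -> T -> R) c :
  (forall t, measurable_fun setT (L t)) -> measurable_fun setT (ctime L c).
Proof.
move=> mL; have -> : ctime L c = fun w => (\sum_(n <oo) (\1_(run L c n) w)%:E)%E.
  by apply/funext => w; exact: ctime_run.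
apply: ge0_emeasurable_sum => [n w _ _|n _]; first by rewrite lee_fin.
by apply/measurable_EFinP; apply: measurable_indic; exact: measurable_run.
Qed.

Section wadd.
Local Open Scope ereal_scope.
Context (R : realType) (K : nat) d (Omega : measurableType d).
Variables (y : nat -> Omega -> 'cV[R]_K) (P : nat -> probability Omega R).
Hypothesis FM : forall t, filtration y t `<=` measurable.

(** The version [Z] is tested on the events that it exceeds [B] by at least [1 / (n + 1)]: they
    belong to the past, so the bound on integrals makes each of them null. *)
Lemma ess_sup_condexp_le (Q : probability Omega R) t (X Z : Omega -> \bar R) (B : R) :
  is_condexp Q (filtration y t) X Z -> (0 <= B)%R ->
  (forall E, filtration y t E -> \int[Q]_(w in E) X w <= Q E * B%:E) ->
  ess_sup Q Z <= B%:E.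
Proof.
move=> [FZ Z0 ZX] B0 XB; apply: ereal_inf_lbound => /=.
have mZ : measurable_fun setT Z.
  by move=> _ C mC; rewrite setTI; apply: (@FM t); exact: FZ.
pose E n := Z @^-1` [set x | (B + n.+1%:R^-1)%:E <= x].
have FE n : filtration y t (E n).
  by apply: FZ; rewrite -set_itvcy; exact: emeasurable_itv.
have mE n : measurable (E n) by exact: (FM (FE n)).
have E0 n : Q (E n) = 0.
  have e0 : (0 < n.+1%:R^-1 :> R)%R by rewrite invr_gt0.
  have : (B + n.+1%:R^-1)%:E * Q (E n) <= Q (E n) * B%:E.
    apply: le_trans (XB _ (FE n)); rewrite -ZX; last exact: FE.
    rewrite -integral_cst//; apply: ge0_le_integral => //.
    - by move=> w _; rewrite lee_fin addr_ge0// ltW.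
    - exact: measurable_funTS.
  have qE : Q (E n) = (fine (Q (E n)))%:E by rewrite fineK// fin_num_measure.
  have q0 : (0 <= fine (Q (E n)))%R by exact: fine_ge0.
  rewrite qE.
  rewrite -!EFinM lee_fin mulrDl mulrC gerDl pmulr_rle0// => h.
  by congr EFin; apply/eqP; rewrite eq_le h.
apply: (@negligibleS _ _ _ Q (\bigcup_n E n)); last first.
  by apply: negligible_bigcup => n; apply/(negligibleP _ (mE n)); exact: E0.
move=> w /= /negP; rewrite -ltNge => BZ.
move: BZ; rewrite /E; case Zw : (Z w) => [r| |]//.
  rewrite lte_fin => Br; exists (Num.truncn (r - B)^-1) => //=.
  rewrite Zw lee_fin -lerBrDl invf_ple ?posrE ?subr_gt0//.
  by apply/ltW/truncnS_gt.
by move=> _; exists 0%N => //=; rewrite Zw leey.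
Qed.

Lemma wadd_le (tau : Omega -> \bar R) (B : R) : (0 <= B)%R ->
  (forall t0 E, (1 <= t0)%N -> filtration y t0.-1 E ->
    \int[P t0]_(w in E) maxe 0 (tau w - t0%:R%:E) <= P t0 E * B%:E) ->
  wadd y P tau <= B%:E.
Proof.
move=> B0 tauB; apply: ge_ereal_sup => _ [t0 [Z [t01 ceZ ->]]].
by apply: (ess_sup_condexp_le ceZ) => // E FE; exact: tauB.
Qed.

End wadd.

Section cusum_bounds.
Local Open Scope ereal_scope.
Context (R : realType) (K : nat) d (Omega : measurableType d).
Local Notation V := ('cV[R]_K).
Local Notation lam := (@lebesgue_mx R K 1).
Variables (Pinf : probability Omega R) (phi : V -> R) (y : nat -> Omega -> V).
Hypotheses
  (y_dens : forall t, (1 <= t)%N -> has_density Pinf (y t) phi)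
  (y_ind : mutually_independent Pinf [set t | (1 <= t)%N] (fun t => sigma_vec (y t))).
Variables (A : 'M[R]_K) (g : V -> R) (f : V -> \bar R).
Hypotheses (mg : measurable_fun setT g) (g0 : forall x, (0 <= g x)%R).
Hypothesis g1 : \int[lam]_x (g x)%:E = 1.
Hypotheses (mf : measurable_fun setT f) (f0 : forall x, 0 <= f x).
Hypothesis phiB : forall x y, phi (y - x) = (phi y * expo x y)%R.
Hypothesis phi1 : \int[lam]_x (phi x)%:E = 1.
Variable LR : seq V -> R.
Hypotheses (LRE : forall ys, Lam A g f ys = (LR ys)%:E).
Hypotheses (LR_gt0 : forall ys, (0 < LR ys)%R) (LR_nil : LR [::] = 1%R).
Local Notation lr := (lik y LR).
Variable P : nat -> probability Omega R.
Hypothesis com : forall t0 n E, (1 <= t0)%N -> filtration y (t0.-1 + n) E ->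
  P t0 E = \int[Pinf]_(w in E) (lr t0 n w)%:E.
Variables (p1 pinf : forall t : nat, 'M[R]_(K, t) -> R).
Hypotheses (hp1 : forall t, has_density (P 1%N) (block y 1 t) (@p1 t))
  (hpinf : forall t, has_density Pinf (block y 1 t) (@pinf t)).

Local Notation ratio := (likelihood_ratio p1 pinf y).

Let mratio t : measurable_fun setT (ratio t).
Proof.
rewrite /likelihood_ratio; case: (t == 0%N) => //.
have [mb mp1 _ _] := hp1 t; have [_ mp p0 _] := hpinf t.
apply: measurable_funM; first exact: (measurableT_comp mp1 mb).
apply: measurable_invr_ge0; last by move=> w; exact: p0.
exact: (measurableT_comp mp mb).
Qed.

Let mlr n : measurable_fun setT (lr 1 n).
Proof. exact: (measurable_lik y_dens mg g0 mf f0 LRE). Qed.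

Let exceptional : exists N : nat -> set Omega, forall t,
  [/\ filtration y t (N t), Pinf (N t) = 0 & forall w, ~ N t w -> ratio t w = lr 1 t w].
Proof.
suff /choice[N NP] : forall t, exists N, [/\ filtration y t N, Pinf N = 0 &
    forall w, ~ N w -> ratio t w = lr 1 t w] by exists N.
case=> [|t].
  exists set0; split; [exact: (@measurable0 _ (filtrationType y 0%N))|exact: measure0|].
  by move=> w _; rewrite /likelihood_ratio/= /lik LR_nil.
have c1 E : filtration y t.+1 E -> P 1%N E = \int[Pinf]_(w in E) (lr 1 t.+1 w)%:E.
  by move=> FE; exact: (com (t0 := 1%N) (n := t.+1)).
have [N [FN PN NE]] := likelihood_ratio_ae y_dens mg g0 mf f0 LRE LR_gt0 c1 (hp1 t.+1) (hpinf t.+1).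
by exists N; split => // w Nw; rewrite /likelihood_ratio/= NE.
Qed.

(** Absolute continuity is available on each [filtration y t], with a density depending on [t];
    hence the exceptional sets have to be events of a finite horizon. *)
Let Pt_null t0 t N : (1 <= t0)%N -> filtration y t N -> Pinf N = 0 -> P t0 N = 0.
Proof.
move=> t01 FN N0.
have FN' : filtration y (t0.-1 + t) N by apply: sub_filtration FN; exact: leq_addl.
rewrite (com t01 FN'); apply: null_set_integral => //.
  exact: (filtration_measurable y_dens FN).
by apply: measurable_funTS; apply/measurable_EFinP; exact: (measurable_lik y_dens mg g0 mf f0 LRE).
Qed.

Let ratio_ae (Q : probability Omega R) :
  (forall t N, filtration y t N -> Pinf N = 0 -> Q N = 0) ->
  \forall w \ae Q, forall t, ratio t w = lr 1 t w.
Proof.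
move=> Q0; have [N NP] := exceptional.
apply: (@negligibleS _ _ _ Q (\bigcup_t N t)); last first.
  apply: negligible_bigcup => t; have [FN N0 _] := NP t.
  apply/negligibleP; last exact: (Q0 t).
  exact: (filtration_measurable y_dens FN).
move=> w /= /existsNP[t tw]; exists t => //; have [_ _ H] := NP t.
by apply: contrapT => /H.
Qed.

Let tau c := ctime ratio c.

Lemma cusum_false_alarm (gamma : R) : (0 < gamma)%R ->
  gamma%:E <= \int[Pinf]_w cusum_time p1 pinf y (ln gamma) w.
Proof.
move=> gamma0; have mtau : measurable_fun setT (tau (ln gamma)) by exact: measurable_ctime.
have tau0 w : 0 <= tau (ln gamma) w.
  by apply: le_ereal_inf_tmp => _ [s _ <-]; rewrite lee_fin.
rewrite -[X in _ <= X]/(\int[Pinf]_w tau (ln gamma) w).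
(* For [gamma] at most 1 the threshold is not positive and [false_alarm] does not apply, but an
   alarm time is always at least 1. *)
have [gamma1|gamma1] := leP gamma 1%R.
  apply: (@le_trans _ _ (\int[Pinf]_w 1)).
    by rewrite integral_cst// [X in _ * X]probability_setT mule1 lee_fin.
  apply: ge0_le_integral => // w _; apply: le_ereal_inf_tmp => _ [s [s1 _] <-].
  by rewrite lee_fin ler1n.
have := false_alarm y_dens y_ind mg g0 g1 mf f0 phiB phi1 LRE LR_gt0 (ln_gt0 gamma1).
have -> : expR (ln gamma) = gamma by rewrite lnK.
move=> /le_trans; apply; rewrite le_eqVlt; apply/orP; left; apply/eqP.
apply: ge0_ae_eq_integral => //; first exact: measurable_ctime.
  by move=> w _; apply: le_ereal_inf_tmp => _ [s _ <-]; rewrite lee_fin.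
have : \forall w \ae Pinf, forall t, ratio t w = lr 1 t w by exact: ratio_ae.
by apply: filterS => w Hw _; apply: eq_ctime => t; rewrite Hw.
Qed.

Variables (D p C Q theta : R).
Hypotheses (p0 : (0 <= p)%R) (Q0 : (0 <= Q)%R)
  (theta01 : (0 <= theta < 1)%R).
Hypothesis dichotomy : forall (c r2 rho : R) xs ys zs, (0 <= c)%R -> (0 <= r2)%R ->
  (0 <= rho)%R ->
  (forall i, (i < size xs)%N -> (LR (take i.+1 xs) <= expR c * LR (take i xs))%R) ->
  (forall y, y \in ys -> (dot y y <= r2)%R) ->
  (LR (xs ++ ys ++ zs) <= expR c * LR (xs ++ ys))%R ->
  (LR (ys ++ zs) <= expR (c + theta ^+ size ys * (p * c) + D +
      (size ys)%:R * (C + r2) + Q * rho))%R \/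
  Lam A g f (ys ++ zs) <= 2%:E * Lam A g (tail rho (alpha A g f ys)) zs.
Variable b : R.
Hypothesis b01 : (0 <= b < 1)%R.
Hypothesis ctr : forall ys y0,
  \int[lam]_z ((Num.sqrt (LR (rcons (rcons ys y0) z)))%:E * (phi z)%:E)
    <= (b * Num.sqrt (LR (rcons ys y0)))%:E.
Variables (Cf l : R).
Hypotheses (Cf0 : (0 <= Cf)%R) (l0 : (0 < l)%R).
Hypothesis f_tail : forall rho, (0 <= rho)%R ->
  \int[lam]_x tail rho f x <= (Cf * expR (- (l * rho)))%:E.
Variable kappa : R.
Hypothesis kappa0 : (0 < kappa)%R.
Hypothesis lim_ratio : \forall w \ae P 1%N,
  (fun t => t%:R^-1 * ln (p1 (block y 1 t w) / pinf (block y 1 t w)))%R @ \oo --> kappa.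

Let ratio_aet t0 : (1 <= t0)%N -> \forall w \ae P t0, forall t, ratio t w = lr 1 t w.
Proof. by move=> t01; apply: ratio_ae => t N; exact: Pt_null. Qed.

Let lim_lr : \forall w \ae P 1%N, (fun t => t%:R^-1 * ln (lr 1 t w))%R @ \oo --> kappa.
Proof.
have := ratio_aet (leqnn 1); apply: filterS2 lim_ratio => w lw rw.
apply: cvg_trans lw; apply: near_eq_cvg; exists 1%N => // t /= t1.
by rewrite -rw /likelihood_ratio (gtn_eqF t1).
Qed.

Lemma cusum_wadd (eps : R) : (0 < eps)%R ->
  exists2 c1 : R, (0 < c1)%R & forall c, (c1 <= c)%R ->
    wadd y P (cusum_time p1 pinf y c) <= (c / kappa * (1 + eps))%:E.
Proof.
move=> eps0.
have [c1 c10 H] := delay_bound y_dens y_ind mg g0 g1 mf f0 phiB phi1 LRE LR_gt0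
  LR_nil com p0 Q0 theta01 dichotomy b01 ctr Cf0 l0 f_tail kappa0 lim_lr eps0.
exists c1 => // c cc; apply: wadd_le.
- exact: (filtration_measurable y_dens).
- have c0 : (0 < c)%R by exact: lt_le_trans cc.
  by apply/ltW; rewrite mulr_gt0 ?divr_gt0 ?addr_gt0.
move=> t0 E t01 FE.
have FPE : P t0 E = Pinf E.
  have FE0 : filtration y (t0.-1 + 0) E by rewrite addn0.
  rewrite (com t01 FE0) (eq_integral (cst 1)) ?integral_cst ?mul1e//.
    exact: (filtration_measurable y_dens FE).
  by move=> w; rewrite /lik/= LR_nil.
rewrite FPE; apply: le_trans (H c t0 E cc t01 FE).
rewrite le_eqVlt; apply/orP; left; apply/eqP.
have mE := filtration_measurable y_dens FE.
apply: ge0_ae_eq_integral => //.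
- by apply: measurable_funTS; exact: measurable_delay.
- by apply: measurable_funTS; exact: measurable_delay.
- by move=> w _; rewrite le_max lexx.
- by move=> w _; rewrite le_max lexx.
have := ratio_aet t01; apply: filterS => w rw _.
by rewrite -(eq_ctime c rw).
Qed.

End cusum_bounds.

(** * The Gaussian model *)

Lemma has_density_integral1 d (Omega : measurableType d) (R : realType)
    (P : probability Omega R) m n (X : Omega -> 'M[R]_(m, n)) f :
  has_density P X f -> (\int[@lebesgue_mx R m n]_x (f x)%:E = 1)%E.
Proof.
by move=> [_ _ _ /(_ _ measurableT) <-]; rewrite preimage_setT probability_setT.
Qed.

Section gaussian_density.
Context (R : realType) (K : nat).
Local Notation V := ('cV[R]_K).
Local Notation lam := (@lebesgue_mx R K 1).
Implicit Types (mu x : V) (S : 'M[R]_K).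

Definition gauss_cst S : R := (Num.sqrt ((2 * pi) ^+ K * \det S))^-1.

Lemma gaussian_pdf0E S : gaussian_pdf 0 S =
  (fun x => gauss_cst S * expR (- (bform (invmx S) x x / 2))).
Proof. by apply/funext => x; rewrite /gaussian_pdf subr0. Qed.

Lemma gaussian_pdf1E : gaussian_pdf 0 (1%:M : 'M[R]_K) =
  (fun x => gauss_cst 1%:M * expR (- (dot x x / 2))).
Proof. by rewrite gaussian_pdf0E invmx1; apply/funext => x; rewrite bform1. Qed.

(** With a determinant that is not positive, the default values of the square root and of the
    inverse would make the whole function zero, and its integral could not be 1. *)
Lemma gauss_cst_gt0 mu S : (\int[lam]_x (gaussian_pdf mu S x)%:E = 1)%E ->
  0 < gauss_cst S.
Proof.
move=> f1; rewrite lt_neqAle invr_ge0 sqrtr_ge0 andbT; apply/negP => /eqP c0.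
move: f1; rewrite integral0_eq => [/eqP|x _]; first by rewrite eqe eq_sym oner_eq0.
by rewrite /gaussian_pdf -/(gauss_cst S) -c0 mul0r.
Qed.

Section posdef.
Variables (mu : V) (S : 'M[R]_K).
Hypotheses (Spos : posdefmx S) (c0 : 0 < gauss_cst S).

Lemma bform_invmx_ge0 x : 0 <= bform (invmx S) x x.
Proof.
have [l l0 /(_ x)] := posdef_inv_ge Spos; apply: le_trans.
by rewrite mulr_ge0 ?dot_ge0// ltW.
Qed.

Lemma gaussian_pdf_le x : gaussian_pdf mu S x <= gauss_cst S.
Proof.
rewrite /gaussian_pdf -/(gauss_cst S); apply: ler_piMr; first exact: ltW.
rewrite -[leRHS]expR0 ler_expR.
by rewrite oppr_le0 divr_ge0//; exact: bform_invmx_ge0.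
Qed.

Lemma gaussian_isG L : (forall x, bform (invmx S) x x <= L * dot x x) ->
  isG L (fun x => (gaussian_pdf mu S x)%:E).
Proof.
move=> SL; have [ST _] := Spos; have SiT := trmx_invmx ST.
exists (ln (gauss_cst S) - bform (invmx S) mu mu / 2), (invmx S *m mu), (invmx S).
split => //; first by move=> x; rewrite bform_invmx_ge0 SL.
apply/funext => x; rewrite /gaussian_pdf -/(gauss_cst S) /gf.
rewrite -{1}(lnK (x := gauss_cst S))// -expRD; congr (expR _)%:E.
rewrite -/(bform (invmx S) (x - mu) (x - mu)) !bformD.
have -> : dot (invmx S *m mu) x = bform (invmx S) x mu by rewrite bformE dotC.
by rewrite (bformC mu x SiT); field.
Qed.

Hypotheses (Z1_gt0 : (0 < Zg (1%:M : 'M[R]_K))%E)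
  (Z1_lty : (Zg (1%:M : 'M[R]_K) < +oo)%E).

(** From [|x - mu|^2 >= |x|^2 / 2 - |mu|^2], the exponent is at most [- l / 4 * |x|^2] up to a
    constant. Outside the ball, half of this is spent on the factor in [rho], and the other half
    stays integrable by [Zg_lty]. *)
Lemma gaussian_tail : exists Cf l : R, [/\ 0 <= Cf, 0 < l &
  forall rho, 0 <= rho -> (\int[lam]_x tail rho (fun x => (gaussian_pdf mu S x)%:E) x
    <= (Cf * expR (- (l * rho)))%:E)%E].
Proof.
have [l l0 Sl] := posdef_inv_ge Spos.
have l4 : 0 < l / 4 by rewrite divr_gt0.
have Zfin : Zg ((l / 4)%:M : 'M[R]_K) \is a fin_num.
  by rewrite ge0_fin_numE; [exact: (Zg_lty Z1_gt0 Z1_lty l4)|exact/ltW/(Zg_gt0 Z1_gt0)].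
pose Cf := gauss_cst S * expR (l / 2 * dot mu mu) * fine (Zg ((l / 4)%:M : 'M[R]_K)).
exists Cf, (l / 8); split.
- apply: mulr_ge0; first by apply: mulr_ge0; [exact: ltW|exact: expR_ge0].
  by apply: fine_ge0; exact/ltW/(Zg_gt0 Z1_gt0).
- by rewrite divr_gt0.
move=> rho rho0.
pose k := gauss_cst S * expR (l / 2 * dot mu mu) * expR (- (l / 8 * rho)).
have k0 : 0 <= k by rewrite !mulr_ge0 ?expR_ge0// ltW.
have mf : measurable_fun setT (fun x => (gaussian_pdf mu S x)%:E).
  by have [L _ SL] := bform_le_dot (invmx S); exact: isG_measurable (gaussian_isG SL).
have f0 x : (0 <= (gaussian_pdf mu S x)%:E)%E.
  by rewrite lee_fin mulr_ge0 ?expR_ge0// ltW.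
have mZ : measurable_fun setT (fun x => (gf 0 0 ((l / 4)%:M : 'M[R]_K) x)%:E).
  by apply/measurable_EFinP; exact: measurable_gf.
apply: (@le_trans _ _ (\int[lam]_x (k%:E * (gf 0 0 ((l / 4)%:M : 'M[R]_K) x)%:E))%E).
  apply: ge0_le_integral => //.
  - by move=> x _; rewrite /tail; case: ifP.
  - exact: measurable_tail.
  - exact: measurable_funeM.
  move=> x _; rewrite -EFinM /tail; case: ifPn => xr.
    by rewrite lee_fin mulr_ge0// gf_ge0.
  rewrite lee_fin /gaussian_pdf -/(gauss_cst S) /k -!mulrA ler_pM2l// /gf -!expRD ler_expR.
  rewrite -/(bform (invmx S) (x - mu) (x - mu)) dotC dot0r.
  have -> : bform ((l / 4)%:M : 'M[R]_K) x x = l / 4 * dot x x.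
    by rewrite -scalemx1 bformZm bform1.
  have := Sl (x - mu); set B := bform _ _ _.
  have : 0 <= l * (dot x x - rho).
    by rewrite mulr_ge0 ?subr_ge0 ?(ltW l0)// ltW// ltNge.
  have : 0 <= l * dot (x - 2 *: mu) (x - 2 *: mu) by rewrite mulr_ge0 ?dot_ge0// ltW.
  clearbody B; rewrite !bformD (dotC mu x); lra.
rewrite ge0_integralZl//.
- by rewrite -ZgI -(fineK Zfin) -EFinM lee_fin /k /Cf mulrAC.
- by move=> x _; rewrite lee_fin gf_ge0.
Qed.

End posdef.

End gaussian_density.

Theorem theorem3 (R : realType) (K : nat) (hK : (1 <= K)%N)
    (A Rw : 'M[R]_K) (f1 : 'cV[R]_K -> R)
    (hA : A \in unitmx) (hA1 : operator_norm A < 1)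
    (hRw : posdefmx Rw) (hf1 : is_gaussian_pdf f1)
    (d : measure_display) (Omega : measurableType d)
    (y : nat -> Omega -> 'cV[R]_K)
    (P : nat -> probability Omega R) (Pinf : probability Omega R)
    (hP : forall t0 : nat, (1 <= t0)%N -> change_model A Rw f1 y t0 (P t0))
    (hPinf : no_change_model y Pinf)
    (p : nat -> nat -> forall n : nat, 'M[R]_(K, n) -> R)
    (pinf : nat -> forall n : nat, 'M[R]_(K, n) -> R)
    (hp : forall t0 s n : nat, (1 <= t0)%N -> (1 <= s)%N ->
      has_density (P t0) (block y s n) (p t0 s n))
    (hpinf : forall s n : nat, (1 <= s)%N ->
      has_density Pinf (block y s n) (pinf s n))
    (kappa : R) (hkappa : 0 < kappa)
    (hlim : forall t0 : nat, (1 <= t0)%N ->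
      \forall w \ae P t0,
        (fun t : nat => t%:R^-1 *
          ln (p t0 t0 t (block y t0 t w) / pinf t0 t (block y t0 t w)))
        @ \oo --> kappa) :
  let tau (gamma : R) := cusum_time (p 1%N 1%N) (pinf 1%N) y (ln gamma) in
  (forall gamma : R, 0 < gamma ->
    (gamma%:E <= \int[Pinf]_w tau gamma w)%E) /\
  (exists2 e : R -> R, e x @[x --> +oo] --> (0 : R) &
    \forall gamma \near +oo,
      (wadd y P (tau gamma) <= (ln gamma / kappa * (1 + e gamma))%:E)%E).
Proof.
move=> tau; have [mu [S [Spos f1E]]] := hf1.
have [y_dens y_ind] := hPinf.
pose g x := gauss_cst Rw * expR (- (bform (invmx Rw) x x / 2)).
pose f x := (f1 x)%:E.
have gE : gaussian_pdf 0 Rw = g by exact: gaussian_pdf0E.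
(* A change at time 1 already provides the masses of [g] and [f]: innovations start at time 2, and
   the initial state has density [f1]. *)
have [nu [x [omega [[_ _ om_dens _ x_dens] _ _ _ _]]]] := hP 1%N isT.
have g1 : (\int[@lebesgue_mx R K 1]_x (g x)%:E = 1)%E.
  by rewrite -gE; exact: has_density_integral1 (om_dens 2%N isT).
have f1_1 : (\int[@lebesgue_mx R K 1]_x f x = 1)%E.
  exact: has_density_integral1 x_dens.
have phi1 : (\int[@lebesgue_mx R K 1]_x (gaussian_pdf 0 1%:M x)%:E = 1)%E.
  exact: has_density_integral1 (y_dens 1%N isT).
have cR0 : 0 < gauss_cst Rw by rewrite -gE in g1; exact: gauss_cst_gt0 g1.
have cI0 : 0 < gauss_cst (1%:M : 'M[R]_K) by exact: gauss_cst_gt0 phi1.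
have cf0 : 0 < gauss_cst S.
  by move: f1_1; rewrite /f f1E; exact: gauss_cst_gt0.
have phi1' := phi1; rewrite gaussian_pdf1E in phi1'.
have Z1_gt0 := Zg1_gt0 cI0 phi1'; have Z1_lty := Zg1_lty cI0 phi1'.
have RiT : (invmx Rw)^T = invmx Rw by apply: trmx_invmx; case: hRw.
have Ri0 z : 0 <= bform (invmx Rw) z z by exact: bform_invmx_ge0.
have [L1 L10 RiL1] := bform_le_dot (invmx Rw).
have [L2 L20 SL2] := bform_le_dot (invmx S).
pose L := Num.max L1 L2.
have L0 : 0 <= L by rewrite le_max L10.
have RiL z : bform (invmx Rw) z z <= L * dot z z.
  by apply: (le_trans (RiL1 z)); rewrite ler_wpM2r ?dot_ge0// le_max lexx.
have SL z : bform (invmx S) z z <= L * dot z z.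
  by apply: (le_trans (SL2 z)); rewrite ler_wpM2r ?dot_ge0// le_max lexx orbT.
have fG : isG L f by rewrite /f f1E; exact: gaussian_isG.
have mf := isG_measurable fG; have f0 z := isG_ge0 z fG.
have f_le z : (f z <= (gauss_cst S)%:E)%E.
  by rewrite lee_fin f1E; exact: gaussian_pdf_le.
have [Cf [l [Cf0 l0 f_tail]]] := gaussian_tail mu Spos cf0 Z1_gt0 Z1_lty.
have mg : measurable_fun setT g by exact: measurable_gauss_kernel.
have g0 z : 0 <= g z by exact: gauss_kernel_ge0.
have phiB (u v : 'cV[R]_K) : gaussian_pdf 0 1%:M (v - u) = gaussian_pdf 0 1%:M v * expo u v.
  by rewrite gaussian_pdf1E; exact: std_gaussB.
pose LR := LamR A (invmx Rw) (gauss_cst Rw) f.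
have LRE ys : Lam A g f ys = (LR ys)%:E.
  exact: (LamRE A RiT Ri0 cR0 Z1_gt0 Z1_lty g1 L0 RiL fG f1_1).
have LR_gt0 ys : 0 < LR ys.
  exact: (LamR_gt0 A RiT Ri0 cR0 Z1_gt0 Z1_lty g1 L0 RiL fG f1_1).
have LR_nil : LR [::] = 1 by exact: LamR_nil.
have [D [q [C [Q [theta [q0 C0 Q0 theta01 dichotomy]]]]]] :=
  likelihood_dichotomy A RiT Ri0 cR0 Z1_gt0 Z1_lty g1 L0 RiL fG f1_1 f_le.
have [b b01 ctr] := sqrt_LamR_contraction A hK RiT Ri0 cR0 cI0 g1 phi1' L0 RiL fG f1_1.
have com t0 n E : (1 <= t0)%N -> filtration y (t0.-1 + n) E ->
    P t0 E = (\int[Pinf]_(w in E) (lik y LR t0 n w)%:E)%E.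
  move=> t01 FE.
  have [nu' [x' [omega' [[nu_d nu_i om_d om_i x_d] al xE yb ya]]]] := hP t0 t01.
  rewrite gE in om_d.
  rewrite (change_of_measure t01 nu_d nu_i om_d om_i x_d al xE yb ya y_dens y_ind phiB FE).
  by apply: eq_integral => w _; rewrite -LRE.
have hp1 t : has_density (P 1%N) (block y 1 t) (p 1%N 1%N t) by exact: hp.
have hpinf1 t : has_density Pinf (block y 1 t) (pinf 1%N t) by exact: hpinf.
split.
  move=> gamma gamma0.
  exact: (cusum_false_alarm y_dens y_ind mg g0 g1 mf f0 phiB phi1 LRE LR_gt0
    LR_nil com hp1 hpinf1 gamma0).
have ctr' ys y0 : (\int[@lebesgue_mx R K 1]_z
    ((Num.sqrt (LR (rcons (rcons ys y0) z)))%:E * (gaussian_pdf 0 1%:M z)%:E)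
    <= (b * Num.sqrt (LR (rcons ys y0)))%:E)%E.
  by rewrite gaussian_pdf1E; exact: ctr.
have f_tail' rho : 0 <= rho ->
    (\int[@lebesgue_mx R K 1]_x tail rho f x <= (Cf * expR (- (l * rho)))%:E)%E.
  by rewrite /f f1E; exact: f_tail.
have W eps : 0 < eps -> exists2 c1 : R, 0 < c1 & forall c, c1 <= c ->
    (wadd y P (cusum_time (p 1%N 1%N) (pinf 1%N) y c) <= (c / kappa * (1 + eps))%:E)%E.
  by exact: (cusum_wadd y_dens y_ind mg g0 g1 mf f0 phiB phi1 LRE LR_gt0 LR_nil
    com hp1 hpinf1 q0 Q0 theta01 dichotomy b01 ctr' Cf0 l0 f_tail' hkappa (hlim 1%N isT)).
pose v gamma := wadd y P (tau gamma).
(* The relative excess of the worst delay itself, cut off at 0: the inequality is then a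
   rearrangement, and the estimate [W] serves for the limit and for finiteness. *)
exists (fun gamma => Num.max 0 (fine (v gamma) * kappa / ln gamma - 1)).
  apply/cvgrPdist_le => eps eps0; have [c1 c10 H] := W eps eps0.
  exists (expR c1); split => // gamma c1g.
  have lng : c1 <= ln gamma.
    by rewrite -[c1]expRK ler_ln ?posrE ?expR_gt0 ?ltW// (lt_trans _ c1g)// expR_gt0.
  have ln0 : 0 < ln gamma by exact: lt_le_trans lng.
  rewrite sub0r normrN ger0_norm; last by rewrite le_max lexx.
  rewrite ge_max (ltW eps0)/= lerBlDl ler_pdivrMr//.
  have : fine (v gamma) <= ln gamma / kappa * (1 + eps).
    have := H _ lng; rewrite -/(tau gamma) -/(v gamma); case: (v gamma) => [r| |]//=.
    by move=> _; rewrite mulr_ge0 ?addr_ge0 ?divr_ge0 ?ltW.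
  rewrite -(ler_pM2r hkappa) => /le_trans; apply.
  by rewrite mulrAC divfK ?gt_eqF// mulrC.
(* Any fixed precision shows that the delay is finite; for an infinite one [fine] would return 0 and
   the witness would say nothing. *)
have [c1 c10 H] := W 1 ltr01.
exists (expR c1); split => // gamma c1g.
have lng : c1 <= ln gamma.
  by rewrite -[c1]expRK ler_ln ?posrE ?expR_gt0 ?ltW// (lt_trans _ c1g)// expR_gt0.
have ln0 : 0 < ln gamma by exact: lt_le_trans lng.
have vfin : (v gamma < +oo)%E by apply: le_lt_trans (H _ lng) (ltry _).
rewrite -/(v gamma); apply: (@le_trans _ _ (fine (v gamma))%:E).
  by case: (v gamma) vfin => [r| |]//=; rewrite leNye.
rewrite lee_fin -ler_pdivrMl ?divr_gt0//.
rewrite -lerBlDl le_max; apply/orP; right.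
by rewrite invf_div mulrC mulrA.
Qed.
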